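(* Let $\mathbb{K}\in\{\mathbb{R},\mathbb{C}\}$ and let $m\geq 2$ be an integer. Put $M_{\mathbb{R}}=\frac{m(m+1)}{2}$ and $M_{\mathbb{C}}=m^2$. Assume that there exists a maximal equiangular tight frame in $\mathbb{K}^m$, i.e. an equiangular tight frame consisting of $M_{\mathbb{K}}$ vectors in $\mathbb{K}^m$. Then for every integer $k\geq 1$, $$\lambda_{\mathbb{K}}(kM_{\mathbb{K}}-m,\,kM_{\mathbb{K}})=\lambda_{\mathbb{K}}(m)-\frac{2m}{kM_{\mathbb{K}}}+1.$$ Moreover, this value is attained by an equiangular tight frame when $k=1$, and by a biangular tight frame when $k\geq 2$.
   Context: Projection constants. All Banach spaces are over $\mathbb{K}$. For a Banach space $X$ and a subspace $Y\subset X$, let $\lambda(Y,X)=\inf\{\|P\|: P:X\to Y \text{ a continuous linear projection onto } Y\}$ (with value $\infty$ if no such projection exists), where $P$ is a projection onto $Y$ if $P|_Y=\mathrm{Id}_Y$. The absolute projection constant of $Y$ is $\lambda(Y)=\sup\{\lambda(Y,X): Y\subset X\}$, the supremum being over all Banach spaces $X$ containing $Y$ as a subspace (isometrically). The maximal absolute projection constant is $\lambda_{\mathbb{K}}(m)=\sup\{\lambda(Y):\dim Y=m\}$. For integers $N\geq m$, the maximal relative projection constant is $\lambda_{\mathbb{K}}(m,N)=\sup\{\lambda(Y,\ell_\infty^{(N)}(\mathbb{K})): Y\subset\ell_\infty^{(N)}(\mathbb{K}),\ \dim Y=m\}$, where $\ell_\infty^{(N)}(\mathbb{K})$ is $\mathbb{K}^N$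 with the maximum norm. It is known that for integers $N\geq d\geq 1$, $$\lambda_{\mathbb{K}}(d,N)=\max\Big\{\sum_{i,j=1}^N t_it_j|V^*V|_{ij}: t\in\mathbb{R}_+^N,\ \|t\|_2=1,\ V\in\mathbb{K}^{d\times N},\ VV^*=I_d\Big\},$$ where $\mathbb{R}_+=[0,\infty)$ and $|V^*V|_{ij}$ is the absolute value of the $(i,j)$ entry of $V^*V$, i.e. $|\langle v_i,v_j\rangle|$ for the columns $v_1,\dots,v_N$ of $V$. Frames. A system $(u_1,\dots,u_N)$ of vectors in $\mathbb{K}^d$ is a tight frame if there is $\alpha>0$ with $\|x\|^2=\alpha\sum_{i=1}^N|\langle x,u_i\rangle|^2$ for all $x\in\mathbb{K}^d$; equivalently $UU^*=\frac1\alpha I_d$ for the matrix $U$ with columns $u_i$. It is a Parseval frame if $\alpha=1$. A tight frame of unit vectors is an equiangular tight frame if $|\langle u_i,u_j\rangle|$ takes the same value for all $i\neq j$. An equal-norm tight frame is called biangular if $|\langle u_i,u_j\rangle|$, $i\ne j$, takes exactly two distinct values. ''The value is attained by an equiangular (respectively biangular) tight frame'' means: with $N=kM_{\mathbb{K}}$ and $d=N-m$, there exist $V\in\mathbb{K}^{d\times N}$ with $VV^*=I_d$ and $t\in\mathbb{R}_+^N$ with $\|t\|_2=1$ such that $\sum_{i,j=1}^N t_it_j|V^*V|_{ij}=\lambda_{\mathbb{K}}(d,N)$ and the columns of $V$ all have the same norm and, after rescaling to unit norm, form an equiangular (respectively biangular) tight frame in $\mathbb{K}^d$. *)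

(* Defs.v *)
From HB Require Import structures.
From mathcomp Require Import all_boot all_order all_algebra.
From mathcomp Require Import complex.
From mathcomp Require Import all_classical all_reals all_analysis.

Set Implicit Arguments.
Unset Strict Implicit.
Unset Printing Implicit Defensive.

Import Order.TTheory GRing.Theory Num.Theory.
Import numFieldNormedType.Exports.

Local Open Scope classical_set_scope.
Local Open Scope ring_scope.

Inductive scalar_field := RealScalars | ComplexScalars.

Definition scalars (R : realType) (F : scalar_field) : numFieldType :=
  match F with
  | RealScalars => R
  | ComplexScalars => (R[i] : numFieldType)
  end.

Section Scalars.
Variables (R : realType) (F : scalar_field).

Definition conjK : scalars R F -> scalars R F :=
  match F return scalars R F -> scalars R F with
  | RealScalars => id
  | ComplexScalars => @conjc R
  end.

Definition reK : scalars R F -> R :=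
  match F return scalars R F -> R with
  | RealScalars => id
  | ComplexScalars => @complex.Re R
  end.

Definition ofR : R -> scalars R F :=
  match F return R -> scalars R F with
  | RealScalars => id
  | ComplexScalars => fun x => Complex x 0
  end.

(* MathComp norms over the field K take their values in K, here in the image
   of R; [rnorm] reads them in R. It applies to scalars and to vectors. *)
Definition rnorm (X : normedZmodType (scalars R F)) (x : X) : R := reK `|x|.

End Scalars.

Section ProjectionConstants.
Variables (R : realType) (F : scalar_field).
Local Notation K := (scalars R F).

Definition has_dim (X : lmodType K) (Y : set X) (m : nat) : Prop :=
  exists e : 'I_m -> X,
    (forall c : 'I_m -> K, \sum_i c i *: e i = 0 -> forall i, c i = 0) /\
    Y = [set x | exists c : 'I_m -> K, x = \sum_i c i *: e i].

Definition is_projection (X : normedModType K) (Y : set X)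
    (P : {linear X -> X}) : Prop :=
  [/\ continuous P, (forall x, Y (P x)) & forall y, Y y -> P y = y].

Definition opnorm (X : normedModType K) (P : X -> X) : \bar R :=
  ereal_sup [set (rnorm (P x))%:E | x in [set x : X | rnorm x <= 1]].

(* The infimum over the empty set is +oo. *)
Definition proj_const (X : normedModType K) (Y : set X) : \bar R :=
  ereal_inf [set c | exists2 P : {linear X -> X},
                       is_projection Y P & c = opnorm P].

(* "Y is isometrically a subspace of X" is a linear isometry j : Y -> X. *)
Definition abs_proj_const (Y : completeNormedModType K) : \bar R :=
  ereal_sup [set c | exists (X : completeNormedModType K)
                            (j : {linear Y -> X}),
                       (forall y, `|j y| = `|y|) /\
                       c = proj_const (range j)].

Definition max_abs_proj_const (m : nat) : \bar R :=
  ereal_sup [set c | exists Y : completeNormedModType K,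
                       has_dim [set: Y] m /\ c = abs_proj_const Y].

(* The library norm of 'rV[K]_N is the maximum norm. *)
Definition max_rel_proj_const (m N : nat) : \bar R :=
  ereal_sup [set c | exists Y : set 'rV[K]_N,
                       has_dim Y m /\ c = proj_const Y].

End ProjectionConstants.

Section Frames.
Variables (R : realType) (F : scalar_field).
Local Notation K := (scalars R F).

Definition adjmx (d N : nat) (A : 'M[K]_(d, N)) : 'M[K]_(N, d) :=
  map_mx (@conjK R F) A^T.

Definition inner (d : nat) (x y : 'cV[K]_d) : K :=
  \sum_(i < d) x i ord0 * conjK (y i ord0).

Definition norm2 (d : nat) (x : 'cV[K]_d) : R :=
  Num.sqrt (\sum_(i < d) rnorm (x i ord0) ^+ 2).

(* A system of N vectors in K^d is given by the columns of a d x N matrix. *)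
Definition tight_frame (d N : nat) (U : 'M[K]_(d, N)) : Prop :=
  exists2 a : R, 0 < a &
    forall x : 'cV[K]_d,
      norm2 x ^+ 2 = a * \sum_(i < N) rnorm (inner x (col i U)) ^+ 2.

Definition equiangular_tight_frame (d N : nat) (U : 'M[K]_(d, N)) : Prop :=
  [/\ tight_frame U,
      (forall i, norm2 (col i U) = 1) &
      exists c : R, forall i j, i != j ->
        rnorm (inner (col i U) (col j U)) = c].

Definition biangular_tight_frame (d N : nat) (U : 'M[K]_(d, N)) : Prop :=
  [/\ tight_frame U,
      (exists r : R, forall i, norm2 (col i U) = r) &
      exists a b : R,
        a != b /\
        [set x : R | exists i j, i != j /\
           x = rnorm (inner (col i U) (col j U))] = [set a; b]].

(* [P] is the property required of the rescaled columns of V. *)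
Definition attained_by (d N : nat) (P : 'M[K]_(d, N) -> Prop) : Prop :=
  exists (V : 'M[K]_(d, N)) (t : 'I_N -> R),
    [/\ V *m adjmx V = 1%:M,
        (forall i, 0 <= t i),
        Num.sqrt (\sum_(i < N) t i ^+ 2) = 1,
        (\sum_(i < N) \sum_(j < N)
           t i * t j * rnorm ((adjmx V *m V) i j))%:E
          = max_rel_proj_const R F d N &
        exists r : R, [/\ 0 < r, (forall i, norm2 (col i V) = r) &
                          P ((ofR F r)^-1 *: V)]].

End Frames.

(* m(m+1)/2 is an exact division. *)
Definition max_etf_size (F : scalar_field) (m : nat) : nat :=
  match F with
  | RealScalars => (m * (m + 1)) %/ 2
  | ComplexScalars => m ^ 2
  end.

(* Main.v *)
Require Import Defs.
From HB Require Import structures.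
From mathcomp Require Import all_boot all_order all_algebra.
From mathcomp Require Import complex.
From mathcomp Require Import all_classical all_reals all_analysis.
From mathcomp Require Import ring lra zify.

Set Implicit Arguments.
Unset Strict Implicit.
Unset Printing Implicit Defensive.

Import Order.TTheory GRing.Theory Num.Theory.
Import numFieldNormedType.Exports.

Local Open Scope classical_set_scope.
Local Open Scope ring_scope.

(** Upper bounds.  For positive weights [t], let [G] be the orthogonal projection
    onto the image of a subspace of l_inf^N under [D = diag t].  The oblique
    projection [D^-1 G D] is good on average, with average row sum
    [\sum t_i t_j |G_ij|], so by a minimax argument some projection has norm at
    most the supremum of these sums.  Finitely many Hahn-Banach functionals reduce
    a subspace of an arbitrary Banach space to this case.  Write
    [r_i = sqrt G_ii] and [|G_ij| = r_i r_j s_ij].  The quartic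
    [s <= a + b s^2 - c s^4], tight at 1 and at the angle [p] of a maximal
    equiangular tight frame, together with a lower bound for fourth moments
    (projection of the fourth-moment tensor onto invariant tensors) gives
    [\sum t_i t_j |G_ij| <= A (\sum t_i r_i)^2 + B Q] with [Q <= 1] and
    [(\sum t_i r_i)^2 <= m]; this is the bound for lambda(m).
    For rank N - m the projection is [1 - G], which changes the sum into
    [1 + \sum t_i t_j |G_ij| - 2 \sum t_i^2 G_ii].  The quartic still suffices
    when [A >= 2 / N].  This fails for k = 1, where AM-GM off the diagonal and a
    completed square on the diagonal do, and for real m = 2 and N = 6, where the
    first-moment constraints have to be used more carefully.

    Lower bounds.  If [G] is the projection built from k copies of a maximal
    equiangular tight frame, its sign matrix [S] commutes with [G], so
    [tr (S P) = tr (S G)] for every projection [P] onto the range of [G], whence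
    [N |P| >= tr (S G)].  The same applies to [1 - G] and [2 - S]. *)

(** * Scalars *)

(** Repeating the vectors of a frame, with the weights split accordingly, does not change the sum
    behind lambda(m), and N is arbitrary there. An estimate for s must therefore be sharp at s = 1
    also off the diagonal. The quadratic that touches s at p is not, which is why a quartic appears;
    even powers are used because their sums are polynomial in the entries of G and their conjugates.
    The fourth power enters with a negative sign, so fourth moments have to be bounded from below.
    That bound is an equality for projective 2-designs, and a maximal equiangular tight frame is
    one, so a single p makes all the estimates sharp at once. For rank N - m the diagonal loss is at
    least 2 X^2 / N, where X is the sum of t_i r_i. The coefficient of X^2 becomes A - 2 / N, and
    the bound X^2 <= m helps only if this is nonnegative. In the lower bounds S commutes with G
    because a common modulus off the diagonal makes the sign matrix of one copy affine in its
    projection. *)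

Section ScalarTheory.
Variables (R : realType) (F : scalar_field).
Local Notation K := (scalars R F).
Local Notation conj := (@conjK R F).
Local Notation re := (@reK R F).
Local Notation ofr := (@ofR R F).

Fact conjK_is_zmod_morphism : zmod_morphism conj.
Proof. by case: F => //= x y; rewrite raddfB. Qed.

HB.instance Definition _ :=
  GRing.isZmodMorphism.Build K K conj conjK_is_zmod_morphism.

Fact conjK_is_monoid_morphism : monoid_morphism conj.
Proof.
by case: F => //=; split=> [|x y]; rewrite ?rmorph1 // rmorphM.
Qed.

HB.instance Definition _ :=
  GRing.isMonoidMorphism.Build K K conj conjK_is_monoid_morphism.

Fact ofR_is_zmod_morphism : zmod_morphism ofr.
Proof. by case: F => //= x y; rewrite !complexr0 raddfB. Qed.

HB.instance Definition _ :=
  GRing.isZmodMorphism.Build R K ofr ofR_is_zmod_morphism.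

Fact ofR_is_monoid_morphism : monoid_morphism ofr.
Proof. by case: F => //=; split=> // x y; rewrite !complexr0 rmorphM. Qed.

HB.instance Definition _ :=
  GRing.isMonoidMorphism.Build R K ofr ofR_is_monoid_morphism.

Fact reK_is_zmod_morphism : zmod_morphism re.
Proof. by case: F => //= -[a b] [c d]. Qed.

HB.instance Definition _ :=
  GRing.isZmodMorphism.Build K R re reK_is_zmod_morphism.

Lemma reK_ofR x : re (ofr x) = x.
Proof. by case: F. Qed.

Lemma reK_ofRM x y : re (ofr x * y) = x * re y.
Proof. by case: F y => // -[a b] /=; rewrite mul0r subr0. Qed.

Lemma conjK_ofR x : conj (ofr x) = ofr x.
Proof. by case: F => //=; rewrite oppr0. Qed.

Lemma conjKK : involutive conj.
Proof. by case: F => //= x; rewrite conjcK. Qed.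

Lemma reK_conj x : re (conj x) = re x.
Proof. by case: F x => // -[]. Qed.

Lemma ofR_le x y : (ofr x <= ofr y) = (x <= y).
Proof. by case: F => //=; rewrite !complexr0 lecR. Qed.

Lemma ofR_lt x y : (ofr x < ofr y) = (x < y).
Proof. by case: F => //=; rewrite !complexr0 ltcR. Qed.

Lemma ofR_inj : injective ofr.
Proof. by move=> x y xy; rewrite -[x]reK_ofR xy reK_ofR. Qed.

Lemma ge0_ofR (x : K) : 0 <= x -> x = ofr (re x).
Proof.
by case: F x => //= -[a b]; rewrite lecE /= => /andP[/eqP ->].
Qed.

Lemma rnormE (X : normedZmodType K) (x : X) : `|x| = ofr (rnorm x).
Proof. by apply: ge0_ofR. Qed.

Lemma rnorm_ge0 (X : normedZmodType K) (x : X) : 0 <= rnorm x.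
Proof. by rewrite -ofR_le -rnormE rmorph0. Qed.

Lemma rnormD (X : normedZmodType K) (x y : X) : rnorm (x + y) <= rnorm x + rnorm y.
Proof. by rewrite -ofR_le rmorphD /= -!rnormE ler_normD. Qed.

Lemma rnormN (X : normedZmodType K) (x : X) : rnorm (- x) = rnorm x.
Proof. by rewrite /rnorm normrN. Qed.

Lemma rnorm0 (X : normedZmodType K) : rnorm (0 : X) = 0.
Proof. by rewrite /rnorm normr0 raddf0. Qed.

Lemma rnorm_eq0 (X : normedZmodType K) (x : X) : (rnorm x == 0) = (x == 0).
Proof. by rewrite -(inj_eq ofR_inj) -rnormE rmorph0 normr_eq0. Qed.

Lemma rnorm_sum (X : normedZmodType K) I (r : seq I) (P : pred I) (f : I -> X) :
  rnorm (\sum_(i <- r | P i) f i) <= \sum_(i <- r | P i) rnorm (f i).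
Proof.
elim/big_rec2: _ => [|i x y _ h]; first by rewrite rnorm0.
by rewrite (le_trans (rnormD _ _)) // lerD2l.
Qed.

Lemma rnormM (x y : K) : rnorm (x * y) = rnorm x * rnorm y.
Proof. by apply: ofR_inj; rewrite rmorphM /= -!rnormE normrM. Qed.

Lemma rnorm_ofR x : rnorm (ofr x) = `|x|.
Proof.
rewrite /rnorm; case: F => //=.
by rewrite expr0n addr0 sqrtr_sqr.
Qed.

Lemma rnorm_conj (x : K) : rnorm (conj x) = rnorm x.
Proof.
by rewrite /rnorm; case: F x => //= -[a b] /=; rewrite sqrrN.
Qed.

Lemma rnormZ (X : normedModType K) (a : K) (x : X) : rnorm (a *: x) = rnorm a * rnorm x.
Proof. by apply: ofR_inj; rewrite rmorphM /= -!rnormE normrZ. Qed.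

Lemma mul_conjK (x : K) : x * conj x = ofr (rnorm x ^+ 2).
Proof.
rewrite rmorphXn /= -rnormE.
case: F x => /= x; first by rewrite real_normK ?num_real // expr2.
rewrite -add_Re2_Im2; case: x => a b; simpc => /=.
by rewrite -complexr0 !expr2 [b * a]mulrC addNr.
Qed.

Lemma reK_le (x : K) : `|re x| <= rnorm x.
Proof.
rewrite -ler_sqr ?nnegrE ?rnorm_ge0 // real_normK ?num_real //.
rewrite -ofR_le -mul_conjK.
case: F x => /= x; first by rewrite -expr2.
by case: x => a b; rewrite lecE /=; apply/andP; split;
  [apply/eqP; ring | rewrite mulrN opprK -expr2 lerDl -expr2 sqr_ge0].
Qed.

Lemma reK_ler (x : K) : re x <= rnorm x.
Proof. by apply: le_trans (reK_le x); rewrite ler_norm. Qed.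

(** The value 1 at 0 keeps [phase] unimodular everywhere, so a row of phases has norm at most 1. *)
Definition phase (x : K) : K := if x == 0 then 1 else ofr (rnorm x)^-1 * conj x.

Lemma mul_phase x : phase x * x = ofr (rnorm x).
Proof.
rewrite /phase; case: eqVneq => [->|x0]; first by rewrite mulr0 rnorm0 rmorph0.
rewrite -mulrA [conj x * x]mulrC mul_conjK -rmorphM /=; congr ofr.
by rewrite expr2 mulrA mulVf ?mul1r // rnorm_eq0.
Qed.

Lemma rnorm1 : rnorm (1 : K) = 1.
Proof. by rewrite /rnorm normr1 -(rmorph1 ofr) reK_ofR. Qed.

Lemma rnorm_phase x : rnorm (phase x) = 1.
Proof.
rewrite /phase; case: eqVneq => [_|x0]; first exact: rnorm1.
rewrite rnormM rnorm_ofR rnorm_conj ger0_norm ?invr_ge0 ?rnorm_ge0 //.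
by rewrite mulVf ?rnorm_eq0.
Qed.

(* The imaginary unit, with the junk value 0 over the reals. *)
Definition iK : K :=
  match F return scalars R F with
  | RealScalars => 0
  | ComplexScalars => Complex 0 1
  end.

Definition imK (x : K) : R := - re (iK * x).

Lemma scalarsE (x : K) : x = ofr (re x) + ofr (imK x) * iK.
Proof.
rewrite /imK /iK; case: F x => /= x; first by rewrite mulr0 addr0.
by case: x => a b; simpc; apply/eqP; rewrite eq_complex /= !eqxx.
Qed.

Lemma rnorm_iK : rnorm iK <= 1.
Proof.
rewrite /iK /rnorm; case: F => /=; first by rewrite normr0.
by rewrite expr0n add0r expr1n sqrtr1.
Qed.

Lemma imK_is_zmod_morphism : zmod_morphism imK.
Proof. by move=> x y; rewrite /imK mulrBr raddfB opprB opprK addrC. Qed.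

HB.instance Definition _ :=
  GRing.isZmodMorphism.Build K R imK imK_is_zmod_morphism.

Lemma imK_le (x : K) : `|imK x| <= rnorm x.
Proof.
rewrite /imK normrN (le_trans (reK_le _)) // rnormM.
by rewrite ler_piMl ?rnorm_ge0 // rnorm_iK.
Qed.

End ScalarTheory.

(** * Real inequalities *)

Section RealInequalities.
Variable R : realType.

Lemma sum_CauchySchwarz (I : finType) (a b : I -> R) :
  (\sum_i a i * b i) ^+ 2 <= (\sum_i a i ^+ 2) * (\sum_i b i ^+ 2).
Proof.
set A := \sum_i a i ^+ 2; set B := \sum_i b i ^+ 2; set D := \sum_i _.
have B0 : 0 <= B by apply: sumr_ge0 => i _; rewrite sqr_ge0.
case: (eqVneq B 0) => [BE|Bn].
  suff -> : D = 0 by rewrite BE mulr0 expr0n.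
  rewrite /D big1 // => i _.
  move/eqP: BE; rewrite psumr_eq0 => [/allP /(_ i)|j _]; last exact: sqr_ge0.
  by rewrite mem_index_enum sqrf_eq0 => /(_ isT) /eqP ->; rewrite mulr0.
have : 0 <= \sum_i (a i * B - b i * D) ^+ 2 by apply: sumr_ge0 => i _; rewrite sqr_ge0.
have -> : \sum_i (a i * B - b i * D) ^+ 2 = B * (A * B - D ^+ 2).
  have h i : (a i * B - b i * D) ^+ 2 =
      B ^+ 2 * a i ^+ 2 + (- 2 * B * D) * (a i * b i) + D ^+ 2 * b i ^+ 2 by ring.
  by rewrite (eq_bigr _ (fun i _ => h i)) !big_split /= -!mulr_sumr -/A -/B -/D; ring.
by rewrite pmulr_rge0 ?subr_ge0 // lt0r Bn.
Qed.

Lemma sum_sqr_ge (N : nat) (x : 'I_N -> R) (hN : (0 < N)%N) :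
  (\sum_i x i) ^+ 2 / N%:R <= \sum_i x i ^+ 2.
Proof.
rewrite ler_pdivrMr ?ltr0n //.
have := sum_CauchySchwarz x (fun=> 1).
rewrite (eq_bigr x) => [|i _]; last by rewrite mulr1.
by under [X in _ * X]eq_bigr do rewrite expr1n; rewrite sumr_const card_ord.
Qed.

Lemma sum_mul_sum (I : finType) (a b : I -> R) :
  (\sum_i a i) * (\sum_j b j) = \sum_i \sum_j a i * b j.
Proof. by rewrite mulr_suml; apply: eq_bigr => i _; rewrite mulr_sumr. Qed.

Lemma sum_sqr (I : finType) (a : I -> R) :
  (\sum_i a i) ^+ 2 = \sum_i \sum_j a i * a j.
Proof. by rewrite expr2 sum_mul_sum. Qed.

(** The coefficients solve three linear conditions on a + b s^2 - c s^4: value p and slope 1 at p,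
    value 1 at 1. *)
Definition quartic_c (p : R) := (2 * p * (1 + p) ^+ 2)^-1.
Definition quartic_a (p : R) := quartic_c p * (p ^+ 2 * (1 + 2 * p)).
Definition quartic_b (p : R) := quartic_c p * (1 + 2 * p + 3 * p ^+ 2).

Lemma quartic_c_ge0 (p : R) : 0 <= p -> 0 <= quartic_c p.
Proof. by move=> p0; rewrite invr_ge0 mulr_ge0 ?sqr_ge0 ?mulr_ge0. Qed.

(* The quartic touches [s] at [p] and meets it at [1]. *)
Lemma le_quartic (p s : R) : 0 < p -> 0 <= s <= 1 ->
  s <= quartic_a p + quartic_b p * s ^+ 2 - quartic_c p * s ^+ 4.
Proof.
move=> p0 /andP[s0 s1].
rewrite -subr_ge0.
(* The cubic term is absent, so the roots p, p, 1 and the fourth one sum to zero; this gives the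
   factor s + 1 + 2 p. *)
have -> : quartic_a p + quartic_b p * s ^+ 2 - quartic_c p * s ^+ 4 - s =
    quartic_c p * ((s - p) ^+ 2 * ((1 - s) * (s + 1 + 2 * p))).
  rewrite /quartic_a /quartic_b /quartic_c; field.
  by apply/andP; split; apply: lt0r_neq0; lra.
apply: mulr_ge0; first by apply: quartic_c_ge0; exact: ltW.
by apply: mulr_ge0; [exact: sqr_ge0 | apply: mulr_ge0; lra].
Qed.

(** * Weighted sums of moduli: the quartic estimate *)

Section FrameData.
Variables (N : nat) (mu : R) (g : 'I_N -> 'I_N -> R) (r t : 'I_N -> R).
Hypotheses (g0 : forall i j, 0 <= g i j) (gC : forall i j, g i j = g j i).
Hypotheses (gii : forall i, g i i = r i ^+ 2) (gle : forall i j, g i j <= r i * r j).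
Hypotheses (r0 : forall i, 0 <= r i) (t0 : forall i, 0 <= t i).
Hypotheses (tight : forall i, \sum_j g i j ^+ 2 = r i ^+ 2).
Hypotheses (trace : \sum_i r i ^+ 2 = mu) (tnorm : \sum_i t i ^+ 2 = 1).

Let x i := t i * r i.
Let X := \sum_i x i.
(** Where r_i r_j = 0 the quotient is 0 by convention, and g_ij vanishes as well, so the identities
    relating s and g survive. *)
Let s i j := g i j / (r i * r j).

Let x0 i : 0 <= x i. Proof. exact: mulr_ge0. Qed.

Let g_r0 i j : r i = 0 -> g i j = 0.
Proof.
by move=> ri; apply/eqP; rewrite eq_le g0 andbT (le_trans (gle i j)) // ri mul0r.
Qed.

Let xxs i j : x i * x j * s i j = t i * t j * g i j.
Proof.
rewrite /x /s; case: (eqVneq (r i) 0) => [ri|ri].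
  by rewrite (g_r0 j ri) ri !(mulr0, mul0r).
case: (eqVneq (r j) 0) => [rj|rj].
  by rewrite gC (g_r0 i rj) rj !(mulr0, mul0r).
by field; rewrite ri rj.
Qed.

Let s_itv i j : 0 <= s i j <= 1.
Proof.
rewrite /s divr_ge0 ?mulr_ge0 //=.
case: (eqVneq (r i * r j) 0) => [->|rij]; first by rewrite invr0 mulr0.
by rewrite ler_pdivrMr ?mul1r // lt0r rij mulr_ge0.
Qed.

Let Q := \sum_i \sum_j (t i / r i) * (t j / r j) * g i j ^+ 2.

(** Expand the nonnegative sum of g_ij^2 (t_i / r_i - t_j / r_j)^2. By tightness each of the two
    square terms sums to at most 1; indices with r_i = 0 contribute nothing, hence an inequality. *)
Let Q_le1 : Q <= 1.
Proof.
have h : 0 <= \sum_i \sum_j g i j ^+ 2 * (t i / r i - t j / r j) ^+ 2.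
  by do 2!(apply: sumr_ge0 => ? _); rewrite mulr_ge0 ?sqr_ge0.
have e1 : \sum_i \sum_j g i j ^+ 2 * (t i / r i) ^+ 2 <= 1.
  rewrite -tnorm ler_sum // => i _.
  rewrite -mulr_suml tight -exprMn mulrCA.
  case: (eqVneq (r i) 0) => [->|ri]; first by rewrite mul0r mulr0 expr0n sqr_ge0.
  by rewrite divff // mulr1.
have e2 : \sum_i \sum_j g i j ^+ 2 * (t j / r j) ^+ 2 =
          \sum_i \sum_j g i j ^+ 2 * (t i / r i) ^+ 2.
  by rewrite exchange_big /=; do 2!(apply: eq_bigr => ? _); rewrite gC.
have : \sum_i \sum_j g i j ^+ 2 * (t i / r i - t j / r j) ^+ 2 =
   \sum_i \sum_j g i j ^+ 2 * (t i / r i) ^+ 2 +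
   \sum_i \sum_j g i j ^+ 2 * (t j / r j) ^+ 2 + (-2) * Q.
  rewrite /Q mulr_sumr -!big_split; apply: eq_bigr => i _ /=.
  by rewrite mulr_sumr -!big_split; apply: eq_bigr => j _ /=; ring.
move: h e1; rewrite e2; lra.
Qed.

Let X2_le : X ^+ 2 <= mu.
Proof. by have := sum_CauchySchwarz t r; rewrite tnorm mul1r trace. Qed.

(* [e] is 1 in the real case and 0 in the complex case. *)
Variables (e p : R).
Hypothesis quartic_moment : forall y : 'I_N -> R,
  (4 + 2 * e) / (mu + 2 + 2 * e) *
    (\sum_i \sum_j y i * y j * r i ^+ 2 * r j ^+ 2 * g i j ^+ 2
     - (\sum_i y i * r i ^+ 4) ^+ 2 / (2 * mu + 2 + 2 * e))
  <= \sum_i \sum_j y i * y j * g i j ^+ 4.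
Hypotheses (p_gt0 : 0 < p) (pE : p ^+ 2 * (mu + 1 + e) = 1).
Hypotheses (mu_ge2 : 2 <= mu) (e_itv : e = 0 \/ e = 1).

(** These are the B and, below, the A of the overview: c times the fourth-moment bound is subtracted
    from the quartic estimate, which lowers the coefficient of Q and raises that of X^2. *)
Definition quadratic_coef :=
  quartic_b p - quartic_c p * ((4 + 2 * e) / (mu + 2 + 2 * e)).
Definition constant_coef :=
  quartic_a p + quartic_c p * ((4 + 2 * e) / (mu + 2 + 2 * e) / (2 * mu + 2 + 2 * e)).

Lemma quadratic_coef_ge0 : 0 <= quadratic_coef.
Proof.
rewrite /quadratic_coef /quartic_b -mulrBr mulr_ge0 //.
  by apply: quartic_c_ge0; exact: ltW.
rewrite subr_ge0; apply: (@le_trans _ _ 1); last by have := sqr_ge0 p; move: p_gt0; lra.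
by rewrite ler_pdivrMr; move: mu_ge2; case: e_itv => ->; lra.
Qed.

Lemma quartic_bound :
  \sum_i \sum_j t i * t j * g i j <= constant_coef * X ^+ 2 + quadratic_coef * Q.
Proof.
(* This exponent makes y_i r_i^2 = t_i / r_i and y_i r_i^4 = t_i r_i, so that the moment inequality
   is expressed in Q and X. *)
pose y i := t i / r i ^+ 3.
have yr2 i : y i * r i ^+ 2 = t i / r i.
  rewrite /y; case: (eqVneq (r i) 0) => [->|ri]; first by rewrite !expr0n /= invr0 !mulr0.
  by field.
have yr4 i : y i * r i ^+ 4 = x i.
  rewrite /y /x; case: (eqVneq (r i) 0) => [->|ri]; first by rewrite !expr0n /= !mulr0.
  by field.
have c0 : 0 <= quartic_c p.
  by apply: quartic_c_ge0; exact: ltW.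
have s2 i j : x i * x j * s i j ^+ 2 = (t i / r i) * (t j / r j) * g i j ^+ 2.
  rewrite /x /s; case: (eqVneq (r i) 0) => [ri|ri].
    by rewrite (g_r0 j ri) ri !(mulr0, mul0r, expr0n) /=.
  case: (eqVneq (r j) 0) => [rj|rj].
    by rewrite gC (g_r0 i rj) rj !(mulr0, mul0r, expr0n) /=.
  by field; rewrite ri rj.
have s4 i j : x i * x j * s i j ^+ 4 = y i * y j * g i j ^+ 4.
  rewrite /x /s /y; case: (eqVneq (r i) 0) => [ri|ri].
    by rewrite (g_r0 j ri) ri !(mulr0, mul0r, expr0n) /=.
  case: (eqVneq (r j) 0) => [rj|rj].
    by rewrite gC (g_r0 i rj) rj !(mulr0, mul0r, expr0n) /=.
  by field; rewrite ri rj.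
apply: (@le_trans _ _ (quartic_a p * X ^+ 2 + quartic_b p * Q
   - quartic_c p * \sum_i \sum_j y i * y j * g i j ^+ 4)).
  rewrite /X sum_sqr /Q -mulrN -sumrN !mulr_sumr -!big_split ler_sum // => i _ /=.
  rewrite -sumrN !mulr_sumr -!big_split ler_sum // => j _ /=.
  rewrite -xxs -s2 -s4.
  have -> : quartic_a p * (x i * x j) + quartic_b p * (x i * x j * s i j ^+ 2) +
     quartic_c p * - (x i * x j * s i j ^+ 4) = x i * x j *
     (quartic_a p + quartic_b p * s i j ^+ 2 - quartic_c p * s i j ^+ 4) by ring.
  by rewrite ler_wpM2l ?mulr_ge0 // le_quartic.
have := quartic_moment y.
have -> : \sum_i \sum_j y i * y j * r i ^+ 2 * r j ^+ 2 * g i j ^+ 2 = Q.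
  apply: eq_bigr => i _; apply: eq_bigr => j _.
  by rewrite -(yr2 i) -(yr2 j); ring.
rewrite (eq_bigr x) // -/X => /(ler_wpM2l c0).
rewrite /constant_coef /quadratic_coef; set S := \sum_i \sum_j _.
set u := (4 + 2 * e) / _; set v := (2 * mu + _ + _).
rewrite mulrBr mulrBr => h.
have -> : (quartic_a p + quartic_c p * (u / v)) * X ^+ 2 +
  (quartic_b p - quartic_c p * u) * Q = quartic_a p * X ^+ 2 + quartic_b p * Q
   - (quartic_c p * (u * Q) - quartic_c p * (u * (X ^+ 2 / v))) by ring.
by rewrite lerD2l lerN2.
Qed.

Lemma constant_coef_ge0 : 0 <= constant_coef.
Proof.
have c0 : 0 <= quartic_c p.
  by apply: quartic_c_ge0; exact: ltW.
rewrite /constant_coef addr_ge0 //; first by rewrite /quartic_a mulr_ge0 // mulr_ge0 ?sqr_ge0 //; move: p_gt0; lra.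
by rewrite mulr_ge0 // !divr_ge0 //; move: mu_ge2; case: e_itv => ->; lra.
Qed.

Lemma weighted_sum_le :
  \sum_i \sum_j t i * t j * g i j <= constant_coef * mu + quadratic_coef.
Proof.
apply: le_trans quartic_bound _; apply: lerD.
  by rewrite ler_wpM2l ?constant_coef_ge0.
by rewrite -[leRHS]mulr1 ler_wpM2l ?quadratic_coef_ge0.
Qed.

(** By Cauchy-Schwarz the diagonal sum is at least X^2 / N. The net coefficient of X^2 is then
    [constant_coef] - 2 / N, whose sign decides whether X^2 <= mu may be inserted. *)
Lemma weighted_sum_diag_le (hN : (0 < N)%N) : 2 / N%:R <= constant_coef ->
  \sum_i \sum_j t i * t j * g i j - 2 * (\sum_i t i ^+ 2 * g i i)
   <= constant_coef * mu + quadratic_coef - 2 * mu / N%:R.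
Proof.
move=> hc.
have hX : X ^+ 2 / N%:R <= \sum_i t i ^+ 2 * g i i.
  have := sum_sqr_ge x hN; rewrite -/X => h; apply: le_trans h _.
  by rewrite ler_sum // => i _; rewrite gii /x exprMn.
have := quartic_bound.
have : quadratic_coef * Q <= quadratic_coef.
  by rewrite -[leRHS]mulr1 ler_wpM2l ?quadratic_coef_ge0.
have : (constant_coef - 2 / N%:R) * X ^+ 2 <= (constant_coef - 2 / N%:R) * mu.
  by rewrite ler_wpM2l // subr_ge0.
rewrite !mulrBl.
have -> : 2 / N%:R * X ^+ 2 = 2 * (X ^+ 2 / N%:R) by ring.
have -> : 2 / N%:R * mu = 2 * mu / N%:R by ring.
move: hX; set S := \sum_i \sum_j _; set D := \sum_i _ * _.
lra.
Qed.

End FrameData.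

(* AM-GM off the diagonal; on the diagonal the deficit is a complete square. *)
Lemma weighted_sum_equiangular_le (N : nat) (mu al : R) (g : 'I_N -> 'I_N -> R)
    (t : 'I_N -> R) (hN : (0 < N)%N) (al0 : 0 < al)
    (tight : forall i, \sum_j g i j ^+ 2 = g i i)
    (trace : \sum_i g i i = mu) (tnorm : \sum_i t i ^+ 2 = 1) :
  \sum_i \sum_j t i * t j * g i j - 2 * (\sum_i t i ^+ 2 * g i i)
   <= al + mu / (4 * al) - (2 * al + mu) ^+ 2 / (4 * al) / N%:R.
Proof.
have al4 : 0 < 4 * al by rewrite mulr_gt0.
pose x i := 2 * al * t i ^+ 2 + g i i.
have Ex : \sum_i x i = 2 * al + mu.
  by rewrite big_split /= -mulr_sumr tnorm mulr1 trace.
have pair a b c : a * b * c <= al * a ^+ 2 * b ^+ 2 + (4 * al)^-1 * c ^+ 2.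
  rewrite -subr_ge0.
  have -> : al * a ^+ 2 * b ^+ 2 + (4 * al)^-1 * c ^+ 2 - a * b * c =
    (4 * al)^-1 * (2 * al * a * b - c) ^+ 2.
    by field; rewrite lt0r_neq0.
  by rewrite mulr_ge0 ?sqr_ge0 // invr_ge0 ltW.
have step i : \sum_j t i * t j * g i j - 2 * (t i ^+ 2 * g i i) <=
   \sum_j (al * t i ^+ 2 * t j ^+ 2 + (4 * al)^-1 * g i j ^+ 2)
     - (4 * al)^-1 * x i ^+ 2.
  rewrite (bigD1 i) //= [in leRHS](bigD1 i) //=.
  set d := 2 * (t i ^+ 2 * g i i).
  have -> : t i * t i * g i i = al * t i ^+ 2 * t i ^+ 2 + (4 * al)^-1 * g i i ^+ 2
     - (4 * al)^-1 * x i ^+ 2 + d.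
    by rewrite /d /x; field; rewrite lt0r_neq0.
  have : \sum_(j | j != i) t i * t j * g i j <= \sum_(j | j != i)
     (al * t i ^+ 2 * t j ^+ 2 + (4 * al)^-1 * g i j ^+ 2).
    by apply: ler_sum => j _; exact: pair.
  lra.
have E : \sum_i (\sum_j (al * t i ^+ 2 * t j ^+ 2 + (4 * al)^-1 * g i j ^+ 2)
     - (4 * al)^-1 * x i ^+ 2) = al + mu / (4 * al) - (4 * al)^-1 * \sum_i x i ^+ 2.
  rewrite sumrB -mulr_sumr; congr (_ - _).
  transitivity (\sum_i (al * t i ^+ 2 + (4 * al)^-1 * g i i)).
    apply: eq_bigr => i _; rewrite big_split /= -!mulr_sumr tnorm mulr1.
    by rewrite tight.
  by rewrite big_split /= -!mulr_sumr tnorm mulr1 trace [in RHS]mulrC.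
have h : \sum_i (\sum_j t i * t j * g i j - 2 * (t i ^+ 2 * g i i)) <=
   al + mu / (4 * al) - (4 * al)^-1 * \sum_i x i ^+ 2.
  by rewrite -E; apply: ler_sum => i _; exact: step.
rewrite sumrB -mulr_sumr in h; apply: le_trans h _.
have := sum_sqr_ge x hN; rewrite Ex => hx.
by rewrite lerD2l lerN2 mulrAC mulrC ler_wpM2l // invr_ge0 ltW.
Qed.

(** * Evaluation of the constants *)

Section Constants.
Variables (mu e p M : R).
Hypotheses (mu_ge2 : 2 <= mu) (p_gt0 : 0 < p) (pE : p ^+ 2 * (mu + 1 + e) = 1).
Hypotheses (e_itv : e = 0 \/ e = 1) (ME : M = mu * (mu + e) / (1 + e)).

Let e_ge0 : 0 <= e. Proof. by case: e_itv => ->. Qed.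

Let muE : mu = (p ^+ 2)^-1 - 1 - e.
Proof.
have p2 : p ^+ 2 != 0 by rewrite lt0r_neq0 // exprn_gt0.
by apply: (mulfI p2); rewrite !mulrBr divff // mulr1 -pE; ring.
Qed.

Let M_gt0 : 0 < M.
Proof.
by rewrite ME divr_gt0 ?mulr_gt0 //; move: mu_ge2 e_ge0; lra.
Qed.

(** Equality in the Welch bound, p^2 = (M - mu) / (mu (M - 1)), for M unit vectors in dimension
    mu. *)
Lemma welch_bound : M - mu = mu * p ^+ 2 * (M - 1).
Proof.
have e1 : 1 + e != 0 by apply: lt0r_neq0; move: e_ge0; lra.
have -> : M - 1 = (mu - 1) * (mu + 1 + e) / (1 + e) by rewrite ME; field.
have -> : mu * p ^+ 2 * ((mu - 1) * (mu + 1 + e) / (1 + e)) =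
  (p ^+ 2 * (mu + 1 + e)) * (mu * (mu - 1) / (1 + e)) by ring.
by rewrite pE ME; field.
Qed.

Lemma coef_sum : constant_coef mu e p * mu + quadratic_coef mu e p
  = mu / M * (1 + (M - 1) * p).
Proof.
have p0 := lt0r_neq0 p_gt0.
have p1 : 1 + p != 0 by apply: lt0r_neq0; move: p_gt0; lra.
have e1 : 1 + e != 0 by apply: lt0r_neq0; move: e_ge0; lra.
have p21 : 1 + p ^+ 2 != 0 by apply: lt0r_neq0; have := sqr_ge0 p; lra.
have mu0 : mu != 0 by apply: lt0r_neq0; move: mu_ge2; lra.
have mue : mu + e != 0 by apply: lt0r_neq0; move: mu_ge2 e_ge0; lra.
have d1 : mu + 2 + 2 * e != 0 by apply: lt0r_neq0; move: mu_ge2 e_ge0; lra.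
have d2 : 2 * mu + 2 + 2 * e != 0 by apply: lt0r_neq0; move: mu_ge2 e_ge0; lra.
(* Eliminating mu instead of p avoids square roots: for either value of e both sides are rational
   functions of p. *)
have Hmu : mu = (1 - (1 + e) * p ^+ 2) / p ^+ 2 by rewrite {1}muE; field.
rewrite /constant_coef /quadratic_coef /quartic_a /quartic_b /quartic_c ME.
move: mu_ge2 pE; rewrite Hmu; case: e_itv => -> mu2 pE'.
  have q0 : p ^+ 2 != 0 by rewrite lt0r_neq0 // exprn_gt0.
  have q3 : p ^+ 2 * 3 <= 1.
    have : 2 * p ^+ 2 <= 1 - (1 + 0) * p ^+ 2 by rewrite -ler_pdivlMr // exprn_gt0.
    lra.
  field; apply/and5P; split; [done| | | done | ]; apply: lt0r_neq0; have := sqr_ge0 p; lra.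
have q4 : p ^+ 2 * 4 <= 1.
  have : 2 * p ^+ 2 <= 1 - (1 + 1) * p ^+ 2 by rewrite -ler_pdivlMr // exprn_gt0.
  lra.
by field; rewrite p0 p1 /=; apply/and4P; split; apply: lt0r_neq0;
  have := sqr_ge0 p; lra.
Qed.

(** Since p / 2 = c p^2 (1 + p)^2, the difference is c p^2 times (2 + e) / (mu + 2 + 2 e) - 1 / (mu
    + 1 + e), which is nonnegative. *)
Lemma half_le_constant_coef : p / 2 <= constant_coef mu e p.
Proof.
have p0 := lt0r_neq0 p_gt0.
have p1 : 1 + p != 0 by apply: lt0r_neq0; move: p_gt0; lra.
have p21 : 0 < 1 + p ^+ 2 by have := sqr_ge0 p; lra.
have mu1 : mu + 1 + e != 0 by apply: lt0r_neq0; move: mu_ge2 e_ge0; lra.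
rewrite -subr_ge0.
have q0 : p ^+ 2 = (mu + 1 + e)^-1 by apply: (mulIf mu1); rewrite pE mulVf.
have m0 : mu != 0 by apply: lt0r_neq0; move: mu_ge2; lra.
have -> : constant_coef mu e p - p / 2 = quartic_c p * p ^+ 2 *
  ((2 + e) / (mu + 2 + 2 * e) - p ^+ 2).
  have -> : constant_coef mu e p = quartic_c p * (p ^+ 2 * (1 + 2 * p)
     + (2 + e) / (mu + 2 + 2 * e) * (mu + 1 + e)^-1).
    rewrite /constant_coef /quartic_a; field.
    by rewrite mu1 /=; apply/andP; split; apply: lt0r_neq0; move: mu_ge2 e_ge0; lra.
  have pE2 : p / 2 = quartic_c p * (p ^+ 2 * (1 + p) ^+ 2).
    by rewrite /quartic_c; field; rewrite p0 p1.
  by rewrite pE2 -q0; ring.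
apply: mulr_ge0.
  by apply: mulr_ge0; [apply: quartic_c_ge0; exact: ltW | exact: sqr_ge0].
rewrite q0 subr_ge0 -[_^-1]mul1r ler_pdivrMr; last by move: mu_ge2 e_ge0; lra.
rewrite mulrAC ler_pdivlMr; last by move: mu_ge2 e_ge0; lra.
by move: mu_ge2; case: e_itv => ->; lra.
Qed.

(** As p^2 = 1 / (mu + 1 + e), the hypothesis says p n >= 4, that is 2 / n <= p / 2. *)
Lemma le_constant_coef (n : R) : 0 < n -> 16 * (mu + 1 + e) <= n ^+ 2 ->
  2 / n <= constant_coef mu e p.
Proof.
move=> n0 hn; apply: le_trans half_le_constant_coef.
rewrite ler_pdivrMr // mulrAC ler_pdivlMr //.
have pn : 0 <= p * n by rewrite mulr_ge0 // ltW.
rewrite -ler_sqr ?nnegrE // ?mulr_ge0 //.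
have -> : (2 * 2) ^+ 2 = p ^+ 2 * (16 * (mu + 1 + e)) by rewrite mulrCA pE; ring.
by rewrite exprMn ler_wpM2l ?sqr_ge0.
Qed.

(** AM-GM is sharp when 2 [al] t_i t_j = g_ij. At uniform weights t_i^2 = 1 / M and g_ij = mu p / M
    this forces [al] = mu p / 2. *)
Lemma equiangular_value : let al := mu * p / 2 in
  al + mu / (4 * al) - (2 * al + mu) ^+ 2 / (4 * al) / M
   = mu / M * (1 + (M - 1) * p) - 2 * mu / M.
Proof.
have p0 := lt0r_neq0 p_gt0.
have mu0 : mu != 0 by apply: lt0r_neq0; move: mu_ge2; lra.
have M0 := lt0r_neq0 M_gt0.
have E : M = mu * p ^+ 2 * (M - 1) + mu by rewrite -welch_bound subrK.
move=> al; have -> : al + mu / (4 * al) - (2 * al + mu) ^+ 2 / (4 * al) / M =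
    (mu * p ^+ 2 * M - 2 * mu * p - mu * p ^+ 2 + (M - mu)) / (2 * p * M).
  by rewrite /al; field; rewrite ?mu0 ?p0 ?M0.
by rewrite welch_bound; field; rewrite ?M0 ?p0.
Qed.

Lemma equiangular_lt1 : p < 1.
Proof.
rewrite -[p]ger0_norm ?ltW // -[1]ger0_norm // -ltr_sqr ?nnegrE // !real_normK ?num_real //.
rewrite expr1n -pE ltr_pMr ?exprn_gt0 //.
by move: mu_ge2 e_ge0; lra.
Qed.

End Constants.

(* The case of six vectors in the real plane, where [constant_coef >= 2 / 6] fails;
   [c] and [d] are the cosine and the sine of the doubled angles. *)
Section Plane.
Variables (g : 'I_6 -> 'I_6 -> R) (r t c d : 'I_6 -> R) (s : 'I_6 -> 'I_6 -> R).
Hypotheses (r0 : forall i, 0 <= r i) (t0 : forall i, 0 <= t i).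
Hypotheses (cd1 : forall i, c i ^+ 2 + d i ^+ 2 = 1).
Hypotheses (gE : forall i j, g i j = r i * r j * s i j) (s01 : forall i j, 0 <= s i j <= 1).
Hypotheses (sE : forall i j, 2 * s i j ^+ 2 - 1 = c i * c j + d i * d j).
Hypotheses (gii : forall i, g i i = r i ^+ 2).
Hypotheses (trace : \sum_i r i ^+ 2 = 2) (tnorm : \sum_i t i ^+ 2 = 1).
Hypotheses (c_tight : \sum_i r i ^+ 2 * c i = 0).

Let x i := t i * r i.
Let X := \sum_i x i.
Let Y := \sum_i x i * c i.
Let W := \sum_i x i * (c i ^+ 2 - d i ^+ 2).
Hypotheses (Y0 : 0 <= Y) (d_x : \sum_i x i * d i = 0).

Let x0 i : 0 <= x i. Proof. exact: mulr_ge0. Qed.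

Let c_le1 i : c i <= 1.
Proof. by have := cd1 i; have := sqr_ge0 (d i); nra. Qed.

Let Y_leX : Y <= X.
Proof. by apply: ler_sum => i _; rewrite -[leRHS]mulr1 ler_wpM2l. Qed.

Let X2_le : X ^+ 2 <= 2.
Proof. by have := sum_CauchySchwarz t r; rewrite tnorm mul1r trace. Qed.

Let W_leX : W <= X.
Proof.
apply: ler_sum => i _; rewrite -[leRHS]mulr1 ler_wpM2l //.
by have := cd1 i; have := sqr_ge0 (d i); lra.
Qed.

Let W_ge : 2 * Y ^+ 2 <= X * (W + X).
Proof.
have -> : W + X = 2 * \sum_i x i * c i ^+ 2.
  rewrite mulr_sumr -big_split; apply: eq_bigr => i _ /=.
  by have /(canRL (addKr _)) -> := cd1 i; ring.
rewrite [X * _]mulrCA ler_wpM2l //.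
have := sum_CauchySchwarz (fun i => Num.sqrt (x i)) (fun i => Num.sqrt (x i) * c i).
have sq i : Num.sqrt (x i) * Num.sqrt (x i) = x i by rewrite -expr2 sqr_sqrtr.
under eq_bigr do rewrite mulrA sq.
under [X in _ <= X * _]eq_bigr do rewrite expr2 sq.
by under [X in _ <= _ * X]eq_bigr do rewrite exprMn expr2 sq.
Qed.

(* Expand [\sum (t - r |a + b e|)^2 >= 0] with [a = X / 2] and [b = Y / 2], where
   [|a + b e| >= a + b c + k (1 - c^2)] and [k = b^2 / (2 (a + b))]. *)
Let moment_defect : 0 < X -> Y ^+ 2 * (X - W) / (2 * (X + Y)) <= 2 - X ^+ 2 - Y ^+ 2.
Proof.
move=> X0; pose k := Y ^+ 2 / (4 * (X + Y)).
have XY : 0 < X + Y by rewrite ltr_wpDr.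
have k0 : 0 <= k by rewrite divr_ge0 ?sqr_ge0 // mulr_ge0 // ltW.
pose q i := X ^+ 2 + Y ^+ 2 + 2 * X * Y * c i.
pose l i := X + Y * c i + k * d i ^+ 2 * 2.
have kY : k * 2 <= Y.
  rewrite /k mulrAC ler_pdivrMr ?mulr_gt0 //.
  by have := mulr_ge0 (ltW X0) Y0; have := sqr_ge0 Y; lra.
have ck : k * (4 * (X + Y)) = Y ^+ 2 by rewrite /k mulfVK // lt0r_neq0 // mulr_gt0.
have ql i : l i <= Num.sqrt (q i).
  apply: le_trans (ler_norm _) _; rewrite -sqrtr_sqr ler_wsqrtr // -subr_ge0.
  have -> : q i - l i ^+ 2 = d i ^+ 2 * (k * 2) * (2 * Y * (1 - c i) - k * 2 * d i ^+ 2).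
    have : d i ^+ 2 * Y ^+ 2 = d i ^+ 2 * (k * (4 * (X + Y))) by rewrite ck.
    have : Y ^+ 2 * d i ^+ 2 = Y ^+ 2 * (1 - c i ^+ 2) by rewrite -(cd1 i) addrAC subrr add0r.
    rewrite /q /l; lra.
  apply: mulr_ge0; first by rewrite mulr_ge0 ?sqr_ge0 // mulr_ge0.
  rewrite subr_ge0.
  have -> : d i ^+ 2 = (1 + c i) * (1 - c i) by have := cd1 i; lra.
  rewrite mulrA ler_wpM2r ?subr_ge0 //.
  have : k * 2 * c i <= k * 2 by rewrite -[leRHS]mulr1 ler_wpM2l // mulr_ge0.
  by move: kY; lra.
have h : 0 <= \sum_i (t i - r i * Num.sqrt (q i) / 2) ^+ 2.
  by apply: sumr_ge0 => i _; rewrite sqr_ge0.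
have q0 i : 0 <= q i.
  have -> : q i = (X + Y * c i) ^+ 2 + (Y * d i) ^+ 2.
    have : Y ^+ 2 * (c i ^+ 2 + d i ^+ 2) = Y ^+ 2 by rewrite cd1 mulr1.
    rewrite /q; lra.
  by rewrite addr_ge0 ?sqr_ge0.
have : \sum_i x i * l i <= 1 + (X ^+ 2 + Y ^+ 2) / 2.
  apply: (@le_trans _ _ (\sum_i x i * Num.sqrt (q i))).
    by apply: ler_sum => i _; rewrite ler_wpM2l.
  have E i : (t i - r i * Num.sqrt (q i) / 2) ^+ 2 = t i ^+ 2 - x i * Num.sqrt (q i)
     + ((X ^+ 2 + Y ^+ 2) / 4 * r i ^+ 2 + X * Y / 2 * (r i ^+ 2 * c i)).
    by rewrite sqrrB !exprMn (sqr_sqrtr (q0 i)) /x /q; field.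
  move: h; rewrite (eq_bigr _ (fun i _ => E i)) !big_split /= -!mulr_sumr tnorm trace c_tight.
  rewrite sumrN; lra.
have -> : \sum_i x i * l i = X ^+ 2 + Y ^+ 2 + k * (X - W).
  have E i : x i * l i = X * x i + Y * (x i * c i) + (k * x i - k * (x i * (c i ^+ 2 - d i ^+ 2))).
    by have -> : c i ^+ 2 = 1 - d i ^+ 2 by [have := cd1 i; lra]; rewrite /l; ring.
  rewrite (eq_bigr _ (fun i _ => E i)) !big_split /= sumrN -!mulr_sumr -/X -/Y -/W; ring.
have -> : Y ^+ 2 * (X - W) / (2 * (X + Y)) = 2 * (k * (X - W)).
  by rewrite /k; field; rewrite lt0r_neq0.
lra.
Qed.

Let defect_bound : 6 * X ^+ 2 + 7 * Y ^+ 2 - W ^+ 2 <= 12.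
Proof.
have X0 : 0 <= X by apply: sumr_ge0.
case: (eqVneq X 0) => [XE|Xn].
  have -> : Y = 0 by apply/eqP; rewrite eq_le Y0 andbT -XE.
  by rewrite XE; have := sqr_ge0 W; lra.
have {Xn}X0 : 0 < X by rewrite lt0r Xn.
have XY : 0 < X + Y by rewrite ltr_wpDr.
(* Six times [moment_defect] bounds 12 - 6 X^2 - 6 Y^2 from below, so only Y^2 - W^2 remains to be
   compared with it. *)
suff h : (X + Y) * (Y ^+ 2 - W ^+ 2) <= 3 * (Y ^+ 2 * (X - W)).
  have := moment_defect X0.
  have : Y ^+ 2 - W ^+ 2 <= 6 * (Y ^+ 2 * (X - W) / (2 * (X + Y))).
    rewrite mulrA ler_pdivlMr ?mulr_gt0 //; move: h; lra.
  lra.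
(* As a quadratic in W, the difference has its vertex at 3 Y^2 / (2 (X + Y)). *)
have yx := Y_leX; have wx := W_leX; have wy := W_ge; have y0 := Y0.
rewrite -subr_ge0 -(pmulr_rge0 _ XY).
set f := (X + Y) * (_ - _).
have fE : f = ((X + Y) * W - 3 / 2 * Y ^+ 2) ^+ 2 +
   Y ^+ 2 / 4 * (8 * X ^+ 2 + 4 * X * Y - 13 * Y ^+ 2).
  by rewrite /f; field.
case: (lerP 0 (8 * X ^+ 2 + 4 * X * Y - 13 * Y ^+ 2)) => hy.
  by rewrite fE addr_ge0 ?sqr_ge0 // mulr_ge0 // divr_ge0 ?sqr_ge0.
have yx2 : 8 * X <= 13 * Y by have := mulr_ge0 y0 y0; nra.
(* Here the value at the vertex is negative, and W is kept away from it by W_ge, that is X W >= 2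
   Y^2 - X^2. The identity splits f into its value at that endpoint and the increment from there;
   both turn out nonnegative. *)
have fX : f * X ^+ 2 = (X + Y) * ((X - Y) ^+ 2 * (4 * Y ^+ 2 + 2 * X * Y + X ^+ 2) * (X + Y) +
   (X * W - (2 * Y ^+ 2 - X ^+ 2)) * ((X + Y) * (X * W + (2 * Y ^+ 2 - X ^+ 2)) - 3 * Y ^+ 2 * X)).
  rewrite /f; ring.
rewrite -(pmulr_lge0 _ (exprn_gt0 2 X0)) fX.
have XY0 := ltW XY; have X0' := ltW X0.
apply: mulr_ge0 => //; apply: addr_ge0.
  by rewrite mulr_ge0 // mulr_ge0 ?sqr_ge0 // addr_ge0 ?sqr_ge0 // addr_ge0 // mulr_ge0 ?sqr_ge0 // mulr_ge0.
have V0 : 2 * Y ^+ 2 - X ^+ 2 <= X * W by move: wy; lra.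
apply: mulr_ge0; first by rewrite subr_ge0.
rewrite subr_ge0; apply: (@le_trans _ _ ((X + Y) * (2 * (2 * Y ^+ 2 - X ^+ 2)))); last first.
  by rewrite ler_wpM2l //; lra.
have : 0 <= Y * (16 * Y ^+ 2 + 10 * X * Y - 18 * X ^+ 2).
  rewrite mulr_ge0 //; nra.
nra.
Qed.

(** With z the cosine of the difference of the doubled angles, s^2 = (1 + z) / 2. At p = 1/2 the
    quartic becomes 2/3 + 7/18 z - 1/18 (2 z^2 - 1), a trigonometric polynomial, so the double sum
    is controlled by the squared moments X^2, Y^2 and W^2. *)
Lemma plane_bound :
  \sum_i \sum_j t i * t j * g i j - 2 * (\sum_i t i ^+ 2 * g i i) <= 2 / 3.
Proof.
pose z i j := c i * c j + d i * d j.
have sz i j : s i j <= 2 / 3 + 7 / 18 * z i j - (2 * z i j ^+ 2 - 1) / 18.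
  have : 0 < 2^-1 :> R by rewrite invr_gt0.
  move=> /le_quartic /(_ (s01 i j)).
  have -> : s i j ^+ 4 = (s i j ^+ 2) ^+ 2 by ring.
  have -> : s i j ^+ 2 = (1 + z i j) / 2 by rewrite /z -sE; field.
  rewrite /quartic_a /quartic_b /quartic_c => h; apply: le_trans h _.
  by rewrite le_eqVlt; apply/orP; left; apply/eqP; field.
have zE i j : 2 * z i j ^+ 2 - 1 = (c i ^+ 2 - d i ^+ 2) * (c j ^+ 2 - d j ^+ 2)
    + (2 * c i * d i) * (2 * c j * d j).
  have hi := cd1 i; have hj := cd1 j.
  have : (c i ^+ 2 + d i ^+ 2) * (c j ^+ 2 + d j ^+ 2) = 1 by rewrite hi hj mulr1.
  rewrite /z; lra.
have E : \sum_i \sum_j t i * t j * g i j <= 2 / 3 * X ^+ 2 + 7 / 18 * Y ^+ 2 - W ^+ 2 / 18.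
  (* The sine part of the moment at four times the angle; it enters with a negative sign and is
     dropped. *)
  pose V := \sum_i x i * (2 * c i * d i).
  apply: (@le_trans _ _ (2 / 3 * X ^+ 2 + 7 / 18 * (Y ^+ 2 + (\sum_i x i * d i) ^+ 2)
     - (W ^+ 2 + V ^+ 2) / 18)); last by rewrite d_x; have := sqr_ge0 V; lra.
  rewrite !sum_sqr -!big_split mulr_suml -sumrN !mulr_sumr -!big_split /= ler_sum // => i _.
  rewrite -!big_split mulr_suml -sumrN !mulr_sumr -!big_split /= ler_sum // => j _.
  have := ler_wpM2l (mulr_ge0 (x0 i) (x0 j)) (sz i j).
  rewrite zE gE /z /x; lra.
have D : X ^+ 2 / 6 <= \sum_i t i ^+ 2 * g i i.
  have := sum_sqr_ge x (isT : (0 < 6)%N); rewrite -/X => h; apply: le_trans h _.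
  by apply: ler_sum => i _; rewrite gii /x exprMn.
have := defect_bound.
move: E D; set S := \sum_i \sum_j _; set T := \sum_i _ * _; lra.
Qed.

End Plane.

(* Rotating the doubled angles makes the second moment [\sum t r e^(2 i theta)]
   real and nonnegative. *)
Lemma rotated_plane_bound (g : 'I_6 -> 'I_6 -> R) (r t c d : 'I_6 -> R)
    (s : 'I_6 -> 'I_6 -> R)
    (r0 : forall i, 0 <= r i) (t0 : forall i, 0 <= t i)
    (cd1 : forall i, c i ^+ 2 + d i ^+ 2 = 1)
    (gE : forall i j, g i j = r i * r j * s i j)
    (s01 : forall i j, 0 <= s i j <= 1)
    (sE : forall i j, 2 * s i j ^+ 2 - 1 = c i * c j + d i * d j)
    (gii : forall i, g i i = r i ^+ 2)
    (trace : \sum_i r i ^+ 2 = 2) (tnorm : \sum_i t i ^+ 2 = 1)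
    (c_tight : \sum_i r i ^+ 2 * c i = 0) (d_tight : \sum_i r i ^+ 2 * d i = 0) :
  \sum_i \sum_j t i * t j * g i j - 2 * (\sum_i t i ^+ 2 * g i i) <= 2 / 3.
Proof.
pose Yc := \sum_i t i * r i * c i; pose Yd := \sum_i t i * r i * d i.
have [al [be [ab1 abY abd]]] : exists al be, [/\ al ^+ 2 + be ^+ 2 = 1 :> R,
    0 <= al * Yc + be * Yd & al * Yd - be * Yc = 0].
  pose n := Num.sqrt (Yc ^+ 2 + Yd ^+ 2).
  have n2 : n ^+ 2 = Yc ^+ 2 + Yd ^+ 2 by rewrite sqr_sqrtr // addr_ge0 ?sqr_ge0.
  case: (eqVneq n 0) => [nE|n0].
    have h : Yc ^+ 2 + Yd ^+ 2 == 0 by rewrite -n2 nE expr0n.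
    move: h; rewrite paddr_eq0 ?sqr_ge0 // !sqrf_eq0 => /andP[/eqP -> /eqP ->].
    by exists 1, 0; split; rewrite ?mulr0 ?addr0 ?subr0 // expr1n expr0n addr0.
  exists (Yc / n), (Yd / n); split; last by rewrite mulrAC [Yd / n * _]mulrAC [Yd * Yc]mulrC subrr.
    by rewrite !expr_div_n -mulrDl -n2 divff // sqrf_eq0.
  by rewrite mulrAC [Yd / n * _]mulrAC -mulrDl divr_ge0 ?sqrtr_ge0 // addr_ge0 // -expr2 sqr_ge0.
pose c' i := al * c i + be * d i; pose d' i := al * d i - be * c i.
apply: (@plane_bound g r t c' d' s) => //.
- move=> i; have : (al ^+ 2 + be ^+ 2) * (c i ^+ 2 + d i ^+ 2) = 1 by rewrite ab1 cd1 mulr1.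
  rewrite /c' /d'; lra.
- move=> i j; rewrite sE -[LHS]mul1r -ab1 /c' /d'; ring.
- have E i : r i ^+ 2 * c' i = al * (r i ^+ 2 * c i) + be * (r i ^+ 2 * d i) by rewrite /c'; ring.
  by rewrite (eq_bigr _ (fun i _ => E i)) big_split /= -!mulr_sumr c_tight d_tight !mulr0 addr0.
- have E i : t i * r i * c' i = al * (t i * r i * c i) + be * (t i * r i * d i) by rewrite /c'; ring.
  by rewrite (eq_bigr _ (fun i _ => E i)) big_split /= -!mulr_sumr.
- have E i : t i * r i * d' i = al * (t i * r i * d i) + - be * (t i * r i * c i) by rewrite /d'; ring.
  by rewrite (eq_bigr _ (fun i _ => E i)) big_split /= -!mulr_sumr -/Yc -/Yd mulNr.
Qed.

End RealInequalities.

(** * Minimax *)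

Section Minimax.
Variables (R : realType) (N : nat) (A : Type) (v : A -> 'I_N -> R) (C : R).
Hypothesis v0 : forall a i, 0 <= v a i.
Hypothesis mix : forall a b (h : R), 0 <= h <= 1 ->
  exists c, forall i, v c i <= (1 - h) * v a i + h * v b i.
Hypothesis avg : forall w : 'I_N -> R, (forall i, 0 < w i) ->
  exists a, \sum_i w i * v a i <= C * \sum_i w i.

(* A near minimizer of the squared excess over [C] would be improved by moving
   slightly towards a point which is good on average for the weights given by
   the excess itself. *)
Lemma minimax (eps : R) : 0 < eps -> exists a, forall i, v a i <= C + eps.
Proof.
move=> eps0; apply: contrapT => noa.
pose g a i := Num.max (v a i - C) 0.
have g0 a i : 0 <= g a i by rewrite le_max lexx orbT.
pose Phi a := \sum_i g a i ^+ 2.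
have Phi_ge a : eps ^+ 2 <= Phi a.
  have /existsNP[i /negP] : ~ forall i, v a i <= C + eps by move=> h; apply: noa; exists a.
  rewrite -ltNge => hi; rewrite /Phi (bigD1 i) //=.
  apply: ler_wpDr; first by apply: sumr_ge0 => j _; rewrite sqr_ge0.
  rewrite ler_sqr ?nnegrE ?g0 ?ltW // /g lt_max; apply/orP; left; lra.
have [a0 _] := avg (fun=> ltr01).
pose m := inf (range Phi).
have Phi_lb : has_inf (range Phi).
  split; first by exists (Phi a0), a0.
  by exists (eps ^+ 2) => _ [a _ <-].
have m_le a : m <= Phi a by apply: inf_lbound; [case: Phi_lb | exists a].
have m0 : 0 < m.
  apply: (@lt_le_trans _ _ (eps ^+ 2)); first by rewrite exprn_gt0.
  by apply: lb_le_inf; [case: Phi_lb | move=> _ [a _ <-]].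
have N0 : (0 < N)%N.
  case: (posnP N) => // N0; exfalso; apply: noa; exists a0 => i.
  by have := ltn_ord i; rewrite {2}N0.
have Nr : 0 < N%:R :> R by rewrite ltr0n.
have C0 : 0 <= C.
  have [a] := avg (fun=> ltr01); rewrite sumr_const card_ord -mulr_natr mul1r => h.
  rewrite -(pmulr_lge0 _ Nr); apply: le_trans h.
  by apply: sumr_ge0 => i _; rewrite mul1r.
pose B := m + 2.
(* [avg] requires positive weights, so the excess is raised by [eta], at a cost of at most [eta] C N
   <= m / 2. In return the weights are at least [eta], which gives the bound V on every coordinate
   of the averaged point. *)
pose eta := m / (2 * (C + 1) * N%:R).
have CN : 0 < 2 * (C + 1) * N%:R by rewrite !mulr_gt0 //; lra.
have eta0 : 0 < eta by rewrite divr_gt0.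
pose V := C * (N%:R * (B + eta)) / eta.
pose D := V + C + B.
pose E := N%:R * D ^+ 2.
have E0 : 0 <= E by rewrite mulr_ge0 ?sqr_ge0 // ltW.
(* Moving by h gains h m to first order and loses at most h^2 E <= h m / 2 to second order. Starting
   within h m / 2 of the infimum m then leads below m. *)
pose h := m / (2 * (E + m)).
have Em : 0 < 2 * (E + m) by rewrite mulr_gt0 // ltr_wpDl.
have h0 : 0 < h by rewrite divr_gt0.
have hE : h * (2 * (E + m)) = m by rewrite /h mulfVK // lt0r_neq0.
have h1 : h <= 1 by rewrite /h ler_pdivrMr //; lra.
have dlt : 0 < Num.min 1 (h * m / 2) by rewrite lt_min ltr01 divr_gt0 // mulr_gt0.
have [_ [a _ <-] Ha] := inf_adherent dlt Phi_lb.
have {Ha}[Ha1 Ha2] : Phi a < m + 1 /\ Phi a < m + h * m / 2.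
  split; apply: (lt_le_trans Ha); rewrite -/m lerD2l ge_min lexx ?orbT //.
have gB i : g a i <= B.
  have : g a i ^+ 2 <= Phi a.
    by rewrite /Phi (bigD1 i) //= lerDl; apply: sumr_ge0 => j _; rewrite sqr_ge0.
  have := g0 a i; have := sqr_ge0 (g a i - 1); rewrite /B; move: Ha1 m0; nra.
pose w i := g a i + eta.
have w0 i : 0 < w i by rewrite ltr_wpDl.
have [b Hb] := avg w0.
have bV i : v b i <= V.
  rewrite /V ler_pdivlMr //; apply: (@le_trans _ _ (\sum_i w i * v b i)).
    rewrite (bigD1 i) //= mulrC; apply: ler_wpDr.
      by apply: sumr_ge0 => j _; rewrite mulr_ge0 // ltW.
    by rewrite ler_wpM2r // /w lerDr.
  apply: (le_trans Hb); rewrite ler_wpM2l //.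
  apply: (@le_trans _ _ (\sum_(i < N) (B + eta))).
    by apply: ler_sum => j _; rewrite /w lerD2r.
  by rewrite sumr_const card_ord mulr_natl.
have [c Hc] := mix a b (introT andP (conj (ltW h0) h1)).
have key : \sum_i g a i * (v b i - v a i) <= - (m / 2).
  have gv i : g a i * (v a i - C) = g a i ^+ 2.
    by rewrite expr2 /g; case: (lerP (v a i - C) 0) => hv; rewrite ?mul0r.
  have e1 : \sum_i g a i * (v b i - v a i) =
      (\sum_i w i * v b i - C * \sum_i w i) - eta * (\sum_i v b i) + eta * C * N%:R - Phi a.
    have -> : eta * C * N%:R = \sum_(i < N) eta * C by rewrite sumr_const card_ord mulr_natr.
    rewrite /Phi !mulr_sumr -!sumrN -!big_split; apply: eq_bigr => i _ /=.
    by rewrite -gv /w; ring.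
  have e2 : 0 <= eta * \sum_i v b i by apply: mulr_ge0; [exact: ltW | apply: sumr_ge0].
  have e3 : eta * C * N%:R <= m / 2.
    rewrite /eta -mulrA mulrAC ler_pdivrMr //.
    have -> : m / 2 * (2 * (C + 1) * N%:R) = m * (C * N%:R) + m * N%:R by field.
    by rewrite lerDl mulr_ge0 // ltW.
  have := m_le a; move: Hb; rewrite e1; lra.
have Phic : Phi c <= Phi a + 2 * h * (\sum_i g a i * (v b i - v a i)) + h ^+ 2 * E.
  have -> : E = \sum_(i < N) D ^+ 2 by rewrite /E sumr_const card_ord mulr_natl.
  rewrite /Phi !mulr_sumr -!big_split /= ler_sum // => i _.
  apply: (@le_trans _ _ ((g a i + h * (v b i - v a i)) ^+ 2)).
    rewrite -[leRHS]real_normK ?num_real // ler_sqr ?nnegrE //.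
    rewrite /g ge_max normr_ge0 andbT; apply: le_trans (ler_norm _).
    have : v a i - C <= g a i by rewrite /g le_max lexx.
    by have := Hc i; rewrite /g; lra.
  have dD : (v b i - v a i) ^+ 2 <= D ^+ 2.
    rewrite -[(v b i - _) ^+ 2]real_normK ?num_real //.
    have aB : v a i <= C + B.
      have : v a i - C <= g a i by rewrite /g le_max lexx.
      by have := gB i; lra.
    have V0 : 0 <= V := le_trans (v0 b i) (bV i).
    have B0 : 0 <= B := le_trans (g0 a i) (gB i).
    rewrite ler_sqr ?nnegrE // /D; last by lra.
    by rewrite ler_norml; apply/andP; split; have := v0 a i; have := v0 b i; have := bV i; lra.
  have := ler_wpM2l (sqr_ge0 h) dD; lra.
have hk := ler_wpM2l (ltW h0) key.
have : h ^+ 2 * E <= h * m / 2.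
  have -> : h ^+ 2 * E = h * (h * E) by ring.
  rewrite -mulrA; apply: ler_wpM2l; first exact: ltW.
  have : 0 <= h * m by rewrite mulr_ge0 // ltW.
  by move: hE; lra.
by have := m_le c; move: Phic hk Ha2; lra.
Qed.

End Minimax.

(** * Fourth moments *)

Section FourthMoment.
Variables (R : realType) (F : scalar_field).
Local Notation K := (scalars R F).
Local Notation conj := (@conjK R F).
Local Notation re := (@reK R F).
Local Notation ofr := (@ofR R F).

Definition real_flag : R :=
  match F with RealScalars => 1 | ComplexScalars => 0 end.

(** The flag is 0 exactly where conjugation is nontrivial. Multiplying by it expresses the
    additional symmetries of the real case in a proof common to both fields. *)
Lemma real_flag_conj (x : K) : ofr real_flag * conj x = ofr real_flag * x.
Proof.
rewrite /real_flag; case: F x => //= x; change (Complex (0 : R) 0) with (0 : R[i]).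
by rewrite !mul0r.
Qed.

Variable m : nat.
Implicit Types (X : 'I_m -> 'I_m -> 'I_m -> 'I_m -> K) (H : 'I_m -> 'I_m -> K).

Let D (a b : 'I_m) : K := (a == b)%:R.
Let e : K := ofr real_flag.

Lemma sum_delta (f : 'I_m -> K) b : \sum_d f d * D b d = f b.
Proof.
rewrite (bigD1 b) //= big1 ?addr0 => [|d db]; first by rewrite /D eqxx mulr1.
by rewrite /D eq_sym (negbTE db) mulr0.
Qed.

Lemma sum_delta_sym (f : 'I_m -> K) b : \sum_d f d * D d b = f b.
Proof. by rewrite -[RHS]sum_delta; apply: eq_bigr => d _; rewrite /D eq_sym. Qed.

(** H tensored with the identity and symmetrized like the tensor with entries w_a w_b conj(w_c)
    conj(w_d): under a <-> b and c <-> d, and over the reals under all permutations, which accounts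
    for the last two terms. *)
Definition sym_delta H a b c d : K :=
  H a c * D b d + H a d * D b c + H b c * D a d + H b d * D a c
  + e * (H a b * D c d + D a b * H c d).

Lemma sym_delta_pairing X H
    (X12 : forall a b c d, X a b c d = X b a c d)
    (X34 : forall a b c d, X a b c d = X a b d c)
    (X23 : forall a b c d, e * X a b c d = e * X a c b d) :
  \sum_a \sum_b \sum_c \sum_d X a b c d * sym_delta H a b c d =
  (4 + 2 * e) * \sum_a \sum_c (\sum_b X a b c b) * H a c.
Proof.
pose B := \sum_a \sum_b \sum_c \sum_d X a b c d * (H a c * D b d).
have BE : B = \sum_a \sum_c (\sum_b X a b c b) * H a c.
  apply: eq_bigr => a _; rewrite exchange_big; apply: eq_bigr => c _ /=.
  rewrite mulr_suml; apply: eq_bigr => b _.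
  by rewrite -(sum_delta (fun d => X a b c d * H a c)); apply: eq_bigr => d _; rewrite mulrA.
have B2 : \sum_a \sum_b \sum_c \sum_d X a b c d * (H a d * D b c) = B.
  do 2!(apply: eq_bigr => ? _); rewrite exchange_big.
  by do 2!(apply: eq_bigr => ? _); rewrite X34.
have B3 : \sum_a \sum_b \sum_c \sum_d X a b c d * (H b c * D a d) = B.
  by rewrite exchange_big; do 4!(apply: eq_bigr => ? _); rewrite X12.
have B4 : \sum_a \sum_b \sum_c \sum_d X a b c d * (H b d * D a c) = B.
  rewrite -B2 exchange_big; do 4!(apply: eq_bigr => ? _); by rewrite X12.
have B5 : \sum_a \sum_b \sum_c \sum_d e * (X a b c d * (H a b * D c d)) = e * B.
  rewrite /B mulr_sumr; apply: eq_bigr => a _; rewrite exchange_big mulr_sumr.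
  apply: eq_bigr => b _; rewrite mulr_sumr; apply: eq_bigr => c _.
  by rewrite mulr_sumr; apply: eq_bigr => d _; rewrite !mulrA X23.
have B6 : \sum_a \sum_b \sum_c \sum_d e * (X a b c d * (D a b * H c d)) = e * B.
  under eq_bigr do rewrite exchange_big.
  rewrite exchange_big /B mulr_sumr; apply: eq_bigr => c _ /=.
  rewrite mulr_sumr; apply: eq_bigr => a _; rewrite exchange_big mulr_sumr /=.
  apply: eq_bigr => d _; rewrite mulr_sumr; apply: eq_bigr => b _.
  by rewrite mulrA [RHS]mulrA [H c d * _]mulrC X23 X12 X34.
rewrite -BE.
transitivity (B + B + B + B + (e * B + e * B)); last by ring.
rewrite -[X in _ = B + X + B + B + _]B2 -[X in _ = B + _ + X + B + _]B3.
rewrite -[X in _ = B + _ + _ + X + _]B4 -[X in _ = _ + (X + _)]B5 -[X in _ = _ + (_ + X)]B6 /B.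
rewrite -!big_split; apply: eq_bigr => a _; rewrite -!big_split; apply: eq_bigr => b _.
rewrite -!big_split; apply: eq_bigr => c _; rewrite -!big_split; apply: eq_bigr => d _ /=.
by rewrite /sym_delta; ring.
Qed.

Lemma real_flag_idem : e * e = e.
Proof. by rewrite /e -rmorphM /=; congr (ofr _); rewrite /real_flag; case: F; rewrite ?mulr1 ?mulr0. Qed.

Lemma sym_delta_sym H (HS : forall a b, e * H a b = e * H b a) :
  [/\ forall a b c d, sym_delta H a b c d = sym_delta H b a c d,
      forall a b c d, sym_delta H a b c d = sym_delta H a b d c &
      forall a b c d, e * sym_delta H a b c d = e * sym_delta H a c b d].
Proof.
have Dsym a b : D a b = D b a by rewrite /D eq_sym.
split=> a b c d; rewrite /sym_delta.
- rewrite [D b a]Dsym [in LHS]mulrDr [in RHS]mulrDr !mulrA HS; ring.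
- rewrite [D d c]Dsym [in LHS]mulrDr [in RHS]mulrDr ![D a b * _]mulrC !mulrA [e * H c d]HS; ring.
have mul_ee (x u : K) : e * (x + e * u) = e * (x + u).
  by rewrite !mulrDr mulrA real_flag_idem.
rewrite !mul_ee [D c b]Dsym !mulrDr ![D _ _ * _]mulrC !mulrA.
rewrite [e * H c b]HS; ring.
Qed.

Lemma exchange_sum4 (I : finType) (f : 'I_m -> 'I_m -> 'I_m -> 'I_m -> I -> K) :
  \sum_a \sum_b \sum_c \sum_d \sum_i f a b c d i =
  \sum_i \sum_a \sum_b \sum_c \sum_d f a b c d i.
Proof.
rewrite [RHS]exchange_big; apply: eq_bigr => a _ /=.
rewrite [RHS]exchange_big; apply: eq_bigr => b _ /=.
rewrite [RHS]exchange_big; apply: eq_bigr => c _ /=.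
by rewrite [RHS]exchange_big.
Qed.

Lemma prod_sum4 (f g h k : 'I_m -> K) :
  (\sum_a f a) * (\sum_b g b) * (\sum_c h c) * (\sum_d k d) =
  \sum_a \sum_b \sum_c \sum_d f a * g b * h c * k d.
Proof.
rewrite !mulr_suml; apply: eq_bigr => a _.
rewrite [f a * _]mulr_sumr !mulr_suml; apply: eq_bigr => b _.
rewrite [f a * g b * _]mulr_sumr !mulr_suml; apply: eq_bigr => c _.
by rewrite mulr_sumr.
Qed.

Section Moments.
Variables (N : nat) (w : 'I_N -> 'I_m -> K) (y : 'I_N -> R).
Let Y i : K := ofr (y i).
Let z i j := \sum_a w i a * conj (w j a).
Let S a b c d := \sum_i Y i * (w i a * w i b * conj (w i c) * conj (w i d)).
Let T a c := \sum_i Y i * z i i * (w i a * conj (w i c)).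
Let tau := \sum_i Y i * z i i ^+ 2.
(** The partial trace of [sym_delta M] is k1 M + (tr M) 1. Requiring it to equal T gives M = (T - ga
    1) / k1 with ga = tr M, and taking traces gives ga = tau / k2 with k2 = k1 + m. *)
Let k1 : R := m%:R + 2 + 2 * real_flag.
Let k2 : R := 2 * m%:R + 2 + 2 * real_flag.
Let al : K := ofr k1^-1.
Let ga : K := tau * ofr k2^-1.
Let M a c := al * (T a c - ga * D a c).

Let z_conj i j : conj (z i j) = z j i.
Proof.
rewrite /z rmorph_sum; apply: eq_bigr => a _.
by rewrite rmorphM /= conjKK mulrC.
Qed.

Let conjY i : conj (Y i) = Y i. Proof. exact: conjK_ofR. Qed.
Let conje : conj e = e. Proof. exact: conjK_ofR. Qed.
Let conjD a b : conj (D a b) = D a b. Proof. by rewrite /D rmorph_nat. Qed.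

Let conj_sym_delta H a b c d :
  conj (sym_delta H a b c d) = sym_delta (fun a b => conj (H a b)) a b c d.
Proof. by rewrite /sym_delta !rmorphD /= !rmorphM /= !rmorphD /= !rmorphM /= !conjD conje. Qed.

Let S23 a b c d : e * S a b c d = e * S a c b d.
Proof.
have h u v s t : e * S u v s t = e * \sum_i Y i * (w i u * w i v * w i s * w i t).
  rewrite /S !mulr_sumr; apply: eq_bigr => i _.
  transitivity (Y i * w i u * w i v * (e * conj (w i s)) * conj (w i t)); first by ring.
  rewrite real_flag_conj.
  transitivity (Y i * w i u * w i v * w i s * (e * conj (w i t))); first by ring.
  by rewrite real_flag_conj; ring.
by rewrite !h; congr (_ * _); apply: eq_bigr => i _; ring.
Qed.

Let traceS a c : \sum_b S a b c b = T a c.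
Proof.
rewrite /S exchange_big; apply: eq_bigr => i _ /=.
rewrite /z mulrAC mulr_sumr; apply: eq_bigr => b _; ring.
Qed.

Let eT a c : e * T a c = e * T c a.
Proof.
rewrite /T !mulr_sumr; apply: eq_bigr => i _.
transitivity (Y i * z i i * w i a * (e * conj (w i c))); first by ring.
rewrite real_flag_conj; transitivity (Y i * z i i * w i c * (e * w i a)); first by ring.
by rewrite -real_flag_conj; ring.
Qed.

Let eM a c : e * M a c = e * M c a.
Proof.
rewrite /M mulrCA [RHS]mulrCA; congr (_ * _).
by rewrite !mulrBr eT /D eq_sym.
Qed.

Let trT : \sum_a T a a = tau.
Proof.
rewrite /T exchange_big; apply: eq_bigr => i _ /=.
by rewrite -mulr_sumr -/(z i i); ring.
Qed.

Let rf0 : 0 <= real_flag. Proof. by rewrite /real_flag; case: F. Qed.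

Let k1_gt0 : 0 < k1.
Proof. by rewrite /k1 ltr_wpDr ?mulr_ge0 // ltr_wpDl. Qed.

Let k2_gt0 : 0 < k2.
Proof. by rewrite /k2 ltr_wpDr ?mulr_ge0 // ltr_wpDl ?mulr_ge0. Qed.

Let k1E : al * (m%:R + 2 + 2 * e) = 1.
Proof.
have -> : m%:R + 2 + 2 * e = ofr k1 by rewrite /k1 2!rmorphD /= rmorphM /= !rmorph_nat.
by rewrite /al -rmorphM mulVf ?rmorph1 // lt0r_neq0.
Qed.

Let k2E : ga * (2 * m%:R + 2 + 2 * e) = tau.
Proof.
have -> : 2 * m%:R + 2 + 2 * e = ofr k2.
  by rewrite /k2 2!rmorphD /= !rmorphM /= !rmorph_nat.
by rewrite /ga -mulrA -rmorphM mulVf ?rmorph1 ?mulr1 // lt0r_neq0.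
Qed.

Let trM : \sum_b M b b = al * (tau - ga * m%:R).
Proof.
rewrite -mulr_sumr sumrB trT -mulr_sumr; congr (_ * (_ - _ * _)).
rewrite (eq_bigr (fun=> 1)) => [|b _]; last by rewrite /D eqxx.
by rewrite sumr_const card_ord.
Qed.

Let traceE a c : \sum_b sym_delta M a b c b = T a c.
Proof.
have -> : \sum_b sym_delta M a b c b = M a c * m%:R + M a c + M a c
    + (\sum_b M b b) * D a c + (e * M a c + e * M c a).
  have S1 : \sum_b M a c * D b b = M a c * m%:R.
    rewrite -mulr_sumr; congr (_ * _).
    rewrite (eq_bigr (fun=> 1)) => [|b _]; last by rewrite /D eqxx.
    by rewrite sumr_const card_ord.
  have S2 : \sum_b D a b * M c b = M c a.
    by rewrite -(sum_delta (M c) a); apply: eq_bigr => b _; rewrite mulrC.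
  have S3 : \sum_b e * (M a b * D c b + D a b * M c b) = e * M a c + e * M c a.
    by rewrite -mulr_sumr big_split /= S2 (sum_delta (M a)) mulrDr.
  rewrite /sym_delta !big_split /= S1 S3 -mulr_suml.
  by rewrite (sum_delta_sym (M a)) (sum_delta (M^~ c)).
rewrite -(eM a c) trM.
transitivity (al * (m%:R + 2 + 2 * e) * T a c + al * (tau - ga * (2 * m%:R + 2 + 2 * e)) * D a c).
  by rewrite /M; ring.
by rewrite k1E k2E subrr mulr0 mul0r addr0 mul1r.
Qed.

Let l := \sum_a \sum_c T a c * conj (M a c).

Let pairS : \sum_a \sum_b \sum_c \sum_d S a b c d * conj (sym_delta M a b c d) = (4 + 2 * e) * l.
Proof.
transitivity (\sum_a \sum_b \sum_c \sum_d S a b c d * sym_delta (fun a b => conj (M a b)) a b c d).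
  by do 4!(apply: eq_bigr => ? _); rewrite conj_sym_delta.
rewrite sym_delta_pairing //.
- by congr (_ * _); do 2!(apply: eq_bigr => ? _); rewrite traceS.
- by move=> a b c d; apply: eq_bigr => i _; ring.
- by move=> a b c d; apply: eq_bigr => i _; ring.
Qed.

Let pairE : \sum_a \sum_b \sum_c \sum_d sym_delta M a b c d * conj (sym_delta M a b c d)
  = (4 + 2 * e) * l.
Proof.
transitivity (\sum_a \sum_b \sum_c \sum_d sym_delta M a b c d * sym_delta (fun a b => conj (M a b)) a b c d).
  by do 4!(apply: eq_bigr => ? _); rewrite conj_sym_delta.
have [E12 E34 E23] := sym_delta_sym eM.
rewrite sym_delta_pairing //.
by congr (_ * _); do 2!(apply: eq_bigr => ? _); rewrite traceE.
Qed.

Let pairSS : \sum_a \sum_b \sum_c \sum_d S a b c d * conj (S a b c d) =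
  \sum_i \sum_j Y i * Y j * (z i j * conj (z i j)) ^+ 2.
Proof.
transitivity (\sum_a \sum_b \sum_c \sum_d \sum_i \sum_j
  (Y i * (w i a * w i b * conj (w i c) * conj (w i d))) *
  (Y j * (conj (w j a) * conj (w j b) * w j c * w j d))).
  do 4!(apply: eq_bigr => ? _); rewrite rmorph_sum mulr_suml /=.
  apply: eq_bigr => i _; rewrite mulr_sumr; apply: eq_bigr => j _.
  by rewrite !rmorphM /= conjY !conjKK.
rewrite exchange_sum4; apply: eq_bigr => i _.
rewrite exchange_sum4; apply: eq_bigr => j _.
have -> : Y i * Y j * (z i j * conj (z i j)) ^+ 2 =
  (Y i * Y j) * (z i j * z i j * z j i * z j i) by rewrite z_conj; ring.
rewrite /z prod_sum4 mulr_sumr; apply: eq_bigr => a _.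
rewrite mulr_sumr; apply: eq_bigr => b _; rewrite mulr_sumr; apply: eq_bigr => c _.
rewrite mulr_sumr; apply: eq_bigr => d _; ring.
Qed.

Let lE : l = al * (\sum_i \sum_j Y i * Y j * z i i * z j j * (z i j * conj (z i j))
   - conj ga * tau).
Proof.
have conj_al : conj al = al by rewrite conjK_ofR.
have -> : l = al * (\sum_a \sum_c T a c * conj (T a c) - conj ga * tau).
  rewrite -trT mulrBr [conj ga * _]mulr_sumr !mulr_sumr -sumrB; apply: eq_bigr => a _.
  rewrite mulr_sumr -(sum_delta_sym (fun c => al * (conj ga * T a c)) a) -sumrB.
  apply: eq_bigr => c _.
  by rewrite /M rmorphM rmorphB rmorphM /= conjD conj_al /D eq_sym; ring.
congr (_ * (_ - _)).
transitivity (\sum_a \sum_c \sum_i \sum_j (Y i * z i i * (w i a * conj (w i c))) *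
  (Y j * z j j * (conj (w j a) * w j c))).
  do 2!(apply: eq_bigr => ? _); rewrite rmorph_sum mulr_suml /=.
  apply: eq_bigr => i _; rewrite mulr_sumr; apply: eq_bigr => j _.
  by rewrite !rmorphM /= conjY z_conj !conjKK.
have ex2 (I : finType) (f : 'I_m -> 'I_m -> I -> K) :
    \sum_a \sum_c \sum_i f a c i = \sum_i \sum_a \sum_c f a c i.
  rewrite [RHS]exchange_big; apply: eq_bigr => a _ /=.
  by rewrite [RHS]exchange_big.
rewrite ex2; apply: eq_bigr => i _; rewrite ex2; apply: eq_bigr => j _.
have -> : z i j * conj (z i j) =
    \sum_a \sum_c (w i a * conj (w j a)) * (w j c * conj (w i c)).
  by rewrite z_conj {1}/z mulr_suml; apply: eq_bigr => a _; rewrite mulr_sumr.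
rewrite [RHS]mulr_sumr; apply: eq_bigr => a _.
by rewrite [RHS]mulr_sumr; apply: eq_bigr => c _; ring.
Qed.

(* Expand [|S - E|^2 >= 0] for the best approximation [E = sym_delta M] of the
   fourth-moment tensor [S]: both have the same partial trace [T]. *)
Lemma fourth_moment_ge :
  (4 + 2 * real_flag) / (m%:R + 2 + 2 * real_flag) *
    (\sum_i \sum_j y i * y j * re (z i i) * re (z j j) * rnorm (z i j) ^+ 2
     - (\sum_i y i * re (z i i) ^+ 2) ^+ 2 / (2 * m%:R + 2 + 2 * real_flag))
  <= \sum_i \sum_j y i * y j * rnorm (z i j) ^+ 4.
Proof.
have zii i : z i i = ofr (re (z i i)).
  have -> : z i i = ofr (\sum_a rnorm (w i a) ^+ 2).
    by rewrite rmorph_sum; apply: eq_bigr => a _; rewrite mul_conjK.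
  by rewrite reK_ofR.
have h : 0 <= re (\sum_a \sum_b \sum_c \sum_d (S a b c d - sym_delta M a b c d) *
   conj (S a b c d - sym_delta M a b c d)).
  have sq x : 0 <= re (x * conj x) by rewrite mul_conjK reK_ofR sqr_ge0.
  by do 4!(rewrite raddf_sum; apply: sumr_ge0 => ? _); exact: sq.
have E : \sum_a \sum_b \sum_c \sum_d (S a b c d - sym_delta M a b c d) *
   conj (S a b c d - sym_delta M a b c d) =
   \sum_i \sum_j Y i * Y j * (z i j * conj (z i j)) ^+ 2 - conj ((4 + 2 * e) * l).
  have pairES : \sum_a \sum_b \sum_c \sum_d sym_delta M a b c d * conj (S a b c d) =
      conj ((4 + 2 * e) * l).
    rewrite -pairS; do 4!(rewrite rmorph_sum; apply: eq_bigr => ? _).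
    by rewrite rmorphM /= conjKK mulrC.
  transitivity (\sum_a \sum_b \sum_c \sum_d (S a b c d * conj (S a b c d)
      - S a b c d * conj (sym_delta M a b c d) - sym_delta M a b c d * conj (S a b c d)
      + sym_delta M a b c d * conj (sym_delta M a b c d))).
    by do 4!(apply: eq_bigr => ? _); rewrite rmorphB; ring.
  transitivity (\sum_a \sum_b \sum_c \sum_d S a b c d * conj (S a b c d)
    - \sum_a \sum_b \sum_c \sum_d S a b c d * conj (sym_delta M a b c d)
    - \sum_a \sum_b \sum_c \sum_d sym_delta M a b c d * conj (S a b c d)
    + \sum_a \sum_b \sum_c \sum_d sym_delta M a b c d * conj (sym_delta M a b c d)).
    by do 4!(rewrite -!sumrN -!big_split; apply: eq_bigr => ? _).
  by rewrite pairSS pairS pairES pairE; ring.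
move: h; rewrite E raddfB /= reK_conj subr_ge0.
have -> : 4 + 2 * e = ofr (4 + 2 * real_flag).
  by rewrite rmorphD /= rmorphM /= !rmorph_nat.
have tauE : tau = ofr (\sum_i y i * re (z i i) ^+ 2).
  rewrite rmorph_sum; apply: eq_bigr => i _.
  by rewrite rmorphM rmorphXn /= -zii.
set Q := \sum_i \sum_j y i * y j * re (z i i) * re (z j j) * _.
set t := \sum_i y i * _ ^+ 2 in tauE *.
have QE : \sum_i \sum_j Y i * Y j * z i i * z j j * (z i j * conj (z i j)) = ofr Q.
  rewrite rmorph_sum; apply: eq_bigr => i _; rewrite rmorph_sum; apply: eq_bigr => j _.
  by rewrite mul_conjK !rmorphM /= -!zii.
have -> : l = ofr (k1^-1 * (Q - t ^+ 2 / k2)).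
  rewrite lE QE /ga tauE -rmorphM conjK_ofR -rmorphM -rmorphB -rmorphM /=.
  by congr (ofr (_ * (_ - _))); ring.
have -> : \sum_i \sum_j Y i * Y j * (z i j * conj (z i j)) ^+ 2 =
    ofr (\sum_i \sum_j y i * y j * rnorm (z i j) ^+ 4).
  rewrite rmorph_sum; apply: eq_bigr => i _; rewrite rmorph_sum; apply: eq_bigr => j _.
  by rewrite mul_conjK -rmorphXn -!rmorphM /= -exprM.
by rewrite -rmorphM !reK_ofR mulrA.
Qed.

End Moments.
End FourthMoment.

(** * Orthogonal projections *)

Section OrthogonalProjections.
Variables (R : realType) (F : scalar_field).
Local Notation K := (scalars R F).
Local Notation conj := (@conjK R F).
Local Notation re := (@reK R F).
Local Notation ofr := (@ofR R F).
Local Notation adj := (@adjmx R F _ _).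

Lemma adjmxE m n (A : 'M[K]_(m, n)) i j : adj A i j = conj (A j i).
Proof. by rewrite !mxE. Qed.

Lemma adjmxK m n (A : 'M[K]_(m, n)) : adj (adj A) = A.
Proof. by apply/matrixP => i j; rewrite !adjmxE conjKK. Qed.

Lemma adjmxM m n p (A : 'M[K]_(m, n)) (B : 'M[K]_(n, p)) :
  adj (A *m B) = adj B *m adj A.
Proof. by rewrite /adjmx trmx_mul map_mxM. Qed.

Lemma adjmxB m n (A B : 'M[K]_(m, n)) : adj (A - B) = adj A - adj B.
Proof. by rewrite /adjmx raddfB map_mxB. Qed.

Lemma adjmx1 n : adj (1%:M : 'M[K]_n) = 1%:M.
Proof. by rewrite /adjmx trmx1 map_mx1. Qed.

Lemma adjmx0 m n : adj (0 : 'M[K]_(m, n)) = 0.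
Proof. by rewrite /adjmx trmx0 map_mx0. Qed.

Lemma adjmxZ m n a (A : 'M[K]_(m, n)) : adj (a *: A) = conj a *: adj A.
Proof. by apply/matrixP => i j; rewrite adjmxE [RHS]mxE adjmxE mxE rmorphM. Qed.

Lemma adjmx_inv n (A : 'M[K]_n) : adj (invmx A) = invmx (adj A).
Proof. by rewrite /adjmx trmx_inv map_invmx. Qed.

Lemma mulmx_adj_diag m n (A : 'M[K]_(m, n)) i :
  (A *m adj A) i i = ofr (\sum_j rnorm (A i j) ^+ 2).
Proof.
rewrite mxE rmorph_sum; apply: eq_bigr => j _.
by rewrite adjmxE mul_conjK.
Qed.

Lemma mulmx_adj_eq0 m n (A : 'M[K]_(m, n)) : A *m adj A = 0 -> A = 0.
Proof.
move=> A0; apply/matrixP => i j; rewrite mxE.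
have /ofR_inj/eqP : ofr (\sum_j rnorm (A i j) ^+ 2) = ofr 0.
  by rewrite -mulmx_adj_diag A0 mxE rmorph0.
rewrite psumr_eq0 => [/allP /(_ j)|k _]; last exact: sqr_ge0.
by rewrite mem_index_enum sqrf_eq0 rnorm_eq0 => /(_ isT) /eqP.
Qed.

Definition orthoproj N (G : 'M[K]_N) := adj G = G /\ G *m G = G.

Lemma orthoproj_compl N (G : 'M[K]_N) : orthoproj G -> orthoproj (1%:M - G).
Proof.
move=> [Ga GG]; split; first by rewrite adjmxB adjmx1 Ga.
by rewrite mulmxBl !mulmxBr !mul1mx mulmx1 GG subrr subr0.
Qed.

Lemma orthoproj_diag N (G : 'M[K]_N) i : orthoproj G ->
  G i i = ofr (\sum_j rnorm (G i j) ^+ 2).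
Proof. by move=> [Ga GG]; rewrite -mulmx_adj_diag Ga GG. Qed.

Lemma orthoproj_of_isometry d N (V : 'M[K]_(d, N)) :
  V *m adj V = 1%:M -> orthoproj (adj V *m V) /\ \tr (adj V *m V) = d%:R.
Proof.
move=> VV; split; last by rewrite mxtrace_mulC VV mxtrace1.
split; first by rewrite adjmxM adjmxK.
by rewrite mulmxA -[adj V *m V *m _]mulmxA VV mulmx1.
Qed.

(** Induction on the rank: a nonzero row of G, normalized, is a unit vector fixed by G, and
    subtracting its rank-one projection leaves an orthogonal projection of trace one less. At trace
    0 all row norms vanish, because the diagonal entries are their squares. *)
Lemma orthoproj_gram d N (G : 'M[K]_N) : orthoproj G -> \tr G = d%:R ->
  exists V : 'M[K]_(d, N), V *m adj V = 1%:M /\ adj V *m V = G.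
Proof.
elim: d G => [|d IH] G pG trG.
  exists 0; split; first by rewrite [LHS]flatmx0 [RHS]flatmx0.
  rewrite mulmx0; apply/esym/mulmx_adj_eq0; case: (pG) => -> ->.
  apply/mulmx_adj_eq0; case: (pG) => -> ->.
  have /ofR_inj/eqP h : ofr (\sum_i \sum_j rnorm (G i j) ^+ 2) = ofr 0.
    rewrite [RHS]rmorph0 -[RHS]trG rmorph_sum.
    by apply: eq_bigr => i _; rewrite (orthoproj_diag i pG).
  apply/matrixP => i j; rewrite mxE.
  move: h; rewrite psumr_eq0 => [/allP /(_ i)|k _]; last by apply: sumr_ge0 => l _; exact: sqr_ge0.
  rewrite mem_index_enum => /(_ isT).
  rewrite psumr_eq0 => [/allP /(_ j)|k _]; last exact: sqr_ge0.
  by rewrite mem_index_enum sqrf_eq0 rnorm_eq0 => /(_ isT) /eqP.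
have [i Gii] : exists i, G i i != 0.
  apply: contrapT => /forallNP h.
  have : \tr G = 0 by apply: big1 => i _; apply/eqP/negP => /negP; exact: h.
  by rewrite trG => /eqP; rewrite pnatr_eq0.
have [Ga GG] := pG.
pose c := \sum_j rnorm (G i j) ^+ 2.
have c0 : 0 < c.
  rewrite lt0r; apply/andP; split; last by apply: sumr_ge0 => j _; exact: sqr_ge0.
  by move: Gii; rewrite (orthoproj_diag i pG) -/c; apply: contra_neq => ->; rewrite rmorph0.
pose s := Num.sqrt c.
have s0 : s != 0 by rewrite lt0r_neq0 // sqrtr_gt0.
pose v := ofr s^-1 *: row i G.
have vv : v *m adj v = 1%:M.
  rewrite [LHS]mx11_scalar mulmx_adj_diag; congr (_%:M).
  have -> : \sum_j rnorm (v ord0 j) ^+ 2 = s^-1 ^+ 2 * c.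
    rewrite mulr_sumr; apply: eq_bigr => j _.
    by rewrite !mxE rnormM rnorm_ofR exprMn real_normK ?num_real.
  by rewrite exprVn sqr_sqrtr ?ltW // mulVf ?rmorph1 // lt0r_neq0.
have vG : v *m G = v by rewrite -scalemxAl -row_mul GG.
have Gv : G *m adj v = adj v by rewrite -{1}Ga -adjmxM vG.
pose G' := G - adj v *m v.
have vG' : v *m G' = 0 by rewrite mulmxBr vG mulmxA vv mul1mx subrr.
have pG' : orthoproj G'.
  split; first by rewrite adjmxB adjmxM adjmxK Ga.
  by rewrite {1}/G' mulmxBl -mulmxA vG' mulmx0 subr0 mulmxBr GG mulmxA Gv.
have [|V [VV VG]] := IH G' pG'.
  rewrite raddfB /= trG mxtrace_mulC vv mxtrace1 -natr1.
  by rewrite addrK.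
have vV : v *m adj V = 0.
  have -> : adj V = G' *m adj V by rewrite -VG -mulmxA VV mulmx1.
  by rewrite mulmxA vG' mul0mx.
have adjcol : adj (col_mx v V) = row_mx (adj v) (adj V).
  by rewrite /adjmx tr_col_mx map_row_mx.
have Vv : V *m adj v = 0 by rewrite -[LHS]adjmxK adjmxM adjmxK vV adjmx0.
have h1 : col_mx v V *m adj (col_mx v V) = 1%:M.
  by rewrite adjcol mul_col_row vv VV vV Vv -scalar_mx_block.
have h2 : adj (col_mx v V) *m col_mx v V = G.
  by rewrite adjcol mul_row_col VG /G' addrCA subrr addr0.
by exists (col_mx v V).
Qed.

Lemma row_span_orthoproj m N (A : 'M[K]_(m, N))
    (Afree : forall c : 'rV_m, c *m A = 0 -> c = 0) :
  let G := adj A *m invmx (A *m adj A) *m A in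
  [/\ A *m adj A \in unitmx, orthoproj G & \tr G = m%:R].
Proof.
have AU : A *m adj A \in unitmx.
  rewrite -row_free_unit; apply: inj_row_free => c cA; apply: Afree.
  by apply: mulmx_adj_eq0; rewrite adjmxM mulmxA -(mulmxA c) cA mul0mx.
move=> G; split=> //; last first.
  by rewrite /G mxtrace_mulC mulmxA mulmxV // mxtrace1.
split; first by rewrite /G !adjmxM adjmx_inv adjmxM !adjmxK mulmxA.
by rewrite /G !mulmxA -[_ *m A *m adj A]mulmxA mulmxKV.
Qed.

End OrthogonalProjections.

(** The columns of a 2 x 6 Gram factor are written in polar form. Its rows are orthonormal exactly
    when the r_i^2 sum to 2 and the sums of r_i^2 times the cosine and the sine of the doubled angle
    vanish. *)
Lemma plane_projection_sum_le (R : realType) (G : 'M[scalars R RealScalars]_6)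
    (t : 'I_6 -> R) (pG : orthoproj G) (trG : \tr G = 2)
    (t0 : forall i, 0 <= t i) (tnorm : \sum_i t i ^+ 2 = 1) :
  \sum_i \sum_j t i * t j * rnorm (G i j) - 2 * (\sum_i t i ^+ 2 * rnorm (G i i))
   <= 2 / 3.
Proof.
have [U [UU UG]] := orthoproj_gram pG trG.
pose a i : R := U ord0 i; pose b i : R := U ord_max i.
have normE (x : R) : rnorm (x : scalars R RealScalars) = `|x| by [].
have GE i j : G i j = a i * a j + b i * b j :> R.
  rewrite -UG mxE !big_ord_recl big_ord0 addr0 !adjmxE /=; congr (_ * _ + _ * _).
    by congr (U _ _); apply: val_inj.
  by congr (U _ _); apply: val_inj.
have UUE i j : \sum_k U i k * U j k = (i == j)%:R :> R.
  have <- : (U *m adjmx U) i j = (i == j)%:R by rewrite UU mxE.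
  by rewrite mxE; apply: eq_bigr => k _; rewrite adjmxE.
pose r i := Num.sqrt (a i ^+ 2 + b i ^+ 2).
have ab0 i : 0 <= a i ^+ 2 + b i ^+ 2 by rewrite addr_ge0 ?sqr_ge0.
have r0 i : 0 <= r i by exact: sqrtr_ge0.
have r2 i : r i ^+ 2 = a i ^+ 2 + b i ^+ 2 by rewrite sqr_sqrtr.
(* A zero column gets the direction (1, 0), so that every (u_i, v_i) is a unit vector. *)
pose u i := if r i == 0 then 1 else a i / r i.
pose v i := if r i == 0 then 0 else b i / r i.
have uv1 i : u i ^+ 2 + v i ^+ 2 = 1.
  rewrite /u /v; case: eqVneq => ri; first by rewrite expr1n expr0n addr0.
  by rewrite !expr_div_n -mulrDl -r2 divff // sqrf_eq0.
have ab i : a i = r i * u i /\ b i = r i * v i.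
  rewrite /u /v; case: eqVneq => ri; last by split; rewrite mulrC mulfVK.
  move: (r2 i); rewrite ri expr0n => /esym/eqP; rewrite paddr_eq0 ?sqr_ge0 //.
  by rewrite !sqrf_eq0 => /andP[/eqP -> /eqP ->]; rewrite !mul0r.
pose c i := u i ^+ 2 - v i ^+ 2; pose d i := 2 * u i * v i.
pose s i j := `|u i * u j + v i * v j|.
have s2 i j : s i j ^+ 2 = (u i * u j + v i * v j) ^+ 2 by rewrite real_normK ?num_real.
have r2c i : r i ^+ 2 * c i = a i ^+ 2 - b i ^+ 2 by rewrite (ab i).1 (ab i).2 /c; ring.
have r2d i : r i ^+ 2 * d i = 2 * (a i * b i) by rewrite (ab i).1 (ab i).2 /d; ring.
have Saa : \sum_i a i ^+ 2 = 1 by have := UUE ord0 ord0.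
have Sbb : \sum_i b i ^+ 2 = 1 by have := UUE ord_max ord_max.
have Sab : \sum_i a i * b i = 0 by have := UUE ord0 ord_max.
have uv2 i j : (u i ^+ 2 + v i ^+ 2) * (u j ^+ 2 + v j ^+ 2) = 1 by rewrite !uv1 mulr1.
apply: (@rotated_plane_bound R (fun i j => rnorm (G i j)) r t c d s) => //.
- by move=> i; rewrite -[RHS](uv2 i i) /c /d; ring.
- move=> i j; rewrite GE normE -[r i * r j]ger0_norm ?mulr_ge0 // -normrM.
  by congr `|_|; rewrite (ab i).1 (ab j).1 (ab i).2 (ab j).2; ring.
- move=> i j; rewrite normr_ge0 /= -[s i j]ger0_norm ?normr_ge0 // -[1]ger0_norm //.
  rewrite -ler_sqr ?nnegrE // !real_normK ?num_real // expr1n -(uv2 i j) -subr_ge0.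
  have -> : (u i ^+ 2 + v i ^+ 2) * (u j ^+ 2 + v j ^+ 2) - (u i * u j + v i * v j) ^+ 2
    = (u i * v j - v i * u j) ^+ 2 by ring.
  by rewrite sqr_ge0.
- by move=> i j; rewrite s2 -[X in _ - X](uv2 i j) /c /d; ring.
- by move=> i; rewrite GE normE -!expr2 ger0_norm // r2.
- by rewrite (eq_bigr _ (fun i _ => r2 i)) big_split /= Saa Sbb.
- by rewrite (eq_bigr _ (fun i _ => r2c i)) sumrB Saa Sbb subrr.
- by rewrite (eq_bigr _ (fun i _ => r2d i)) -mulr_sumr Sab mulr0.
Qed.

(** [F] and [N] are variables here, so that the equations can be substituted although the type of G
    depends on them. *)
Lemma plane_projection_sum_le_eq (R : realType) (F : scalar_field) (N : nat)
    (G : 'M[scalars R F]_N) (t : 'I_N -> R) (FE : F = RealScalars) (NE : N = 6)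
    (pG : orthoproj G) (trG : \tr G = 2)
    (t0 : forall i, 0 <= t i) (tnorm : \sum_i t i ^+ 2 = 1) :
  \sum_i \sum_j t i * t j * rnorm (G i j) - 2 * (\sum_i t i ^+ 2 * rnorm (G i i))
   <= 2 / 3.
Proof. by subst F N; exact: plane_projection_sum_le. Qed.

(** * Upper bounds for sums over orthogonal projections *)

Section KeyBounds.
Variables (R : realType) (F : scalar_field).
Local Notation K := (scalars R F).
Local Notation conj := (@conjK R F).
Local Notation re := (@reK R F).
Local Notation ofr := (@ofR R F).
Local Notation adj := (@adjmx R F _ _).
Local Notation e := (real_flag R F).

Section Data.
Variables (N : nat) (G : 'M[K]_N).
Hypothesis pG : orthoproj G.
Let g i j := rnorm (G i j).
Let r i := Num.sqrt (re (G i i)).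

Lemma orthoproj_tight i : \sum_j g i j ^+ 2 = re (G i i).
Proof. by rewrite (orthoproj_diag i pG) reK_ofR. Qed.

Lemma orthoproj_diag_ge0 i : 0 <= re (G i i).
Proof. by rewrite -orthoproj_tight; apply: sumr_ge0 => j _; exact: sqr_ge0. Qed.

Lemma orthoproj_diagE i : g i i = re (G i i).
Proof.
by rewrite /g (orthoproj_diag i pG) rnorm_ofR reK_ofR ger0_norm // sumr_ge0 // => j _; rewrite sqr_ge0.
Qed.

Lemma orthoproj_normC i j : g i j = g j i.
Proof. by rewrite /g -{1}pG.1 adjmxE rnorm_conj. Qed.

Lemma orthoproj_norm_le i j : g i j <= r i * r j.
Proof.
rewrite /r -sqrtrM ?orthoproj_diag_ge0 //.
apply: le_trans (ler_norm _) _; rewrite -sqrtr_sqr ler_wsqrtr //.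
rewrite -!orthoproj_tight.
apply: le_trans (sum_CauchySchwarz _ _); rewrite ler_sqr ?nnegrE ?rnorm_ge0 //; last first.
  by apply: sumr_ge0 => k _; rewrite mulr_ge0 ?rnorm_ge0.
rewrite /g -{1}pG.2 mxE; apply: le_trans (rnorm_sum _ _ _) _.
by apply: ler_sum => k _; rewrite rnormM -/(g k j) orthoproj_normC.
Qed.

Lemma orthoproj_trace m : \tr G = m%:R -> \sum_i re (G i i) = m%:R.
Proof. by rewrite -raddf_sum => h; rewrite -[LHS]/(re (\tr G)) h -(rmorph_nat ofr) reK_ofR. Qed.

Lemma orthoproj_fourth_moment m : \tr G = m%:R -> forall y : 'I_N -> R,
  (4 + 2 * e) / (m%:R + 2 + 2 * e) *
    (\sum_i \sum_j y i * y j * r i ^+ 2 * r j ^+ 2 * g i j ^+ 2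
     - (\sum_i y i * r i ^+ 4) ^+ 2 / (2 * m%:R + 2 + 2 * e))
  <= \sum_i \sum_j y i * y j * g i j ^+ 4.
Proof.
move=> trG y.
have [U [UU UG]] := orthoproj_gram pG trG.
have := fourth_moment_ge (fun i a => U a i) y.
have zE i j : \sum_a U a i * conj (U a j) = G j i.
  by rewrite -UG mxE; apply: eq_bigr => a _; rewrite adjmxE mulrC.
have r2 i : r i ^+ 2 = re (G i i) by rewrite sqr_sqrtr ?orthoproj_diag_ge0.
have r4 i : r i ^+ 4 = re (G i i) ^+ 2 by rewrite -r2 -exprM.
have -> : \sum_i \sum_j y i * y j * re (\sum_a U a i * conj (U a i)) *
  re (\sum_a U a j * conj (U a j)) * rnorm (\sum_a U a i * conj (U a j)) ^+ 2 =
  \sum_i \sum_j y i * y j * r i ^+ 2 * r j ^+ 2 * g i j ^+ 2.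
  by do 2!(apply: eq_bigr => ? _); rewrite !zE !r2 orthoproj_normC.
have -> : \sum_i y i * re (\sum_a U a i * conj (U a i)) ^+ 2 = \sum_i y i * r i ^+ 4.
  by apply: eq_bigr => i _; rewrite zE r4.
have -> : \sum_i \sum_j y i * y j * rnorm (\sum_a U a i * conj (U a j)) ^+ 4 =
  \sum_i \sum_j y i * y j * g i j ^+ 4.
  by do 2!(apply: eq_bigr => ? _); rewrite zE orthoproj_normC.
by [].
Qed.

End Data.

Variable m : nat.
Hypothesis hm : (2 <= m)%N.
Local Notation M := (max_etf_size F m).

(** The common angle of a maximal equiangular tight frame: 1 / sqrt(m + 2) over the reals, 1 /
    sqrt(m + 1) over the complex numbers. *)
Definition etf_angle : R := (Num.sqrt (m%:R + 1 + e))^-1.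
(** The weighted sum at uniform weights for the projection built from such a frame, whose entries
    have modulus m / M on the diagonal and m p / M off it. *)
Definition max_proj_value : R := m%:R / M%:R * (1 + (M%:R - 1) * etf_angle).

Let mu_ge2 : 2 <= m%:R :> R. Proof. by rewrite (ler_nat R 2). Qed.

Let e_itv : e = 0 \/ e = 1.
Proof. by rewrite /real_flag; case: F; [right|left]. Qed.

Let e_ge0 : 0 <= e. Proof. by case: e_itv => ->. Qed.

Let mue_gt0 : 0 < m%:R + 1 + e.
Proof. by move: mu_ge2 e_ge0; lra. Qed.

Lemma etf_angle_gt0 : 0 < etf_angle.
Proof. by rewrite invr_gt0 sqrtr_gt0. Qed.

Lemma etf_angleE : etf_angle ^+ 2 * (m%:R + 1 + e) = 1.
Proof. by rewrite exprVn sqr_sqrtr ?ltW // mulVf // lt0r_neq0. Qed.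

Lemma max_etf_sizeE : M%:R = m%:R * (m%:R + e) / (1 + e) :> R.
Proof.
rewrite /real_flag; case: F => /=; last by rewrite natrX !addr0 divr1 expr2.
apply: (canRL (mulfK _)); first by rewrite -(natrD R 1 1) pnatr_eq0.
rewrite -(natrD R 1 1) -natrM divnK; last by rewrite dvdn2 addn1 oddM /=; case: odd.
by rewrite natrM natrD.
Qed.

Lemma max_etf_size_gt : (m < M)%N.
Proof.
rewrite -(ltr_nat R) max_etf_sizeE ltr_pdivlMr; last by move: e_ge0; lra.
rewrite ltr_pM2l; last by move: mu_ge2; lra.
by move: mu_ge2; case: e_itv => ->; lra.
Qed.

Variables (N : nat) (G : 'M[K]_N) (t : 'I_N -> R).
Hypotheses (pG : orthoproj G) (trG : \tr G = m%:R).
Hypotheses (t0 : forall i, 0 <= t i) (tnorm : \sum_i t i ^+ 2 = 1).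

Let r0 i : 0 <= Num.sqrt (re (G i i)). Proof. exact: sqrtr_ge0. Qed.

Let r2 i : rnorm (G i i) = Num.sqrt (re (G i i)) ^+ 2.
Proof. by rewrite sqr_sqrtr ?orthoproj_diag_ge0 // orthoproj_diagE. Qed.

Let tight i : \sum_j rnorm (G i j) ^+ 2 = Num.sqrt (re (G i i)) ^+ 2.
Proof. by rewrite sqr_sqrtr ?orthoproj_diag_ge0 // orthoproj_tight. Qed.

Let trace : \sum_i Num.sqrt (re (G i i)) ^+ 2 = m%:R.
Proof.
rewrite -(orthoproj_trace trG); apply: eq_bigr => i _.
by rewrite sqr_sqrtr ?orthoproj_diag_ge0.
Qed.

Lemma projection_sum_le :
  \sum_i \sum_j t i * t j * rnorm (G i j) <= max_proj_value.
Proof.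
rewrite /max_proj_value -(coef_sum mu_ge2 etf_angle_gt0 etf_angleE e_itv max_etf_sizeE).
apply: (@weighted_sum_le _ _ _ (fun i j => rnorm (G i j)) (fun i => Num.sqrt (re (G i i))) t) => //.
- by move=> i j; exact: rnorm_ge0.
- exact: orthoproj_normC.
- exact: orthoproj_norm_le.
- exact: orthoproj_fourth_moment.
- exact: etf_angle_gt0.
Qed.

Let value_large (hN : (0 < N)%N) : 16 * (m%:R + 1 + e) <= N%:R ^+ 2 ->
  \sum_i \sum_j t i * t j * rnorm (G i j) - 2 * (\sum_i t i ^+ 2 * rnorm (G i i))
   <= max_proj_value - 2 * m%:R / N%:R.
Proof.
move=> hlarge.
rewrite /max_proj_value -(coef_sum mu_ge2 etf_angle_gt0 etf_angleE e_itv max_etf_sizeE).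
apply: (@weighted_sum_diag_le _ _ _ (fun i j => rnorm (G i j)) (fun i => Num.sqrt (re (G i i))) t) => //.
- by move=> i j; exact: rnorm_ge0.
- exact: orthoproj_normC.
- exact: orthoproj_norm_le.
- exact: orthoproj_fourth_moment.
- exact: etf_angle_gt0.
apply: le_constant_coef => //; first exact: etf_angle_gt0.
  exact: etf_angleE.
by rewrite ltr0n.
Qed.

Let value_equiangular : N = M ->
  \sum_i \sum_j t i * t j * rnorm (G i j) - 2 * (\sum_i t i ^+ 2 * rnorm (G i i))
   <= max_proj_value - 2 * m%:R / N%:R.
Proof.
move=> NM; have mu0 : 0 < m%:R :> R by move: mu_ge2; lra.
have N0 : (0 < N)%N by rewrite NM (leq_ltn_trans _ max_etf_size_gt).
have al0 : 0 < m%:R * etf_angle / 2 by rewrite divr_gt0 // mulr_gt0 // etf_angle_gt0.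
apply: le_trans (@weighted_sum_equiangular_le R N m%:R _ (fun i j => rnorm (G i j)) t N0 al0 _ _ tnorm) _.
- by move=> i; rewrite tight r2.
- by rewrite -trace; apply: eq_bigr => i _; rewrite r2.
rewrite NM (equiangular_value mu_ge2 etf_angle_gt0 etf_angleE e_itv max_etf_sizeE).
by rewrite lexx.
Qed.

Lemma projection_sum_diag_le (k : nat) : (1 <= k)%N -> N = (k * M)%N ->
  \sum_i \sum_j t i * t j * rnorm (G i j) - 2 * (\sum_i t i ^+ 2 * rnorm (G i i))
   <= max_proj_value - 2 * m%:R / N%:R.
Proof.
move=> k1 NE.
have [kE|k2] := eqVneq k 1%N; first by apply: value_equiangular; rewrite NE kE mul1n.
have {k1 k2}k2 : (2 <= k)%N by case: k k1 k2 {NE} => [|[|k]].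
have M0 : (0 < M)%N by exact: leq_ltn_trans max_etf_size_gt.
have N0 : (0 < N)%N by rewrite NE muln_gt0 M0 (leq_trans _ k2).
(* The threshold N >= 4 / p, at which p / 2 <= A already ensures 2 / N <= A. *)
have [hlarge|hsmall] := leP (16 * (m%:R + 1 + e)) (N%:R ^+ 2); first exact: value_large.
have n0 : 0 <= N%:R :> R by [].
have NRE : N%:R * (1 + e) = k%:R * m%:R * (m%:R + e).
  rewrite NE natrM max_etf_sizeE; field.
  by apply: lt0r_neq0; move: e_ge0; lra.
(* Over the complex numbers k >= 2 gives N >= 2 m^2 >= 4 m, which is large enough; over the reals k
   m >= 6 gives N >= 3 (m + 1), which is too. What remains is the plane with k = 2. *)
have [FE km] : F = RealScalars /\ (k * m < 6)%N.
  move: hsmall NRE; rewrite /real_flag; case: F => [hs hN|hs hN]; last first.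
    exfalso; move: hs; apply/negP; rewrite -leNgt.
    have -> : N%:R = k%:R * m%:R * m%:R :> R by move: hN; lra.
    have k2r : 2 <= k%:R :> R by rewrite (ler_nat R 2).
    have kmm : 2 * (m%:R * m%:R) <= k%:R * m%:R * m%:R :> R.
      by rewrite -mulrA ler_wpM2r // mulr_ge0.
    have m4 : 2 * m%:R <= m%:R * m%:R :> R by rewrite ler_wpM2r.
    have : (4 * m%:R) ^+ 2 <= (k%:R * m%:R * m%:R) ^+ 2 :> R.
      by rewrite ler_sqr ?nnegrE ?mulr_ge0 //; lra.
    by apply: le_trans; move: m4 mu_ge2; lra.
  split=> //; rewrite ltnNge; apply/negP => km; move: hs; apply/negP; rewrite -leNgt.
  have km6 : 6 <= k%:R * m%:R :> R by rewrite -natrM (ler_nat R 6).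
  have h : 6 * (m%:R + 1) <= N%:R * (1 + 1) :> R by rewrite hN ler_wpM2r // addr_ge0.
  have : (3 * (m%:R + 1)) ^+ 2 <= N%:R ^+ 2 :> R.
    by rewrite ler_sqr ?nnegrE ?mulr_ge0 ?addr_ge0 //; move: h; lra.
  by apply: le_trans; have := sqr_ge0 (m%:R - 2 : R); move: mu_ge2; nra.
have [mE kE] : m = 2%N /\ k = 2%N.
  move: km k2 hm; clear; case: k => [|[|[|k]]] //; case: m => [|[|[|m']]] //=; lia.
have NE6 : N = 6%N by rewrite NE kE mE FE.
have := @plane_projection_sum_le_eq R F N G t FE NE6 pG _ t0 tnorm.
rewrite trG mE => /(_ erefl) h; apply: le_trans h _.
have pE : etf_angle = 2^-1.
  rewrite /etf_angle /real_flag mE FE; congr (_^-1).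
  have -> : 2%:R + 1 + 1 = 2 ^+ 2 :> R by ring.
  by rewrite sqrtr_sqr ger0_norm.
have ME : M = 3%N by rewrite mE FE.
rewrite /max_proj_value pE ME mE NE6 le_eqVlt; apply/orP; left; apply/eqP.
by field.
Qed.

End KeyBounds.

(** * Projections of l_inf^N *)

Section FiniteProjections.
Variables (R : realType) (F : scalar_field).
Local Notation K := (scalars R F).
Local Notation conj := (@conjK R F).
Local Notation re := (@reK R F).
Local Notation ofr := (@ofR R F).
Local Notation adj := (@adjmx R F _ _).

(* For given weights the oblique projection [D^-1 G D], with [G] the orthogonal
   projection onto the weighted space, is good on average; [minimax] then yields
   a projection that is good in every coordinate. *)
Lemma exists_projection (m N : nat) (E : 'M[K]_(m, N)) (C eps : R)
    (Efree : forall c : 'rV_m, c *m E = 0 -> c = 0)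
    (bound : forall (G : 'M[K]_N) (t : 'I_N -> R), orthoproj G -> \tr G = m%:R ->
       (forall i, 0 <= t i) -> \sum_i t i ^+ 2 = 1 ->
       \sum_i \sum_j t i * t j * rnorm (G i j) <= C) : 0 < eps ->
  exists2 L : 'M[K]_(N, m), E *m L = 1%:M &
    forall j, \sum_i rnorm ((L *m E) i j) <= C + eps.
Proof.
move=> eps0.
(* The projections of row vectors onto the row space of E are the maps x |-> x L E with L a right
   inverse of E; these L form a convex set, and the column sums of |L E| control the norm. *)
pose v (L : {L : 'M[K]_(N, m) | E *m L = 1%:M}) j := \sum_i rnorm ((sval L *m E) i j).
pose mk L EL : {L : 'M[K]_(N, m) | E *m L = 1%:M} := exist _ L EL.
suff [[L EL] hL] : exists L, forall j, v L j <= C + eps by exists L.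
apply: minimax => //.
- by move=> L j; apply: sumr_ge0 => i _; exact: rnorm_ge0.
- move=> [L EL] [L' EL'] h /andP[h0 h1].
  have EL'' : E *m (ofr (1 - h) *: L + ofr h *: L') = 1%:M.
    by rewrite mulmxDr -!scalemxAr EL EL' -scalerDl -rmorphD subrK rmorph1 scale1r.
  exists (mk _ EL'') => j; rewrite /v /= !mulr_sumr -big_split ler_sum //= => i _.
  rewrite mulmxDl -!scalemxAl mxE; apply: le_trans (rnormD _ _) _.
  by rewrite [in X in X + _ <= _]mxE [in X in _ + X <= _]mxE !rnormM !rnorm_ofR !ger0_norm // subr_ge0.
move=> w w0.
(* With w_j = s t_j^2 and L E = D G D^-1, the average of the column sums of |L E| with weights w
   becomes s times the sum of t_i t_j |G_ij|. *)
pose s := \sum_i w i; pose t i := Num.sqrt (w i / s).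
have s_gt0 (i : 'I_N) : 0 < s.
  by rewrite /s (bigD1 i) //= ltr_wpDr // sumr_ge0 // => j _; exact: ltW.
have t_gt0 i : 0 < t i by rewrite sqrtr_gt0 divr_gt0 // (s_gt0 i).
have t2 i : t i ^+ 2 * s = w i.
  by rewrite sqr_sqrtr ?ltW ?divr_gt0 ?(s_gt0 i) // mulfVK // lt0r_neq0 // (s_gt0 i).
pose D : 'M[K]_N := diag_mx (\row_i ofr (t i)).
pose A := E *m D.
have AE i j : A i j = E i j * ofr (t j) by rewrite /A mul_mx_diag !mxE.
have tn0 i : ofr (t i) != 0.
  by rewrite -(rmorph0 ofr) (inj_eq (@ofR_inj R F)) lt0r_neq0.
have Afree (c : 'rV_m) : c *m A = 0 -> c = 0.
  rewrite /A mulmxA => cA; apply: Efree; apply/rowP => j.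
  have := congr1 (fun M : 'rV_N => M ord0 j) cA.
  rewrite mul_mx_diag !mxE => /eqP; rewrite mulf_eq0 (negbTE (tn0 j)) orbF => /eqP.
  by [].
have [AU pG trG] := row_span_orthoproj Afree.
set G := _ *m A in pG trG.
pose L := D *m adj A *m invmx (A *m adj A).
have EL : E *m L = 1%:M by rewrite /L !mulmxA -/A mulmxV.
exists (mk L EL).
have LE i j : rnorm ((L *m E) i j) * t j = t i * rnorm (G i j).
  rewrite -[t j]gtr0_norm // -[t i]gtr0_norm // -!(rnorm_ofR F) -!rnormM; congr rnorm.
  have -> : (L *m E) i j * ofr (t j) = (L *m E *m D) i j by rewrite mul_mx_diag !mxE.
  have -> : L *m E *m D = D *m G by rewrite /L /G -!mulmxA.
  by rewrite /D mul_diag_mx !mxE.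
have sumE : \sum_i w i * v (mk L EL) i = s * \sum_j \sum_i t j * t i * rnorm (G j i).
  rewrite [in RHS]exchange_big [RHS]mulr_sumr; apply: eq_bigr => j _ /=.
  rewrite /v /= -t2 mulrC mulr_suml [RHS]mulr_sumr; apply: eq_bigr => i _.
  have -> : rnorm ((L *m E) i j) * (t j ^+ 2 * s) = rnorm ((L *m E) i j) * t j * (t j * s) by ring.
  by rewrite LE; ring.
rewrite sumE -/s mulrC; case: (posnP N) => [N0|N0].
  have -> : s = 0 by rewrite /s big1 // => -[i hi]; exfalso; rewrite N0 in hi.
  by rewrite !mulr0.
have s0 : 0 < s by exact: (s_gt0 (Ordinal N0)).
apply: ler_wpM2r; first exact: ltW.
apply: bound => // [i|]; first exact: ltW.
rewrite (eq_bigr (fun i => w i / s)) -?mulr_suml ?divff ?lt0r_neq0 // => i _.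
by rewrite sqr_sqrtr // divr_ge0 // ltW.
Qed.

Lemma rV_norm_ge N (x : 'rV[K]_N) j : rnorm (x ord0 j) <= rnorm x.
Proof.
rewrite -(@ofR_le R F) -!rnormE [leRHS]mx_normE -[leLHS]nngE num_le.
exact: (le_bigmax _ (fun i : 'I_1 * 'I_N => `|x i.1 i.2|%:nng) (ord0, j)).
Qed.

Lemma rV_norm_le N (x : 'rV[K]_N) (c : R) : 0 <= c ->
  (forall j, rnorm (x ord0 j) <= c) -> rnorm x <= c.
Proof.
move=> c0 xc; have [x0|x0] := eqVneq (mx_norm x) 0.
  by rewrite (mx_norm_eq0 x0) rnorm0.
have [[i j] xij] := mx_norm_neq0 x0.
rewrite -(@ofR_le R F) -!rnormE [leLHS]xij /= (ord1 i) rnormE ofR_le; exact: xc.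
Qed.

Lemma bounded_continuous (X Z : normedModType K) (f : {linear X -> Z}) (c : R) :
  (forall x, rnorm (f x) <= c * rnorm x) -> continuous f.
Proof.
move=> fc; apply/bounded_linear_continuous/bounded_funP => r.
exists (ofr `|c| * r) => x xr; apply: (@le_trans _ _ (ofr `|c| * `|x|)).
  rewrite !rnormE -rmorphM ofR_le; apply: le_trans (fc x) _.
  by rewrite ler_wpM2r ?rnorm_ge0 // ler_norm.
by rewrite ler_wpM2l // -(rmorph0 ofr) ofR_le.
Qed.

Lemma opnorm_ge (X : normedModType K) (P : X -> X) (x : X) :
  rnorm x <= 1 -> ((rnorm (P x))%:E <= opnorm P)%E.
Proof. by move=> x1; apply: ereal_sup_ubound; exists x. Qed.

Lemma opnorm_le (X : normedModType K) (P : X -> X) (c : R) : 0 <= c ->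
  (forall x, rnorm (P x) <= c * rnorm x) -> (opnorm P <= c%:E)%E.
Proof.
move=> c0 Pc; apply: ge_ereal_sup => _ [x /= x1 <-].
by rewrite lee_fin (le_trans (Pc x)) // -[leRHS]mulr1 ler_wpM2l.
Qed.

Lemma proj_const_le (X : normedModType K) (Y : set X) (c : R) : 0 <= c ->
  (forall eps, 0 < eps -> exists2 P : {linear X -> X},
     (forall x, Y (P x)) /\ (forall y, Y y -> P y = y) &
     forall x, rnorm (P x) <= (c + eps) * rnorm x) ->
  (proj_const Y <= c%:E)%E.
Proof.
move=> c0 h; apply/lee_addgt0Pr => eps eps0.
have [P [PY Py] Pc] := h eps eps0.
apply: (@le_trans _ _ (opnorm P)).
  apply: ereal_inf_lbound; exists P => //; split=> //.
  exact: bounded_continuous Pc.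
by rewrite -EFinD; apply: opnorm_le => //; rewrite addr_ge0 // ltW.
Qed.

Lemma has_dim_rowspace (d N : nat) (Y : set 'rV[K]_N) : has_dim Y d ->
  exists E : 'M[K]_(d, N), (forall c : 'rV_d, c *m E = 0 -> c = 0) /\
    Y = [set x | exists c : 'rV_d, x = c *m E].
Proof.
move=> [e [efree ->]]; exists (\matrix_i e i).
have sumE (c : 'rV_d) : c *m (\matrix_i e i) = \sum_i c ord0 i *: e i.
  by rewrite mulmx_sum_row; apply: eq_bigr => i _; rewrite rowK.
split=> [c|].
  by rewrite sumE => /efree c0; apply/rowP => i; rewrite c0 mxE.
apply/seteqP; split=> x [c ->].
  by exists (\row_i c i); rewrite sumE; apply: eq_bigr => i _; rewrite mxE.
by exists (fun i => c ord0 i); rewrite sumE.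
Qed.

Lemma rowspace_has_dim (d N : nat) (E : 'M[K]_(d, N)) :
  (forall c : 'rV_d, c *m E = 0 -> c = 0) ->
  has_dim [set x : 'rV[K]_N | exists c : 'rV_d, x = c *m E] d.
Proof.
move=> Efree; exists (fun i => row i E).
have sumE (c : 'I_d -> K) : \sum_i c i *: row i E = (\row_i c i) *m E.
  by rewrite mulmx_sum_row; apply: eq_bigr => i _; rewrite mxE.
split=> [c|]; first by rewrite sumE => /Efree /rowP c0 i; have := c0 i; rewrite !mxE.
apply/seteqP; split=> x [c ->]; last by exists (\row_i c i); rewrite sumE.
by exists (fun i => c ord0 i); rewrite sumE; congr (_ *m _); apply/rowP => i; rewrite mxE.
Qed.

Lemma rV_mulmx_norm_le N (p : 'M[K]_N) (c : R) (x : 'rV[K]_N) : 0 <= c ->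
  (forall j, \sum_i rnorm (p i j) <= c) -> rnorm (x *m p) <= c * rnorm x.
Proof.
move=> c0 pc; apply: rV_norm_le => [|j]; first by rewrite mulr_ge0 ?rnorm_ge0.
rewrite mxE; apply: le_trans (rnorm_sum _ _ _) _.
apply: (@le_trans _ _ (\sum_i rnorm (p i j) * rnorm x)).
  by apply: ler_sum => i _; rewrite rnormM mulrC ler_wpM2l ?rnorm_ge0 ?rV_norm_ge.
by rewrite -mulr_suml ler_wpM2r ?rnorm_ge0.
Qed.

Lemma max_rel_proj_const_le (d N : nat) (C : R) : 0 <= C ->
  (forall (G : 'M[K]_N) (t : 'I_N -> R), orthoproj G -> \tr G = d%:R ->
       (forall i, 0 <= t i) -> \sum_i t i ^+ 2 = 1 ->
       \sum_i \sum_j t i * t j * rnorm (G i j) <= C) ->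
  (max_rel_proj_const R F d N <= C%:E)%E.
Proof.
move=> C0 bound; apply: ge_ereal_sup => _ [Y [Ydim ->]].
have [E [Efree ->]] := has_dim_rowspace Ydim.
apply: proj_const_le => // eps eps0.
have [L EL Lb] := exists_projection Efree bound eps0.
exists (mulmxr (L *m E) : {linear 'rV[K]_N -> 'rV[K]_N}).
  split=> [x|_ [c ->]] /=; first by exists (x *m L); rewrite mulmxA.
  by rewrite mulmxA -(mulmxA c) EL mulmx1.
by move=> x /=; apply: rV_mulmx_norm_le => //; rewrite addr_ge0 // ltW.
Qed.

(** In the row convention the first two hypotheses say that p is a projection onto the range of G.
    Cyclicity of the trace and the commutation of S with G give tr (S p) = tr (S G), and S has
    entries of modulus at most 1. *)
Lemma trace_le_entries (N : nat) (p G S : 'M[K]_N) :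
  p *m G = p -> G *m p = G -> S *m G = G *m S ->
  (forall i j, rnorm (S i j) <= 1) ->
  re (\tr (S *m G)) <= \sum_j \sum_i rnorm (p i j).
Proof.
move=> pG Gp SG S1.
have <- : \tr (S *m p) = \tr (S *m G).
  by rewrite -{1}pG mulmxA mxtrace_mulC mulmxA -SG -mulmxA Gp.
rewrite /mxtrace raddf_sum; apply: ler_sum => i _ /=.
rewrite mxE raddf_sum; apply: ler_sum => j _ /=.
apply: le_trans (reK_ler _) _.
by rewrite rnormM ler_piMl ?rnorm_ge0.
Qed.

(* Each column sum of the matrix of [P] is attained on a sign vector. *)
Lemma opnorm_ge_trace (X : normedModType K) (N : nat) (hN : (0 < N)%N)
    (f : {linear 'rV[K]_N -> X}) (h : {linear X -> 'rV[K]_N}) (P : {linear X -> X})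
    (G S : 'M[K]_N) :
  (forall v, rnorm (f v) <= rnorm v) -> (forall x, rnorm (h x) <= rnorm x) ->
  (forall v, h (P (f v)) *m G = h (P (f v))) ->
  (forall v : 'rV_N, h (P (f (v *m G))) = v *m G) ->
  S *m G = G *m S -> (forall i j, rnorm (S i j) <= 1) ->
  ((re (\tr (S *m G)) / N%:R)%:E <= opnorm P)%E.
Proof.
move=> f1 h1 PG GP SG S1.
pose p := lin1_mx (h \o P \o f).
have pE v : v *m p = h (P (f v)) by rewrite mul_rV_lin1.
have pG : p *m G = p.
  by apply/row_matrixP => i; rewrite row_mul rowE pE PG.
have Gp : G *m p = G.
  by apply/row_matrixP => i; rewrite row_mul pE rowE GP.
have := trace_le_entries pG Gp SG S1; set T := re _ => hT.
have [j hj] : exists j, T / N%:R <= \sum_i rnorm (p i j).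
  apply: contrapT => /forallNP hn; move: hT; apply/negP; rewrite -ltNge.
  have -> : T = \sum_(j < N) T / N%:R.
    by rewrite sumr_const card_ord -[RHS]mulr_natr mulfVK // pnatr_eq0 -lt0n.
  apply: ltr_sum => [|j _]; first by apply/hasP; exists (Ordinal hN); rewrite ?mem_index_enum.
  by rewrite ltNge; apply/negP; exact: hn.
pose v : 'rV[K]_N := \row_i phase (p i j).
have v1 : rnorm v <= 1.
  by apply: rV_norm_le => // i; rewrite mxE rnorm_phase.
apply: le_trans (opnorm_ge P (le_trans (f1 v) v1)).
rewrite lee_fin (le_trans hj) //; apply: le_trans (h1 _).
rewrite -pE; apply: le_trans (rV_norm_ge _ j).
rewrite mxE; apply: le_trans (reK_ler _); rewrite raddf_sum ler_sum // => i _ /=.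
by rewrite [v _ _]mxE mul_phase reK_ofR.
Qed.

End FiniteProjections.

(** * Reduction of Banach spaces to l_inf^N *)

Section HahnBanach.
Variables (R : realType) (F : scalar_field).
Local Notation K := (scalars R F).
Local Notation re := (@reK R F).
Local Notation ofr := (@ofR R F).
Variable X : normedModType K.
Implicit Types (p q : X -> R) (x y : X).

Definition sublinear q := (forall x y, q (x + y) <= q x + q y) /\
  (forall (t : R) x, 0 <= t -> q (ofr t *: x) <= t * q x).

Lemma sublinear0 q : sublinear q -> q 0 = 0.
Proof.
move=> [qD qZ]; apply/eqP; rewrite eq_le; apply/andP; split.
  by have := qZ 0 0 (lexx _); rewrite mul0r scaler0.
by have := qD 0 0; rewrite addr0 -[X in X <= _ -> _]addr0 lerD2l.
Qed.

Lemma sublinear_ge q x : sublinear q -> - q (- x) <= q x.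
Proof.
by move=> qs; have := qs.1 x (- x); rewrite subrr sublinear0 //; lra.
Qed.

Lemma sublinearZ q (t : R) x : sublinear q -> 0 <= t -> q (ofr t *: x) = t * q x.
Proof.
move=> qs; rewrite le_eqVlt => /predU1P[<-|t0].
  by rewrite rmorph0 scale0r mul0r sublinear0.
apply/eqP; rewrite eq_le qs.2 ?(ltW t0) //= -ler_pdivlMl //.
have := qs.2 t^-1 (ofr t *: x); rewrite scalerA -rmorphM mulVf ?lt0r_neq0 //.
by rewrite rmorph1 scale1r; apply; rewrite invr_ge0 ltW.
Qed.

Definition shift_set q y x := [set q (x + ofr t *: y) - t * q y | t in [set t : R | 0 <= t]].

(** A sublinear functional below q whose value at -y is at most -q(y). If q is minimal it equals its
    shift, which forces q(-y) = -q(y). *)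
Definition shift q y x := inf (shift_set q y x).

Section Shift.
Variables (q : X -> R) (y : X).
Hypothesis qs : sublinear q.

Let shift_has_inf x : has_inf (shift_set q y x).
Proof.
split; first by exists (q (x + ofr 0 *: y) - 0 * q y); exists 0 => //=; exact: lexx.
exists (- q (- x)) => _ [t /= t0 <-].
have := qs.1 (x + ofr t *: y) (- x); rewrite addrAC subrr add0r (sublinearZ _ qs t0).
lra.
Qed.

Let shift_le x t : 0 <= t -> shift q y x <= q (x + ofr t *: y) - t * q y.
Proof. by move=> t0; apply: inf_lbound; [case: (shift_has_inf x) | exists t]. Qed.

Let le_shift x a :
  (forall t, 0 <= t -> a <= q (x + ofr t *: y) - t * q y) -> a <= shift q y x.
Proof.
by move=> h; apply: lb_le_inf; [case: (shift_has_inf x) | move=> _ [t /= t0 <-]; exact: h].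
Qed.

Lemma shift_sublinear : sublinear (shift q y).
Proof.
split=> [x x'|s x s0].
  rewrite -lerBlDl; apply: le_shift => t t0; rewrite lerBlDl -lerBlDr.
  apply: le_shift => t' t'0; rewrite lerBlDr.
  apply: le_trans (shift_le _ (addr_ge0 t'0 t0)) _.
  have := qs.1 (x + ofr t' *: y) (x' + ofr t *: y).
  by rewrite rmorphD scalerDl [x + _ + _]addrACA; lra.
have key t : 0 <= t -> shift q y (ofr s *: x) <= s * (q (x + ofr t *: y) - t * q y).
  move=> t0; apply: le_trans (shift_le _ (mulr_ge0 s0 t0)) _.
  rewrite rmorphM -scalerA -scalerDr.
  by have := qs.2 s (x + ofr t *: y) s0; lra.
move: s0; rewrite le_eqVlt => /predU1P[sE|s0].
  by have := key 0 (lexx _); rewrite -sE !mul0r.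
rewrite -ler_pdivrMl //; apply: le_shift => t t0.
by rewrite ler_pdivrMl // key.
Qed.

Lemma shift_le_self x : shift q y x <= q x.
Proof. by have := shift_le x (lexx 0); rewrite rmorph0 scale0r addr0 mul0r subr0. Qed.

Lemma shiftN : shift q y (- y) <= - q y.
Proof.
have := shift_le (- y) (@ler01 R).
by rewrite rmorph1 scale1r addNr sublinear0 // mul1r sub0r.
Qed.

End Shift.

(** Zorn's lemma for the reversed pointwise order. Infima along a chain are finite since -p(-x)
    bounds every sublinear functional below p from below; they are subadditive since of two members
    of a chain the smaller one serves both arguments. *)
Lemma minimal_sublinear p : sublinear p -> exists q, [/\ sublinear q,
  (forall x, q x <= p x) &
  forall q', sublinear q' -> (forall x, q' x <= q x) -> q' = q].
Proof.
move=> ps.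
pose T := {q : X -> R | sublinear q /\ forall x, q x <= p x}.
pose mk q (h : sublinear q /\ forall x, q x <= p x) : T := exist _ q h.
pose le (s t : T) := `[< forall x, sval t x <= sval s x >].
have [||||[q [qs qp]] qmax] := @Zorn T le.
- by move=> t; apply/asboolP.
- move=> r s t /asboolP rs /asboolP st; apply/asboolP => x.
  exact: le_trans (st x) (rs x).
- move=> [s hs] [t ht] /asboolP /= st /asboolP /= ts.
  have E : s = t by apply/funext => x; apply/eqP; rewrite eq_le st ts.
  by subst s; congr exist; exact: Prop_irrelevance.
- move=> A Atot; have [[a0 Aa0]|A0] := pselect (A !=set0); last first.
    exists (mk p (conj ps (fun x => lexx _))) => s As.
    by exfalso; apply: A0; exists s.
  pose V x := [set sval a x | a in A].
  have Vinf x : has_inf (V x).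
    split; first by exists (sval a0 x), a0.
    exists (- p (- x)) => _ [[a [as_ ap]] _ <-] /=.
    by apply: le_trans (sublinear_ge x as_); rewrite lerN2.
  have V_le x a : A a -> inf (V x) <= sval a x.
    by move=> Aa; apply: inf_lbound; [case: (Vinf x) | exists a].
  have le_V x c : (forall a, A a -> c <= sval a x) -> c <= inf (V x).
    by move=> h; apply: lb_le_inf; [case: (Vinf x) | move=> _ [a Aa <-]; exact: h].
  have infs : sublinear (fun x => inf (V x)).
    split=> [x y|s x s0].
      rewrite -lerBlDl; apply: (le_V _ _) => a Aa; rewrite lerBlDl -lerBlDr.
      apply: (le_V _ _) => b Ab; rewrite lerBlDr.
      have [/asboolP ab|/asboolP ba] := Atot _ _ Aa Ab.
        apply: le_trans (V_le _ _ Ab) _; apply: le_trans ((svalP b).1.1 x y) _.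
        by rewrite lerD2l ab.
      apply: le_trans (V_le _ _ Aa) _; apply: le_trans ((svalP a).1.1 x y) _.
      by rewrite lerD2r ba.
    have key a : A a -> inf (V (ofr s *: x)) <= s * sval a x.
      by move=> Aa; apply: le_trans (V_le _ _ Aa) _; exact: (svalP a).1.2.
    move: s0; rewrite le_eqVlt => /predU1P[sE|s0].
      by have := key _ Aa0; rewrite -sE !mul0r.
    rewrite -ler_pdivrMl //; apply: (le_V _ _) => a Aa.
    by rewrite ler_pdivrMl // key.
  have infp x : inf (V x) <= p x by apply: le_trans (V_le _ _ Aa0) _; exact: (svalP a0).2.
  exists (mk _ (conj infs infp)) => a Aa; apply/asboolP => x /=; exact: V_le.
exists q; split=> // q' q's q'q.
have q'p x : q' x <= p x := le_trans (q'q x) (qp x).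
by have /(congr1 sval) := qmax (mk q' (conj q's q'p)) (asboolT q'q).
Qed.

(* A minimal sublinear functional coincides with its shifts, hence is odd, hence linear. *)
Lemma HahnBanach_real p y0 : sublinear p -> exists f : X -> R,
  [/\ forall x y, f (x + y) = f x + f y,
      forall (t : R) x, f (ofr t *: x) = t * f x,
      forall x, f x <= p x & p y0 <= f y0].
Proof.
(* Minimizing below the shift by y0 rather than below p itself gives q(-y0) <= -p(y0), hence p(y0)
   <= q(y0) once q is odd. *)
move=> ps; have [q [qs qp qmin]] := minimal_sublinear (shift_sublinear y0 ps).
have qN y : q (- y) = - q y.
  apply/eqP; rewrite eq_le; apply/andP; split.
    by rewrite -{1}(qmin _ (shift_sublinear y qs) (shift_le_self y qs)); exact: shiftN.
  by have := sublinear_ge (- y) qs; rewrite opprK.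
exists q; split.
- move=> x y; apply/eqP; rewrite eq_le qs.1 /=.
  by have := qs.1 (- x) (- y); rewrite -opprD !qN; lra.
- move=> t x; have [t0|t0] := leP 0 t; first exact: sublinearZ.
  have -> : ofr t *: x = - (ofr (- t) *: x) by rewrite rmorphN scaleNr opprK.
  by rewrite qN sublinearZ ?oppr_ge0 ?ltW // mulNr opprK.
- by move=> x; apply: le_trans (qp x) _; exact: shift_le_self.
by have := le_trans (qp (- y0)) (shiftN y0 ps); rewrite qN lerN2.
Qed.

Lemma iK_cases : iK R F = 0 \/ iK R F * iK R F = -1.
Proof.
rewrite /iK; case: F; [by left|right].
by apply/eqP; rewrite eq_complex /= !mul0r !mulr0 mulr1 sub0r addr0 oppr0 !eqxx.
Qed.

Lemma reK_iK : re (iK R F) = 0.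
Proof. by rewrite /iK; case: F. Qed.

Lemma HahnBanach y0 : exists g : X -> K,
  [/\ forall x y, g (x + y) = g x + g y,
      forall (a : K) x, g (a *: x) = a * g x,
      forall x, rnorm (g x) <= rnorm x & rnorm y0 <= rnorm (g y0)].
Proof.
have ps : sublinear (fun x => rnorm x).
  split=> [x y|t x t0]; first exact: rnormD.
  by rewrite rnormZ rnorm_ofR ger0_norm.
have [f [fD fZ fle fy]] := HahnBanach_real y0 ps.
pose i := iK R F.
(* The K-linear functional with real part f; over the reals i is 0 and g is f. *)
pose g x := ofr (f x) - i * ofr (f (i *: x)).
have gD x y : g (x + y) = g x + g y.
  by rewrite /g scalerDr !fD !rmorphD /=; ring.
have gZr (t : R) x : g (ofr t *: x) = ofr t * g x.
  rewrite /g scalerA [i * ofr t]mulrC -scalerA !fZ !rmorphM /=; ring.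
have gZi x : g (i *: x) = i * g x.
  have f0 : f 0 = 0 by have := fZ 0 0; rewrite scaler0 mul0r.
  rewrite /g; have := iK_cases; rewrite -/i => -[i0|ii].
    by rewrite i0 !scale0r !mul0r subr0 f0 rmorph0.
  have fN x' : f (- x') = - f x'.
    by have := fZ (-1) x'; rewrite rmorphN rmorph1 scaleN1r mulN1r.
  by rewrite scalerA ii scaleN1r fN rmorphN mulrBr mulrA ii /=; ring.
have gZ (a : K) x : g (a *: x) = a * g x.
  by rewrite [a]scalarsE scalerDl gD -scalerA !gZr gZi -/i; ring.
have reg x : re (g x) = f x.
  by rewrite /g raddfB /= reK_ofR [i * _]mulrC reK_ofRM reK_iK mulr0 subr0.
exists g; split=> // [x|].
  (* Multiplying x by a phase makes the value of g real and nonnegative, where it agrees with f. *)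
  have -> : rnorm (g x) = f (phase (g x) *: x) by rewrite -reg gZ mul_phase reK_ofR.
  by apply: le_trans (fle _) _; rewrite rnormZ rnorm_phase mul1r.
by apply: le_trans fy _; rewrite -reg reK_ler.
Qed.

End HahnBanach.

(** * Coordinates and norming functionals on a finite-dimensional subspace *)

Section FiniteDimensionalSubspace.
Variables (R : realType) (F : scalar_field).
Local Notation K := (scalars R F).
Local Notation re := (@reK R F).
Local Notation ofr := (@ofR R F).
Variables (X : normedModType K) (m : nat) (e : 'I_m -> X).
Hypothesis efree : forall c : 'I_m -> K, \sum_i c i *: e i = 0 -> forall i, c i = 0.

Definition contractive_functional (g : X -> K) :=
  [/\ forall x y, g (x + y) = g x + g y,
      forall (a : K) x, g (a *: x) = a * g x &
      forall x, rnorm (g x) <= rnorm x].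

Lemma functional_sum g (c : 'I_m -> K) : contractive_functional g ->
  g (\sum_i c i *: e i) = \sum_i c i * g (e i).
Proof.
move=> [gD gZ _]; have g0 : g 0 = 0 by rewrite -(scale0r 0) gZ mul0r.
elim/big_rec2: _ => [|i u v _ <-]; first exact: g0.
by rewrite gD gZ.
Qed.

Lemma functional_sub g x y : contractive_functional g -> g (x - y) = g x - g y.
Proof. by move=> [gD gZ _]; rewrite gD -scaleN1r gZ mulN1r. Qed.

(** One functional is added at a time. Fewer than m columns have a nonzero left kernel vector c; the
    earlier functionals vanish at the corresponding vector of X, and a Hahn-Banach functional that
    does not vanish there gives an independent column. *)
Lemma separating_functionals k : (k <= m)%N -> exists M : 'M[K]_(m, k),
  (forall b : 'cV_k, M *m b = 0 -> b = 0) /\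
  forall j, exists2 g, contractive_functional g & forall i, M i j = g (e i).
Proof.
elim: k => [|k IH] km; first by exists 0; split=> [b _|[]//]; rewrite [b]flatmx0.
have [M [Minj Mg]] := IH (ltnW km).
have /rowV0Pn[c /sub_kermxP cM c0] : kermx M != 0.
  rewrite -mxrank_eq0 mxrank_ker subn_eq0 -ltnNge.
  exact: leq_ltn_trans (rank_leq_col M) km.
pose y := \sum_i c ord0 i *: e i.
have y0 : y != 0.
  apply: contra_neq c0 => y0; apply/rowP => i; rewrite mxE.
  exact: (efree y0).
have [g [gD gZ gle gy]] := HahnBanach y.
have gc : contractive_functional g by [].
have gy0 : g y != 0.
  by rewrite -rnorm_eq0 lt0r_neq0 // (lt_le_trans _ gy) // lt0r rnorm_eq0 y0 rnorm_ge0.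
pose v : 'cV[K]_m := \col_i g (e i).
have cv : c *m v = (g y)%:M.
  apply/matrixP => i j; rewrite (ord1 i) (ord1 j) mxE [RHS]mxE eqxx mulr1n.
  by rewrite functional_sum //; apply: eq_bigr => l _; rewrite mxE.
pose M' : 'M[K]_(m, k + 1) := row_mx M v.
suff : exists M : 'M[K]_(m, k + 1),
  (forall b : 'cV_(k + 1), M *m b = 0 -> b = 0) /\
  forall j, exists2 g, contractive_functional g & forall i, M i j = g (e i).
  by rewrite addn1.
exists M'; split=> [b|j].
  rewrite -[b]vsubmxK mul_row_col => Mb.
  have b2 : dsubmx b = 0.
    have := congr1 (mulmx c) Mb; rewrite mulmx0 mulmxDr !mulmxA cM mul0mx add0r cv mul_scalar_mx.
    by move/eqP; rewrite scaler_eq0 (negbTE gy0) => /eqP.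
  move: Mb; rewrite b2 mulmx0 addr0 => /Minj ->; exact: col_mx0.
rewrite /M' -[j]splitK; case: (fintype.split j) => l /=.
  by have [g' g'c g'E] := Mg l; exists g' => // i; rewrite row_mxEl.
by exists g => // i; rewrite row_mxEr mxE.
Qed.

(** For k = m the evaluation matrix is invertible, and its inverse recovers the coordinates of a
    vector from the values of contractive functionals. *)
Lemma coordinates_bounded : exists2 B : R, 0 <= B &
  forall (c : 'I_m -> K) i, rnorm (c i) <= B * rnorm (\sum_i c i *: e i).
Proof.
have [M [Minj Mg]] := separating_functionals (leqnn m).
have MU : M \in unitmx.
  rewrite -unitmx_tr -row_free_unit; apply: inj_row_free => v vM.
  by apply: trmx_inj; rewrite trmx0; apply: Minj; rewrite -[M]trmxK -trmx_mul vM trmx0.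
exists (\sum_j \sum_i rnorm (invmx M j i)).
  by do 2!(apply: sumr_ge0 => ? _); exact: rnorm_ge0.
move=> c i; set y := \sum_i c i *: e i.
pose cv : 'rV[K]_m := \row_i c i.
have -> : c i = (cv *m M *m invmx M) ord0 i by rewrite mulmxK // mxE.
rewrite mxE; apply: le_trans (rnorm_sum _ _ _) _; rewrite mulr_suml ler_sum // => j _.
have -> : (cv *m M) ord0 j = \sum_i c i * M i j by rewrite mxE; apply: eq_bigr => l _; rewrite mxE.
have [g gc gE] := Mg j.
have -> : \sum_i c i * M i j = g y.
  by rewrite /y functional_sum //; apply: eq_bigr => l _; rewrite gE.
rewrite rnormM mulrC ler_pM ?rnorm_ge0 //; last by case: gc.
rewrite (bigD1 i) //= lerDl sumr_ge0 // => l _; exact: rnorm_ge0.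
Qed.

(** Coordinates of unit vectors are bounded, so finitely many grid points approximate the unit
    sphere of the span. A functional norming a nearby grid point almost norms the vector. *)
Lemma norming_functionals (eps : R) : 0 < eps -> exists (I : finType) (g : I -> X -> K),
  (forall h, contractive_functional (g h)) /\
  forall c : 'I_m -> K, let y := \sum_i c i *: e i in
    exists h, (1 - eps) * rnorm y <= rnorm (g h y).
Proof.
move=> eps0; have [B B0 Bc] := coordinates_bounded.
pose Se := \sum_i rnorm (e i).
have Se0 : 0 <= Se by apply: sumr_ge0 => i _; exact: rnorm_ge0.
(* Rounding the real and the imaginary part of each coordinate by [de] moves the vector by at most 2
   [de] [Se] <= eps / 2, and this error is paid twice. *)
pose de := eps / (4 * (Se + 1)).
have de0 : 0 < de by rewrite divr_gt0 // mulr_gt0 // ltr_wpDl.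
have deS : 4 * de * Se <= eps.
  rewrite /de.
  have -> : 4 * (eps / (4 * (Se + 1))) * Se = eps * (Se / (Se + 1)).
    by field; rewrite lt0r_neq0 // ltr_wpDl.
  rewrite -[leRHS]mulr1; apply: ler_wpM2l; first exact: ltW.
  by rewrite ler_pdivrMr; lra.
pose L := (Num.truncn (2 * B / de)).+1.
pose grid (n : 'I_L) : R := n%:R * de - B.
have gridP a : `|a| <= B -> exists n : 'I_L, `|a - grid n| <= de.
  rewrite ler_norml => /andP[a1 a2].
  have q0 : 0 <= (a + B) / de by rewrite divr_ge0 ?(ltW de0) //; lra.
  have nL : (Num.truncn ((a + B) / de) < L)%N.
    by rewrite ltnS; apply: le_truncn; rewrite ler_wpM2r ?invr_ge0 ?(ltW de0) //; lra.
  exists (Ordinal nL); rewrite /grid /=.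
  have /andP[n1 n2] := truncn_itv q0.
  move: n1 n2; set n := Num.truncn _.
  rewrite ler_pdivlMr // ltr_pdivrMr // -natr1 mulrDl mul1r => n1 n2.
  by rewrite ler_norml; apply/andP; split; lra.
pose I : finType := {ffun 'I_m -> 'I_L * 'I_L}.
pose z (h : I) : X := \sum_i (ofr (grid (h i).1) + ofr (grid (h i).2) * iK R F) *: e i.
have /choice[g gP] : forall h : I, exists g, contractive_functional g /\ rnorm (z h) <= rnorm (g (z h)).
  by move=> h; have [g [gD gZ gle gy]] := HahnBanach (z h); exists g.
exists I, g; split=> [h|]; first by case: (gP h).
suff unit_case (c : 'I_m -> K) : let y := \sum_i c i *: e i in rnorm y = 1 ->
    exists h, 1 - eps <= rnorm (g h y).
  move=> c y; have [y0|y0] := eqVneq (rnorm y) 0.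
    have [n _] := gridP 0 (eq_ind_r (fun u => u <= B) B0 (normr0 R)).
    by exists [ffun=> (n, n)]; rewrite y0 mulr0 rnorm_ge0.
  pose s := (rnorm y)^-1.
  have yp : 0 < rnorm y by rewrite lt0r y0 rnorm_ge0.
  have sy : ofr s *: y = \sum_i (ofr s * c i) *: e i.
    by rewrite scaler_sumr; apply: eq_bigr => i _; rewrite scalerA.
  have [|h hh] := unit_case (fun i => ofr s * c i).
    by rewrite -sy rnormZ rnorm_ofR ger0_norm ?invr_ge0 ?rnorm_ge0 // mulVf.
  exists h; move: hh; rewrite -sy; have [[_ gZ _] _] := gP h.
  by rewrite gZ rnormM rnorm_ofR ger0_norm ?invr_ge0 ?rnorm_ge0 // mulrC ler_pdivlMr.
move=> y y1.
have cB i : rnorm (c i) <= B by have := Bc c i; rewrite -/y y1 mulr1.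
have /choice[h1 h1P] : forall i, exists n : 'I_L, `|re (c i) - grid n| <= de.
  by move=> i; apply: gridP; exact: le_trans (reK_le _) (cB i).
have /choice[h2 h2P] : forall i, exists n : 'I_L, `|imK (c i) - grid n| <= de.
  by move=> i; apply: gridP; exact: le_trans (imK_le _) (cB i).
pose h : I := [ffun i => (h1 i, h2 i)].
have yz : rnorm (y - z h) <= eps / 2.
  apply: (@le_trans _ _ (2 * de * Se)); last by lra.
  rewrite /y /z -sumrB /Se mulr_sumr; apply: le_trans (rnorm_sum _ _ _) _.
  apply: ler_sum => i _; rewrite ffunE /= -scalerBl rnormZ ler_wpM2r ?rnorm_ge0 //.
  rewrite {1}[c i]scalarsE opprD addrACA -rmorphB -mulrBl -rmorphB.
  apply: le_trans (rnormD _ _) _; rewrite rnormM !rnorm_ofR.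
  have : `|imK (c i) - grid (h2 i)| * rnorm (iK R F) <= de.
    by rewrite -[leRHS]mulr1 ler_pM ?rnorm_ge0 // rnorm_iK.
  by have := h1P i; lra.
exists h; have [gc gz] := gP h; have [_ _ gle] := gc.
have e1 : rnorm y <= rnorm (y - z h) + rnorm (z h).
  by have := rnormD (y - z h) (z h); rewrite subrK.
have e2 : rnorm (g h (z h)) <= rnorm (g h (z h - y)) + rnorm (g h y).
  by have := rnormD (g h (z h - y)) (g h y); rewrite functional_sub // subrK.
have e3 := gle (z h - y); rewrite -(opprB y) rnormN in e3.
by move: e1 e2 e3 gz yz; rewrite y1 opprB; lra.
Qed.

(* The functionals embed X into some l_inf^N, almost isometrically on the span of
   [e]; a projection of l_inf^N onto the image of the span is then pulled back. *)
Lemma proj_const_span_le (C : R) : 0 <= C ->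
  (forall N (G : 'M[K]_N) (t : 'I_N -> R), orthoproj G -> \tr G = m%:R ->
       (forall i, 0 <= t i) -> \sum_i t i ^+ 2 = 1 ->
       \sum_i \sum_j t i * t j * rnorm (G i j) <= C) ->
  (proj_const [set x : X | exists c : 'I_m -> K, x = (\sum_i c i *: e i)%R] <= C%:E)%E.
Proof.
move=> C0 bound; apply: proj_const_le => // eps eps0.
(* Chosen so that (1 - [de]) (C + eps) = C + eps / 2: half of eps pays for the distortion of the
   embedding, half for the projection of l_inf^N. *)
pose de := eps / (2 * (C + eps)).
have Ce : 0 < C + eps by rewrite ltr_wpDl.
have de0 : 0 < de by rewrite divr_gt0 // mulr_gt0.
have deE : de * (2 * (C + eps)) = eps by rewrite /de mulfVK // lt0r_neq0 // mulr_gt0.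
have de1 : de <= 2^-1.
  rewrite /de ler_pdivrMr ?mulr_gt0 // mulKf //; lra.
have [I [g [gc gn]]] := norming_functionals de0.
pose N := #|I|; pose gN (j : 'I_N) := g (enum_val j).
have gNc j : contractive_functional (gN j) by exact: gc.
pose E : 'M[K]_(m, N) := \matrix_(i, j) gN j (e i).
have cE (c : 'rV[K]_m) j : (c *m E) ord0 j = gN j (\sum_i c ord0 i *: e i).
  by rewrite (functional_sum _ (gNc j)) mxE; apply: eq_bigr => i _; rewrite mxE.
have nE (c : 'rV[K]_m) : (1 - de) * rnorm (\sum_i c ord0 i *: e i) <= rnorm (c *m E).
  have [h hh] := gn (fun i => c ord0 i); apply: le_trans hh _.
  have := rV_norm_ge (c *m E) (enum_rank h).
  by rewrite cE /gN enum_rankK.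
have d1 : 0 < 1 - de by lra.
have Efree (c : 'rV[K]_m) : c *m E = 0 -> c = 0.
  move=> cE0; have := nE c; rewrite cE0 rnorm0 pmulr_rle0 // => h.
  have /eqP : rnorm (\sum_i c ord0 i *: e i) == 0 by rewrite eq_le h rnorm_ge0.
  by move/eqP; rewrite rnorm_eq0 => /eqP /efree c0; apply/rowP => i; rewrite mxE c0.
have eps20 : 0 < eps / 2 by rewrite divr_gt0.
have [L EL Lb] := exists_projection Efree (bound N) eps20.
pose T x : 'rV[K]_N := \row_j gN j x.
have TD x y : T (x + y) = T x + T y.
  by apply/rowP => j; rewrite !mxE; case: (gNc j).
have TZ a x : T (a *: x) = a *: T x.
  by apply/rowP => j; rewrite !mxE; case: (gNc j).
have Tle x : rnorm (T x) <= rnorm x.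
  by apply: rV_norm_le => [|j]; rewrite ?rnorm_ge0 // mxE; case: (gNc j).
have Tsum (c : 'rV[K]_m) : T (\sum_i c ord0 i *: e i) = c *m E.
  by apply/rowP => j; rewrite mxE cE.
pose P x := \sum_i (T x *m L) ord0 i *: e i.
have lP : linear P.
  move=> a x y; rewrite /P scaler_sumr -big_split; apply: eq_bigr => i _ /=.
  by rewrite TD TZ mulmxDl -scalemxAl mxE [in X in X + _]mxE scalerDl scalerA.
pose P' : {linear X -> X} := HB.pack P (GRing.isLinear.Build K X X *:%R P lP).
exists P'; first split.
- by move=> x; exists (fun i => (T x *m L) ord0 i).
- move=> _ [c ->]; rewrite /P' /= /P; apply: eq_bigr => i _.
  have -> : \sum_i c i *: e i = \sum_i (\row_i c i) ord0 i *: e i.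
    by apply: eq_bigr => l _; rewrite mxE.
  by rewrite Tsum -mulmxA EL mulmx1 mxE.
move=> x; rewrite /P' /=.
have := nE (T x *m L); rewrite -/(P x) -mulmxA => h.
have h2 : rnorm (T x *m (L *m E)) <= (C + eps / 2) * rnorm x.
  apply: (@le_trans _ _ ((C + eps / 2) * rnorm (T x))).
    by apply: rV_mulmx_norm_le => //; rewrite addr_ge0 // ltW.
  by rewrite ler_wpM2l // addr_ge0 // ltW.
rewrite -(ler_pM2l d1); apply: le_trans h _; apply: le_trans h2 _.
rewrite mulrA ler_wpM2r ?rnorm_ge0 //; lra.
Qed.

End FiniteDimensionalSubspace.

Lemma max_abs_proj_const_le (R : realType) (F : scalar_field) (m : nat) (C : R) :
  0 <= C ->
  (forall N (G : 'M[scalars R F]_N) (t : 'I_N -> R), orthoproj G -> \tr G = m%:R ->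
       (forall i, 0 <= t i) -> \sum_i t i ^+ 2 = 1 ->
       \sum_i \sum_j t i * t j * rnorm (G i j) <= C) ->
  (max_abs_proj_const R F m <= C%:E)%E.
Proof.
move=> C0 bound; apply: ge_ereal_sup => _ [Y [[e [efree eE]] ->]].
apply: ge_ereal_sup => _ [X [j [jiso ->]]].
have jsum c : j (\sum_i c i *: e i) = \sum_i c i *: j (e i).
  by rewrite linear_sum; apply: eq_bigr => i _; rewrite linearZ.
have -> : range j = [set x : X | exists c : 'I_m -> scalars R F, x = \sum_i c i *: j (e i)].
  apply/seteqP; split=> [_ [y _ <-]|_ [c ->]].
    have : [set: Y] y by [].
    by rewrite eE => -[c ->]; exists c; rewrite jsum.
  by exists (\sum_i c i *: e i) => //; rewrite jsum.
apply: proj_const_span_le => // c; rewrite -jsum => jc i; apply: efree.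
by apply/normr0_eq0; rewrite -jiso jc normr0.
Qed.

(** The coordinates are Lipschitz, so each converges along a Cauchy filter. The second hypothesis
    supplies a point with the limiting coordinates and bounds the distance to it by the coordinate
    errors. *)
Lemma finite_coordinates_complete (R : realType) (F : scalar_field)
    (Z : normedModType (scalars R F)) (I : finType) (rho : I -> Z -> R) (B B' : R) :
  (forall k x y, `|rho k x - rho k y| <= B * rnorm (x - y)) ->
  (forall l : I -> R, exists z, forall x, rnorm (z - x) <= B' * \sum_k `|l k - rho k x|) ->
  forall Fi : set_system Z, ProperFilter Fi -> cauchy Fi -> cvg Fi.
Proof.
move=> rhoB rebuild Fi FF /cauchyP Fc.
have cvg_rho k : cvg (rho k @ Fi).
  apply: R_complete; apply/cauchyP => e e0.
  have B1 : 0 < `|B| + 1 by rewrite ltr_wpDl.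
  have d0 : 0 < @ofR R F (e / (`|B| + 1)).
    by rewrite -(rmorph0 (@ofR R F)) ofR_lt divr_gt0.
  have [x Fx] := Fc _ d0.
  exists (rho k x); suff : Fi (rho k @^-1` ball (rho k x) e) by [].
  move: Fx; apply: filterS => y; rewrite -!ball_normE /ball_ /=.
  rewrite rnormE ofR_lt ltr_pdivlMr // => xy; apply: le_lt_trans xy.
  apply: le_trans (rhoB k x y) _; rewrite mulrC ler_wpM2l ?rnorm_ge0 //.
  by have := ler_norm B; lra.
pose l k := lim (rho k @ Fi).
have [z hz] := rebuild l.
apply/cvg_ex; exists z; apply/cvgrPdist_lt => e e0.
have eE : e = @ofR R F (@reK R F e) by apply: ge0_ofR; exact: ltW.
have e1 : 0 < @reK R F e by rewrite -(@ofR_lt R F) -eE rmorph0.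
pose n := #|I|%:R * (`|B'| + 1) + 1 : R.
have n0 : 0 < n by rewrite ltr_wpDl // mulr_ge0 // addr_ge0.
have near_k k : \forall x \near Fi, `|l k - rho k x| < @reK R F e / n.
  by apply: cvgr_dist_lt; [exact: cvg_rho | exact: divr_gt0].
have := filter_forall (@filter_filter _ Fi FF) near_k.
apply: filterS => x hx /=; rewrite rnormE eE ofR_lt.
apply: le_lt_trans (hz x) _.
set S := \sum_k _.
have S0 : 0 <= S by apply: sumr_ge0.
have hs : S * n <= #|I|%:R * @reK R F e.
  rewrite -ler_pdivlMr // -mulrA mulr_natl -sumr_const.
  by apply: ler_sum => k _; exact: ltW.
have B0 : B' * S <= `|B'| * S by rewrite ler_wpM2r // ler_norm.
apply: le_lt_trans B0 _; rewrite -(ltr_pM2r n0).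
apply: (@le_lt_trans _ _ (`|B'| * (#|I|%:R * @reK R F e))).
  by rewrite -mulrA ler_wpM2l.
have : 0 <= #|I|%:R * @reK R F e by rewrite mulr_ge0 // ltW.
rewrite /n; lra.
Qed.

(** * Finite-dimensional Banach spaces embedded in l_inf^N *)

Section RowNorm.
Variables (R : realType) (F : scalar_field) (m N : nat).
Local Notation K := (scalars R F).
Local Notation ofr := (@ofR R F).
Variables (U : 'M[K]_(m, N)) (L : 'M[K]_(N, m)).

(* K^m with the norm that makes [c |-> c *m U] an isometry into l_inf^N. *)
Definition row_normed of U *m L = 1%:M : Type := 'rV[K]_m.

Variable UL : U *m L = 1%:M.

HB.instance Definition _ := GRing.Lmodule.copy (row_normed UL) 'rV[K]_m.

Definition row_norm (c : row_normed UL) : K := `|(c : 'rV[K]_m) *m U|.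

Fact ler_row_normD x y : row_norm (x + y) <= row_norm x + row_norm y.
Proof. by rewrite /row_norm mulmxDl ler_normD. Qed.

Fact row_normZ a x : row_norm (a *: x) = `|a| * row_norm x.
Proof. by rewrite /row_norm -scalemxAl normrZ. Qed.

Fact row_norm_eq0 x : row_norm x = 0 -> x = 0.
Proof.
move/normr0_eq0 => xU; change ((x : 'rV[K]_m) = 0).
by rewrite -[x]mulmx1 -UL mulmxA xU mul0mx.
Qed.

HB.instance Definition _ :=
  Lmodule_isNormed.Build K (row_normed UL) ler_row_normD row_normZ row_norm_eq0.

Lemma row_normedE (c : row_normed UL) : rnorm c = rnorm ((c : 'rV[K]_m) *m U).
Proof. by []. Qed.

Let rho (k : bool * 'I_m) (c : row_normed UL) : R :=
  let x := (c : 'rV[K]_m) ord0 k.2 in if k.1 then @reK R F x else @imK R F x.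

Let B := \sum_j \sum_i rnorm (L i j).
Let B' := \sum_j rnorm (row j U).

Let rho_bound k x y : `|rho k x - rho k y| <= B * rnorm (x - y).
Proof.
have h j : rnorm (((x : 'rV[K]_m) - y) ord0 j) <= B * rnorm (x - y).
  have -> : ((x : 'rV[K]_m) - y) ord0 j = (((x : 'rV[K]_m) - y) *m U *m L) ord0 j.
    by rewrite -mulmxA UL mulmx1.
  rewrite mxE; apply: le_trans (rnorm_sum _ _ _) _.
  apply: (@le_trans _ _ (\sum_i rnorm (L i j) * rnorm (x - y))).
    apply: ler_sum => i _; rewrite rnormM mulrC ler_wpM2l ?rnorm_ge0 // row_normedE.
    exact: rV_norm_ge.
  rewrite -mulr_suml ler_wpM2r ?rnorm_ge0 // /B (bigD1 j) //= lerDl.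
  by do 2!(apply: sumr_ge0 => ? _); exact: rnorm_ge0.
apply: le_trans (h k.2); case: k => [[] j]; rewrite /rho /= -raddfB.
  by rewrite !mxE reK_le.
by rewrite !mxE imK_le.
Qed.

Let rho_rebuild (l : bool * 'I_m -> R) :
  exists z, forall x, rnorm (z - x) <= B' * \sum_k `|l k - rho k x|.
Proof.
exists (\row_j (ofr (l (true, j)) + ofr (l (false, j)) * iK R F) : 'rV[K]_m) => x.
set y := \row_j _.
have -> : rnorm ((y : row_normed UL) - x) = rnorm (\sum_j ((y - (x : 'rV[K]_m)) ord0 j) *: row j U).
  by rewrite row_normedE mulmx_sum_row.
apply: le_trans (rnorm_sum _ _ _) _; rewrite mulr_suml ler_sum // => j _.
rewrite rnormZ mulrC ler_wpM2l ?rnorm_ge0 //.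
have -> : (y - (x : 'rV[K]_m)) ord0 j = ofr (l (true, j) - rho (true, j) x)
   + ofr (l (false, j) - rho (false, j) x) * iK R F.
  rewrite !mxE {1}[(x : 'rV[K]_m) _ _]scalarsE /rho /= !rmorphB /=; ring.
apply: le_trans (rnormD _ _) _; rewrite rnormM !rnorm_ofR.
rewrite (bigD1 (true, j)) //= lerD2l (bigD1 (false, j)) //=.
apply: ler_wpDr; first by apply: sumr_ge0.
by rewrite -[leRHS]mulr1 ler_pM ?rnorm_ge0 // rnorm_iK.
Qed.

HB.instance Definition _ := Uniform_isComplete.Build (row_normed UL)
  (@finite_coordinates_complete R F _ _ _ _ _ rho_bound rho_rebuild).

End RowNorm.

(** * Maximal equiangular tight frames *)

Section MaximalETF.
Variables (R : realType) (F : scalar_field) (m : nat).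
Local Notation K := (scalars R F).
Local Notation conj := (@conjK R F).
Local Notation re := (@reK R F).
Local Notation ofr := (@ofR R F).
Local Notation adj := (@adjmx R F _ _).

Lemma norm2_sqr d (x : 'cV[K]_d) : norm2 x ^+ 2 = \sum_i rnorm (x i ord0) ^+ 2.
Proof. by rewrite sqr_sqrtr // sumr_ge0 // => i _; rewrite sqr_ge0. Qed.

Lemma innerE d N (A B : 'M[K]_(d, N)) i j : inner (col i A) (col j B) = (adj B *m A) j i.
Proof.
by rewrite /inner mxE; apply: eq_bigr => a _; rewrite adjmxE !mxE mulrC.
Qed.

Lemma norm2_gram d N (A : 'M[K]_(d, N)) i :
  ofr (norm2 (col i A) ^+ 2) = (adj A *m A) i i.
Proof.
rewrite norm2_sqr mxE rmorph_sum; apply: eq_bigr => a _.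
by rewrite adjmxE mulrC mul_conjK mxE.
Qed.

(** Evaluating the form at y + H y leaves only the cross terms, which for hermitian H add up to 2 |H
    y|^2. This works over both fields. *)
Lemma hermitian_form_eq0 d (H : 'M[K]_d) : adj H = H ->
  (forall x : 'cV_d, adj x *m H *m x = 0) -> H = 0.
Proof.
move=> Ha h.
have adjD (x y : 'cV[K]_d) : adj (x + y) = adj x + adj y.
  by rewrite /adjmx raddfD map_mxD.
have Hy (y : 'cV[K]_d) : H *m y = 0.
  have h1 := h y; have h2 := h (H *m y); have := h (y + H *m y).
  rewrite adjmxM Ha !mulmxA in h2.
  rewrite adjD adjmxM Ha !mulmxDl !mulmxDr !mulmxA h1 h2 add0r addr0.
  set a := adj y *m H *m H *m y; rewrite -mulr2n => /eqP a0.
  have {}a0 : a = 0.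
    by move: a0; rewrite -scaler_nat scaler_eq0 pnatr_eq0 => /eqP.
  have : adj (H *m y) *m adj (adj (H *m y)) = 0.
    by rewrite adjmxK adjmxM Ha -a0 /a !mulmxA.
  by move/mulmx_adj_eq0 => e0; rewrite -[H *m y]adjmxK e0 adjmx0.
apply/matrixP => i j; rewrite mxE.
by have := congr1 (fun M : 'cV[K]_d => M i ord0) (Hy (delta_mx j ord0)); rewrite -colE !mxE.
Qed.

Lemma adj_mul_cV n (v : 'cV[K]_n) :
  adj v *m v = (ofr (\sum_i rnorm (v i ord0) ^+ 2))%:M.
Proof.
apply/matrixP => i j; rewrite (ord1 i) (ord1 j) mxE [RHS]mxE eqxx mulr1n rmorph_sum.
by apply: eq_bigr => l _; rewrite adjmxE mulrC mul_conjK.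
Qed.

Lemma tight_frame_gram d N (U : 'M[K]_(d, N)) : tight_frame U ->
  exists2 a : R, 0 < a & ofr a *: (U *m adj U) = 1%:M.
Proof.
move=> [a a0 h]; exists a => //.
apply/eqP; rewrite -subr_eq0; apply/eqP/hermitian_form_eq0.
  by rewrite adjmxB adjmx1 adjmxZ conjK_ofR adjmxM adjmxK.
move=> x; rewrite mulmxBr mulmxBl mulmx1.
suff -> : adj x *m (ofr a *: (U *m adj U)) *m x = adj x *m x by rewrite subrr.
rewrite -scalemxAr -scalemxAl !mulmxA -[adj x *m U]adjmxK adjmxM adjmxK.
rewrite -mulmxA !adj_mul_cV -(norm2_sqr x) h scale_scalar_mx -rmorphM /=; congr (ofr (_ * _))%:M.
apply: eq_bigr => i _; congr (rnorm _ ^+ 2).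
by rewrite /inner mxE; apply: eq_bigr => l _; rewrite adjmxE !mxE mulrC.
Qed.

Lemma gram_tight_frame d N (V : 'M[K]_(d, N)) (r : R) : 0 < r ->
  V *m adj V = 1%:M -> tight_frame ((ofr r)^-1 *: V).
Proof.
move=> r0 VV; exists (r ^+ 2); first by rewrite exprn_gt0.
move=> x; rewrite norm2_sqr mulr_sumr.
have : adj x *m x = adj (adj V *m x) *m (adj V *m x).
  by rewrite adjmxM adjmxK mulmxA -[adj x *m V *m _]mulmxA VV mulmx1.
rewrite !adj_mul_cV => /(congr1 (fun M : 'M[K]_1 => M ord0 ord0)).
rewrite !mxE eqxx !mulr1n => /ofR_inj ->.
apply: eq_bigr => i _.
have -> : inner x (col i ((ofr r)^-1 *: V)) = ofr r^-1 * (adj V *m x) i ord0.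
  rewrite /inner mxE mulr_sumr; apply: eq_bigr => l _.
  by rewrite adjmxE !mxE rmorphM -fmorphV /= conjK_ofR; ring.
rewrite rnormM rnorm_ofR exprMn real_normK ?num_real // exprVn mulrA divff ?mul1r //.
by rewrite sqrf_eq0 lt0r_neq0.
Qed.

Hypothesis hm : (2 <= m)%N.
Local Notation M := (max_etf_size F m).
Local Notation p := (etf_angle R F m).

Let mu_gt0 : 0 < m%:R :> R. Proof. by rewrite ltr0n (leq_trans _ hm). Qed.

Let M_gt0 : 0 < M%:R :> R.
Proof. by rewrite ltr0n (leq_ltn_trans _ (max_etf_size_gt R F hm)). Qed.

Let M_gt1 : 1 < M%:R :> R.
Proof. by rewrite (ltr_nat R 1) (leq_ltn_trans _ (max_etf_size_gt R F hm)) // ltnW. Qed.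

Let mu_ge2 : 2 <= m%:R :> R. Proof. by rewrite (ler_nat R 2). Qed.

Let e_itv : real_flag R F = 0 \/ real_flag R F = 1.
Proof. by rewrite /real_flag; case: F; [right|left]. Qed.

Let welch : M%:R - m%:R = m%:R * p ^+ 2 * (M%:R - 1) :> R :=
  welch_bound (etf_angleE R F hm) e_itv (max_etf_sizeE R F m).

(** Both parameters are forced: the trace gives the frame constant a = m / M, and comparing a
    diagonal entry of G = G^2 with the squares in its row gives the Welch equality, hence the angle
    p. *)
Lemma maximal_etf_projection (U : 'M[K]_(m, M)) : equiangular_tight_frame U ->
  exists V : 'M[K]_(m, M), [/\ V *m adj V = 1%:M,
    forall i, (adj V *m V) i i = ofr (m%:R / M%:R) &
    forall i j, i != j -> rnorm ((adj V *m V) i j) = m%:R / M%:R * p].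
Proof.
move=> [/tight_frame_gram[a a0 aU] U1 [c Uc]].
have Udiag i : (adj U *m U) i i = 1 by rewrite -norm2_gram U1 expr1n rmorph1.
have aE : a = m%:R / M%:R.
  apply: (canRL (mulfK (lt0r_neq0 M_gt0))); apply: (@ofR_inj R F).
  rewrite rmorph_nat -(mxtrace1 K m) -aU mxtraceZ mxtrace_mulC rmorphM /=; congr (_ * _).
  rewrite /mxtrace (eq_bigr (fun=> 1)) => [|i _]; last exact: Udiag.
  by rewrite sumr_const card_ord rmorph_nat.
pose V := ofr (Num.sqrt a) *: U.
have sa : ofr (Num.sqrt a) * ofr (Num.sqrt a) = ofr a.
  by rewrite -rmorphM -expr2 sqr_sqrtr // ltW.
have VV : V *m adj V = 1%:M.
  by rewrite /V adjmxZ conjK_ofR -scalemxAr -scalemxAl scalerA sa.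
have VG : adj V *m V = ofr a *: (adj U *m U).
  by rewrite /V adjmxZ conjK_ofR -scalemxAr -scalemxAl scalerA sa.
have offdiag i j : i != j -> rnorm ((adj V *m V) i j) = a * c.
  move=> ij; rewrite VG mxE rnormM rnorm_ofR ger0_norm ?(ltW a0) //; congr (_ * _).
  by rewrite -innerE Uc // eq_sym.
have diag i : (adj V *m V) i i = ofr a by rewrite VG mxE Udiag mulr1.
have c0 : 0 <= c.
  have h1 : (1 < M)%N by move: M_gt1; rewrite (ltr_nat R 1).
  by rewrite -(Uc (Ordinal (ltnW h1)) (Ordinal h1)) // rnorm_ge0.
have cE : c = p.
  have [pV _] := orthoproj_of_isometry VV.
  have h1 : (1 < M)%N by move: M_gt1; rewrite (ltr_nat R 1).
  pose i0 := Ordinal h1.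
  have := orthoproj_tight pV i0.
  rewrite (bigD1 i0) //= diag rnorm_ofR (gtr0_norm a0) reK_ofR.
  rewrite (eq_bigr (fun=> (a * c) ^+ 2)) => [|j ji]; last by rewrite offdiag // eq_sym.
  rewrite sumr_const cardC1 card_ord -mulr_natr -subn1 natrB ?(ltnW h1) // => h.
  have p0 := etf_angle_gt0 R F hm.
  have h2 : a * (M%:R - 1) * c ^+ 2 = 1 - a.
    apply: (mulfI (lt0r_neq0 a0)); move: h; rewrite exprMn; lra.
  have h3 : a * (M%:R - 1) * p ^+ 2 = 1 - a.
    apply: (mulIf (lt0r_neq0 M_gt0)); rewrite aE.
    have -> : m%:R / M%:R * (M%:R - 1) * p ^+ 2 * M%:R = m%:R * p ^+ 2 * (M%:R - 1) * (M%:R / M%:R) by ring.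
    by rewrite -welch divff ?lt0r_neq0 // mulr1 mulrBl mul1r mulfVK // lt0r_neq0.
  have /eqP : c ^+ 2 = p ^+ 2.
    have aM : a * (M%:R - 1) != 0 by rewrite lt0r_neq0 // mulr_gt0 // subr_gt0.
    by apply: (mulfI aM); rewrite h2 h3.
  by rewrite eqrXn2 // ?(ltW p0) // => /eqP.
exists V; split=> // [i|i j ij]; first by rewrite diag aE.
by rewrite offdiag // aE cE.
Qed.

(** * Extremal projections from a maximal equiangular tight frame *)

Section Extremal.
Variable V : 'M[K]_(m, M).
Hypotheses (VV : V *m adj V = 1%:M)
  (Vdiag : forall i, (adj V *m V) i i = ofr (m%:R / M%:R))
  (Voff : forall i j, i != j -> rnorm ((adj V *m V) i j) = m%:R / M%:R * p).

Let G0 := adj V *m V.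

(* The matrix of signs of the entries of [G0]; it is a polynomial in [G0]. *)
Let S0 : 'M[K]_M := ofr (M%:R / (m%:R * p)) *: G0 + (ofr (1 - p^-1))%:M.

Let p0 : 0 < p. Proof. exact: etf_angle_gt0. Qed.

Let S0E i j : S0 i j = ofr (M%:R / (m%:R * p)) * G0 i j + ofr (1 - p^-1) *+ (i == j).
Proof. by rewrite [LHS]mxE [X in X + _]mxE [X in _ + X]mxE. Qed.

Let S0diag i : S0 i i = 1.
Proof.
rewrite S0E eqxx mulr1n Vdiag -rmorphM -rmorphD -[RHS](rmorph1 ofr); congr ofr.
by field; rewrite !lt0r_neq0.
Qed.

Let S0off i j : i != j -> rnorm (S0 i j) = 1.
Proof.
move=> ij; rewrite S0E (negbTE ij) mulr0n addr0 rnormM rnorm_ofR Voff // ger0_norm.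
  by field; rewrite !lt0r_neq0.
by rewrite divr_ge0 ?mulr_ge0 // ltW.
Qed.

Let S0comm : S0 *m G0 = G0 *m S0.
Proof.
by rewrite mulmxDl mulmxDr -scalemxAl -scalemxAr mul_scalar_mx mul_mx_scalar.
Qed.

Let S0trace : re (\tr (S0 *m G0)) = m%:R * (1 + (M%:R - 1) * p).
Proof.
have [[_ GG] trG] := orthoproj_of_isometry VV.
rewrite mulmxDl -scalemxAl mul_scalar_mx GG raddfD /= !mxtraceZ trG -(rmorph_nat ofr).
rewrite raddfD /= !reK_ofRM reK_ofR.
have E : M%:R = m%:R * p ^+ 2 * (M%:R - 1) + m%:R :> R by rewrite -welch subrK.
rewrite {1}E; field.
by rewrite !lt0r_neq0.
Qed.

Lemma max_abs_proj_const_ge :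
  ((max_proj_value R F m)%:E <= max_abs_proj_const R F m)%E.
Proof.
have I1 : (1%:M : 'M[K]_M) *m 1%:M = 1%:M by rewrite mulmx1.
pose Y : completeNormedModType K := row_normed VV.
(* This is l_inf^M. Presenting it as [row_normed] for the identity matrix provides the completeness
   that [abs_proj_const] asks of the ambient space. *)
pose X : completeNormedModType K := row_normed I1.
pose j (c : Y) : X := (c : 'rV[K]_m) *m V.
have lj : linear j by move=> a x y; rewrite /j mulmxDl -scalemxAl.
pose j' : {linear Y -> X} := HB.pack j (GRing.isLinear.Build K Y X *:%R j lj).
pose f (v : 'rV[K]_M) : X := v.
have lf : linear f by [].
pose f' : {linear 'rV[K]_M -> X} := HB.pack f (GRing.isLinear.Build K 'rV[K]_M X *:%R f lf).
pose h (x : X) : 'rV[K]_M := x.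
have lh : linear h by [].
pose h' : {linear X -> 'rV[K]_M} := HB.pack h (GRing.isLinear.Build K X 'rV[K]_M *:%R h lh).
have normX (x : X) : rnorm x = rnorm (x : 'rV[K]_M) by rewrite row_normedE mulmx1.
apply: (@le_trans _ _ (abs_proj_const Y)); last first.
  apply: ereal_sup_ubound; exists Y; split=> //.
  exists (fun i => (delta_mx ord0 i : 'rV[K]_m) : Y).
  have sumE (c : 'I_m -> K) : \sum_i c i *: (delta_mx ord0 i : 'rV[K]_m) = \row_i c i.
    by rewrite [RHS]row_sum_delta; apply: eq_bigr => i _; rewrite mxE.
  split=> [c|]; first by move=> /= hc i; have := congr1 (fun x : 'rV[K]_m => x ord0 i) hc;
    rewrite (sumE c) !mxE.
  apply/seteqP; split=> // y _; exists (fun i => (y : 'rV[K]_m) ord0 i).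
  by rewrite (sumE _); apply/rowP => i; rewrite mxE.
apply: (@le_trans _ _ (proj_const (range j'))); last first.
  apply: ereal_sup_ubound; exists X, j'; split=> // y.
  by rewrite !rnormE normX row_normedE.
apply: le_ereal_inf_tmp => _ [P [Pc PY Py] ->].
have -> : max_proj_value R F m = re (\tr (S0 *m G0)) / M%:R.
  by rewrite S0trace /max_proj_value mulrAC.
have VG : V *m G0 = V by rewrite /G0 mulmxA VV mul1mx.
apply: (@opnorm_ge_trace R F X M _ f' h' P G0 S0) => //.
- by rewrite -(ltr0n R).
- by move=> v; rewrite normX.
- by move=> x; rewrite normX.
- by move=> v; have [y _ <-] := PY (f v); rewrite /= /h /j -mulmxA VG.
- move=> v; rewrite /= /h /f Py //; exists (v *m adj V : 'rV[K]_m) => //.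
  by rewrite /= /j -mulmxA.
move=> i l; have [->|il] := eqVneq i l; first by rewrite S0diag rnorm1.
by rewrite S0off.
Qed.

(** * The k-fold copy and its complement *)

Variable k : nat.
Hypothesis hk : (1 <= k)%N.
Local Notation N := (k * M)%N.

(* The index set of N = k M elements is the product of a k-set and an M-set. *)
Let ix (u : 'I_k * 'I_M) : 'I_N := mxvec_index u.1 u.2.
Let pr (i : 'I_N) : 'I_M := (enum_val (cast_ord (esym (mxvec_cast k M)) i)).2.

Let prE u : pr (ix u) = u.2.
Proof. by rewrite /pr /ix /mxvec_index cast_ordK enum_rankK; case: u. Qed.

Let ix_inj : injective ix.
Proof.
by move=> [a b] [a' b'] /cast_ord_inj /enum_rank_inj.
Qed.

Let sum_pr (V' : nmodType) (f : 'I_M -> V') : \sum_i f (pr i) = (\sum_i f i) *+ k.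
Proof.
rewrite (reindex ix) /=; last first.
  by exists (fun i => enum_val (cast_ord (esym (mxvec_cast k M)) i)) => [u _|i _];
    rewrite /ix /mxvec_index ?cast_ordK ?enum_rankK -?surjective_pairing ?enum_valK ?cast_ordKV //; case: u.
rewrite (eq_bigr (fun u : 'I_k * 'I_M => f u.2)) => [|u _]; last by rewrite prE.
rewrite -(pair_big xpredT xpredT (fun _ => f)) /=.
by rewrite sumr_const card_ord.
Qed.

Let kr : k%:R != 0 :> R. Proof. by rewrite pnatr_eq0 -lt0n. Qed.

Let G : 'M[K]_N := \matrix_(i, j) (ofr k%:R^-1 * G0 (pr i) (pr j)).
Let S : 'M[K]_N := \matrix_(i, j) S0 (pr i) (pr j).

Let pG : orthoproj G.
Proof.
have [[Ga GG] _] := orthoproj_of_isometry VV.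
split; first by apply/matrixP => i j; rewrite adjmxE [G j i]mxE [RHS]mxE rmorphM /= conjK_ofR -[G0 in RHS]Ga adjmxE.
apply/matrixP => i j; rewrite mxE.
rewrite (eq_bigr (fun l => ofr (k%:R^-1 ^+ 2) * (G0 (pr i) (pr l) * G0 (pr l) (pr j)))); last first.
  by move=> l _; rewrite [G i l]mxE [G l j]mxE rmorphXn /=; ring.
rewrite (sum_pr (fun l => ofr (k%:R^-1 ^+ 2) * (G0 (pr i) l * G0 l (pr j)))) -mulr_sumr.
have -> : \sum_l G0 (pr i) l * G0 l (pr j) = (G0 *m G0) (pr i) (pr j) by rewrite mxE.
rewrite GG [RHS]mxE -[LHS]mulr_natr -(rmorph_nat ofr k) mulrAC -rmorphM; congr (ofr _ * _).
by field.
Qed.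

Let trG : \tr G = m%:R.
Proof.
rewrite /mxtrace (eq_bigr (fun i => ofr k%:R^-1 * G0 (pr i) (pr i))) => [|i _]; last by rewrite mxE.
rewrite (sum_pr (fun i => ofr k%:R^-1 * G0 i i)) -mulr_sumr -[LHS]mulr_natr mulrAC.
rewrite -(rmorph_nat ofr k) -rmorphM mulVf // rmorph1 mul1r.
by have [_ <-] := orthoproj_of_isometry VV.
Qed.

Let SGE i j : (S *m G) i j = (S0 *m G0) (pr i) (pr j).
Proof.
rewrite mxE (eq_bigr (fun l => ofr k%:R^-1 * (S0 (pr i) (pr l) * G0 (pr l) (pr j)))); last first.
  by move=> l _; rewrite [S i l]mxE [G l j]mxE mulrCA.
rewrite (sum_pr (fun l => ofr k%:R^-1 * (S0 (pr i) l * G0 l (pr j)))) -mulr_sumr -[LHS]mulr_natr mulrAC.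
by rewrite -(rmorph_nat ofr k) -rmorphM mulVf // rmorph1 mul1r [RHS]mxE.
Qed.

Let GSE i j : (G *m S) i j = (G0 *m S0) (pr i) (pr j).
Proof.
rewrite mxE (eq_bigr (fun l => ofr k%:R^-1 * (G0 (pr i) (pr l) * S0 (pr l) (pr j)))); last first.
  by move=> l _; rewrite [S l j]mxE [G i l]mxE mulrA.
rewrite (sum_pr (fun l => ofr k%:R^-1 * (G0 (pr i) l * S0 l (pr j)))) -mulr_sumr -[LHS]mulr_natr mulrAC.
by rewrite -(rmorph_nat ofr k) -rmorphM mulVf // rmorph1 mul1r [RHS]mxE.
Qed.

Let SG : S *m G = G *m S.
Proof. by apply/matrixP => i j; rewrite SGE GSE S0comm. Qed.

Let H := 1%:M - G.
(** The sign matrix of 1 - G: off the diagonal the signs of G are reversed, and on the diagonal 2 -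
    1 = 1 matches the positive entry of 1 - G. *)
Let Q := (2%:M - S : 'M[K]_N).

Let Q1 i j : rnorm (Q i j) <= 1.
Proof.
have -> : Q i j = 2 *+ (i == j) - S0 (pr i) (pr j) by rewrite [LHS]mxE [X in X + _]mxE [X in _ + X]mxE [S i j]mxE.
have [->|ij] := eqVneq i j.
  by rewrite S0diag mulr1n -[2]natr1 addrK rnorm1.
rewrite mulr0n sub0r rnormN; have [->|pij] := eqVneq (pr i) (pr j).
  by rewrite S0diag rnorm1.
by rewrite S0off.
Qed.

Let QH : Q *m H = H *m Q.
Proof.
rewrite /Q /H !mulmxBl !mulmxBr !mulmx1 !mul1mx mul_scalar_mx mul_mx_scalar SG.
by rewrite !opprD !opprK addrACA.
Qed.

Let N_gt0 : (0 < N)%N.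
Proof. by rewrite muln_gt0 hk -(ltr0n R). Qed.

Definition rel_value : R := max_proj_value R F m - 2 * m%:R / N%:R + 1.

Let QHtrace : re (\tr (Q *m H)) / N%:R = rel_value.
Proof.
have NR : N%:R != 0 :> R by rewrite pnatr_eq0 -lt0n.
have trS : \tr S = N%:R.
  rewrite /mxtrace (eq_bigr (fun=> 1)) => [|i _]; last by rewrite mxE S0diag.
  by rewrite sumr_const card_ord.
have trSG : re (\tr (S *m G)) = k%:R * (m%:R * (1 + (M%:R - 1) * p)).
  rewrite -S0trace /mxtrace (eq_bigr (fun i => (S0 *m G0) (pr i) (pr i))) => [|i _]; last exact: SGE.
  by rewrite (sum_pr (fun i => (S0 *m G0) i i)) raddfMn /= mulr_natl.
have -> : \tr (Q *m H) = ofr (N%:R *+ 2 - N%:R - m%:R *+ 2) + \tr (S *m G).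
  rewrite /Q /H mulmxBr mulmx1 mulmxBl !raddfB /= mxtrace_scalar mul_scalar_mx mxtraceZ trG trS.
  have ofr_nat n : ofr n%:R = n%:R by rewrite rmorph_nat.
  have ofr_nat2 n : ofr (n%:R *+ 2) = n%:R *+ 2 by rewrite rmorphMn /= ofr_nat.
  have e2 : 2 *+ N = N%:R *+ 2 :> K by rewrite -mulrnA mulnC mulrnA.
  by rewrite !ofr_nat2 ofr_nat e2 mulr_natl opprK addrA.
rewrite raddfD /= reK_ofR trSG /rel_value /max_proj_value natrM.
by field; rewrite kr lt0r_neq0.
Qed.

Let pH : orthoproj H. Proof. exact: orthoproj_compl. Qed.

Let m_lt_N : (m < N)%N.
Proof. by rewrite (leq_trans (max_etf_size_gt R F hm)) // leq_pmull. Qed.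

Let trH : \tr H = (N - m)%:R.
Proof. by rewrite /H raddfB /= mxtrace1 trG natrB // ltnW. Qed.

Let N0 : N%:R != 0 :> R. Proof. by rewrite pnatr_eq0 -lt0n. Qed.

Let HE i j : H i j = (i == j)%:R - ofr k%:R^-1 * G0 (pr i) (pr j).
Proof. by rewrite [LHS]mxE [X in X + _]mxE [X in _ + X]mxE [G i j]mxE. Qed.

Let Hdiag i : H i i = ofr ((N - m)%:R / N%:R).
Proof.
rewrite HE eqxx Vdiag -rmorphM -(rmorph1 ofr) -rmorphB; congr ofr.
rewrite natrB ?(ltnW m_lt_N) // natrM; field.
by rewrite kr lt0r_neq0.
Qed.

Let Hoff i j : i != j ->
  rnorm (H i j) = m%:R / N%:R * (if pr i == pr j then 1 else p).
Proof.
move=> ij; rewrite HE (negbTE ij) sub0r rnormN rnormM rnorm_ofR ger0_norm ?invr_ge0 //.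
have [->|pij] := eqVneq.
  rewrite Vdiag rnorm_ofR ger0_norm ?divr_ge0 // natrM; field.
  by rewrite kr lt0r_neq0.
rewrite Voff // natrM; field.
by rewrite kr lt0r_neq0.
Qed.

Lemma max_rel_proj_const_ge :
  (rel_value%:E <= max_rel_proj_const R F (N - m) N)%E.
Proof.
have [W [WW WH]] := orthoproj_gram pH trH.
have Wfree (c : 'rV_(N - m)) : c *m W = 0 -> c = 0.
  by move=> cW; rewrite -[c]mulmx1 -WW mulmxA cW mul0mx.
have WHW : W *m H = W by rewrite -WH mulmxA WW mul1mx.
apply: (@le_trans _ _ (proj_const [set x : 'rV[K]_N | exists c : 'rV_(N - m), x = c *m W])); last first.
  by apply: ereal_sup_ubound; eexists; split; [exact: rowspace_has_dim Wfree|].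
apply: le_ereal_inf_tmp => _ [P [Pc PY Py] ->].
rewrite -QHtrace.
apply: (@opnorm_ge_trace R F _ N N_gt0 idfun idfun P H Q) => //.
- by move=> v /=; have [c ->] := PY v; rewrite -mulmxA WHW.
- by move=> v /=; apply: Py; exists (v *m adj W); rewrite -mulmxA WH.
Qed.

(** Off the diagonal the moduli for [G'] and its complement coincide. On the diagonal both
    projections have nonnegative entries, so the modulus of 1 - [G']_ii is 1 minus that of
    [G']_ii. *)
Let complement_sum (G' : 'M[K]_N) (t : 'I_N -> R) : orthoproj G' ->
  \sum_i t i ^+ 2 = 1 ->
  \sum_i \sum_j t i * t j * rnorm ((1%:M - G') i j) =
  1 - 2 * (\sum_i t i ^+ 2 * rnorm (G' i i)) + \sum_i \sum_j t i * t j * rnorm (G' i j).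
Proof.
move=> pG' t1; rewrite -[X in _ = X - _ + _]t1 mulr_sumr -sumrB -big_split; apply: eq_bigr => i _ /=.
have E i' j : (1%:M - G') i' j = (i' == j)%:R - G' i' j by rewrite [LHS]mxE [X in X + _]mxE [X in _ + X]mxE.
rewrite (bigD1 i) //= [in RHS](bigD1 i) //= addrA; congr (_ + _); last first.
  by apply: eq_bigr => j ji; rewrite E eq_sym (negbTE ji) sub0r rnormN.
rewrite (orthoproj_diagE (orthoproj_compl pG')) orthoproj_diagE // E eqxx raddfB /=.
by rewrite -(rmorph1 ofr) reK_ofR; ring.
Qed.

Let rel_bound (G' : 'M[K]_N) (t : 'I_N -> R) : orthoproj G' -> \tr G' = (N - m)%:R ->
  (forall i, 0 <= t i) -> \sum_i t i ^+ 2 = 1 ->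
  \sum_i \sum_j t i * t j * rnorm (G' i j) <= rel_value.
Proof.
move=> pG' trG' t0 t1; have pC := orthoproj_compl pG'.
have trC : \tr (1%:M - G') = m%:R.
  by rewrite raddfB /= mxtrace1 trG' natrB ?(ltnW m_lt_N) // opprB addrCA subrr addr0.
have := projection_sum_diag_le hm pC trC t0 t1 hk erefl.
have := complement_sum pC t1; rewrite opprB addrCA subrr addr0 => ->.
by rewrite /rel_value; lra.
Qed.

Let t (i : 'I_N) : R := Num.sqrt N%:R^-1.

Let t_norm : \sum_i t i ^+ 2 = 1.
Proof.
rewrite (eq_bigr (fun=> N%:R^-1)) => [|i _]; last by rewrite sqr_sqrtr // invr_ge0.
by rewrite sumr_const card_ord -[LHS]mulr_natr mulVf.
Qed.

(** The general upper bound gives one inequality. The other is the trace inequality for H as a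
    projection onto its own range, since at uniform weights the sum is the average of the column
    sums. *)
Let rel_value_attained :
  \sum_i \sum_j t i * t j * rnorm (H i j) = rel_value.
Proof.
apply/eqP; rewrite eq_le rel_bound //=; last by move=> i; exact: sqrtr_ge0.
have [_ HH] := pH; have := trace_le_entries HH HH QH Q1.
rewrite -QHtrace => h; rewrite ler_pdivrMr ?ltr0n //; apply: le_trans h _.
rewrite mulr_suml le_eqVlt; apply/orP; left; apply/eqP; apply: eq_bigr => j _.
rewrite mulr_suml; apply: eq_bigr => i _.
rewrite (orthoproj_normC pH) /t -expr2 sqr_sqrtr ?invr_ge0 //.
by rewrite mulrAC mulVf // mul1r.
Qed.

Lemma max_rel_proj_constE : max_rel_proj_const R F (N - m) N = rel_value%:E.
Proof.
apply/eqP; rewrite eq_le max_rel_proj_const_ge andbT.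
apply: max_rel_proj_const_le; last exact: rel_bound.
rewrite -rel_value_attained; do 2!(apply: sumr_ge0 => ? _).
by rewrite !mulr_ge0 ?sqrtr_ge0 ?rnorm_ge0.
Qed.

Let r : R := Num.sqrt ((N - m)%:R / N%:R).

Let d_gt0 : 0 < (N - m)%:R :> R. Proof. by rewrite ltr0n subn_gt0. Qed.

Let r_gt0 : 0 < r. Proof. by rewrite sqrtr_gt0 divr_gt0 // ltr0n. Qed.

Let r2 : r ^+ 2 = (N - m)%:R / N%:R. Proof. by rewrite sqr_sqrtr // divr_ge0. Qed.

(** The part common to both kinds of frames: any Gram factor W of H with uniform weights attains the
    value, and its columns have equal norms because the diagonal of H is constant. *)
Let attained (P : 'M[K]_(N - m, N) -> Prop) :
  (forall W : 'M[K]_(N - m, N), W *m adj W = 1%:M -> adj W *m W = H ->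
     P ((ofr r)^-1 *: W)) ->
  attained_by P.
Proof.
move=> hP; have [W [WW WH]] := orthoproj_gram pH trH.
exists W, t; split=> //.
- by move=> i; exact: sqrtr_ge0.
- by rewrite t_norm sqrtr1.
- by rewrite WH rel_value_attained max_rel_proj_constE.
exists r; split=> //; last exact: hP.
move=> i; have : norm2 (col i W) ^+ 2 = r ^+ 2.
  by apply: (@ofR_inj R F); rewrite norm2_gram WH Hdiag r2.
by move/eqP; rewrite eqrXn2 ?sqrtr_ge0 // => /eqP.
Qed.

(** * Angles of the rescaled frame *)

Section Rescaled.
Variable W : 'M[K]_(N - m, N).
Hypotheses (WW : W *m adj W = 1%:M) (WH : adj W *m W = H).
Let W' := (ofr r)^-1 *: W.

Let gramW' : adj W' *m W' = ofr (r ^- 2) *: H.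
Proof.
rewrite /W' -fmorphV /= adjmxZ conjK_ofR -scalemxAr -scalemxAl scalerA WH -rmorphM.
by rewrite -expr2 exprVn.
Qed.

Lemma rescaled_tight : tight_frame W'.
Proof. exact: gram_tight_frame. Qed.

Lemma rescaled_norm i : norm2 (col i W') = 1.
Proof.
have : norm2 (col i W') ^+ 2 = 1 ^+ 2.
  apply: (@ofR_inj R F); rewrite norm2_gram gramW' mxE Hdiag -r2 -rmorphM mulVf ?expr1n //.
  by rewrite sqrf_eq0 lt0r_neq0.
by move/eqP; rewrite eqrXn2 ?sqrtr_ge0 // => /eqP.
Qed.

Lemma rescaled_inner i j : i != j -> rnorm (inner (col i W') (col j W')) =
  m%:R / (N - m)%:R * (if pr i == pr j then 1 else p).
Proof.
move=> ij; rewrite innerE gramW' mxE rnormM rnorm_ofR (orthoproj_normC pH) Hoff //.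
rewrite ger0_norm ?invr_ge0 ?exprn_ge0 ?(ltW r_gt0) // r2 mulrA.
congr (_ * _); field.
by rewrite kr !lt0r_neq0.
Qed.

End Rescaled.

Lemma attained_equiangular : k = 1%N ->
  attained_by (@equiangular_tight_frame R F (N - m) N).
Proof.
move=> k1; apply: attained => W WW WH; split.
- exact: rescaled_tight.
- by move=> i; exact: rescaled_norm.
exists (m%:R / (N - m)%:R * p) => i j ij.
rewrite rescaled_inner //; case: eqP => // pij; exfalso.
move: ij; apply/negP; rewrite negbK.
(* For k = 1 the copy index takes only one value, so equal projections force equal indices and the
   value for repeated vectors never occurs. *)
pose iv := fun i : 'I_N => enum_val (cast_ord (esym (mxvec_cast k M)) i).
have iv1 : (iv i).1 = (iv j).1.
  by apply: val_inj; case: (iv i).1 => a /=; case: (iv j).1 => b /=; rewrite k1; case: a b => [|?] [|?].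
have : iv i = iv j by rewrite [iv i]surjective_pairing [iv j]surjective_pairing iv1 -/(pr i) pij.
by move/enum_val_inj/cast_ord_inj => ->.
Qed.

Lemma attained_biangular : (2 <= k)%N ->
  attained_by (@biangular_tight_frame R F (N - m) N).
Proof.
move=> k2; apply: attained => W WW WH; split.
- exact: rescaled_tight.
- by exists 1 => i; exact: rescaled_norm.
exists (m%:R / (N - m)%:R * 1), (m%:R / (N - m)%:R * p).
have md : m%:R / (N - m)%:R != 0 :> R by rewrite lt0r_neq0 // divr_gt0.
split.
  (* The two values differ because p < 1. *)
  apply: contraTneq (equiangular_lt1 mu_ge2 p0 (etf_angleE R F hm) e_itv) => h.
  by rewrite (mulfI md h) ltxx.
have M1 : (1 < M)%N by move: M_gt1; rewrite (ltr_nat R 1).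
apply/seteqP; split=> x.
  move=> [i [j [ij ->]]]; rewrite rescaled_inner //.
  by case: eqP => _; [left|right].
case=> ->.
  (* The larger value occurs for one vector in two different copies. *)
  exists (ix (Ordinal (ltnW k2), Ordinal M1)), (ix (Ordinal k2, Ordinal M1)).
  have ne : ix (Ordinal (ltnW k2), Ordinal M1) != ix (Ordinal k2, Ordinal M1).
    by rewrite (inj_eq ix_inj).
  by split=> //; rewrite rescaled_inner // !prE eqxx.
(* The smaller value occurs for two different vectors in the same copy. *)
exists (ix (Ordinal k2, Ordinal (ltnW M1))), (ix (Ordinal k2, Ordinal M1)).
have ne : ix (Ordinal k2, Ordinal (ltnW M1)) != ix (Ordinal k2, Ordinal M1).
  by rewrite (inj_eq ix_inj).
by split=> //; rewrite rescaled_inner // !prE.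
Qed.

End Extremal.

Lemma max_abs_proj_const_le_value :
  (max_abs_proj_const R F m <= (max_proj_value R F m)%:E)%E.
Proof.
apply: max_abs_proj_const_le => [|N G t pG trG t0 t1]; last exact: projection_sum_le.
have pp := etf_angle_gt0 R F hm.
by rewrite /max_proj_value mulr_ge0 ?divr_ge0 // addr_ge0 // mulr_ge0 ?(ltW pp) // subr_ge0 ltW.
Qed.

End MaximalETF.

Theorem theorem3p1 (R : realType) (F : scalar_field) (m : nat)
    (hm : (2 <= m)%N)
    (hETF : exists U : 'M[scalars R F]_(m, max_etf_size F m),
        equiangular_tight_frame U)
    (k : nat) (hk : (1 <= k)%N) :
  let N := (k * max_etf_size F m)%N in
  let d := (N - m)%N in
  [/\ max_rel_proj_const R F d N
        = (max_abs_proj_const R F m - ((2 * m)%:R / N%:R)%:E + 1)%E,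
      (k = 1%N -> attained_by (@equiangular_tight_frame R F d N)) &
      ((2 <= k)%N -> attained_by (@biangular_tight_frame R F d N))].
Proof.
move=> N d; have [U hU] := hETF.
have [V [VV Vdiag Voff]] := maximal_etf_projection hm hU.
split; last 2 first.
- by move=> k1; apply: (attained_equiangular hm VV Vdiag Voff hk k1).
- by move=> k2; apply: (attained_biangular hm VV Vdiag Voff hk k2).
have -> : max_abs_proj_const R F m = (max_proj_value R F m)%:E.
  apply/eqP; rewrite eq_le max_abs_proj_const_le_value //=.
  exact: (max_abs_proj_const_ge hm VV Vdiag Voff).
rewrite (max_rel_proj_constE hm VV Vdiag Voff hk) /rel_value -(natrM R 2 m).
by rewrite -EFinN -!EFinD.
Qed.
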